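(* (1) Let $a\in\mathbb{I}_1\setminus(K[H]+F)$. Then (a) $\mathrm{Cen}_{\mathbb{I}_1}(a)$ is a finitely generated $K[a]$-module of finite rank $\rho\ge1$. In particular, $\mathrm{Cen}_{\mathbb{I}_1}(a)$ is a finitely generated, left and right Noetherian algebra. (b) Moreover, there is a $K[a]$-module isomorphism $\mathrm{Cen}_{\mathbb{I}_1}(a)\simeq K[a]^\rho\oplus\mathrm{Cen}_F(a)$, and if $-n=\pi_-(a)<0$ (respectively, $m=\pi_+(a)>0$) then $\rho$ divides $n$ (respectively, $m$). (c) $[\mathrm{Cen}_{\mathbb{I}_1}(a),\mathrm{Cen}_{\mathbb{I}_1}(a)]\subseteq\mathrm{Cen}_F(a)$, $\dim_K(\mathrm{Cen}_F(a))<\infty$, and $\mathrm{Cen}_F(a)=\mathrm{tor}_{K[a]}(\mathrm{Cen}_{\mathbb{I}_1}(a))$. (2) Let $a\in(K[H]+F)\setminus(K+F)$, i.e. $a=\alpha+f$ for some polynomial $\alpha\in K[H]\setminus K$ and $f\in F$; let $d:=\deg_F(a)$. Then (a) $\mathrm{Cen}_{\mathbb{I}_1}(a)$ is not a finitely generated $K[a]$-module but has finite rank $\rho:=\deg_H(\alpha)$ (as a $K[a]$-module). (b) $\mathrm{Cen}_{\mathbb{I}_1}(a)$ is not a finitely generated algebra and neither a left nor a right Noetherian algebra. Moreover, it contains infinite direct sums of nonzero left and right ideals. (c) There is a $K[a]$-module isomorphism $\mathrm{Cen}_{\mathbb{I}_1}(a)\simeq K[a]^\rho\oplus\mathrm{Cen}_F(a)$.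 (d) $\mathrm{Cen}_{\mathbb{I}_1}(a)=e_d'K[H]\oplus\mathrm{Cen}_F(a)$ and $$\mathrm{Cen}_F(a)=\bigoplus_{j>d}Ke_{jj}\oplus C_{\alpha,d}\oplus C_{\alpha,d}^*\oplus\mathrm{Cen}_{F_{\le d}}(a_{11})\oplus\Big(\bigoplus_{j>d}\ker_{\mathcal{H}_0}((a_{11}-\alpha(j+1))\cdot)\,e_{0j}\Big)\oplus\bigoplus_{i>d}e_{i0}\ker_{\mathcal{V}_0}(\cdot(a_{11}-\alpha(i+1)))$$ is an infinite direct sum of $K[a]$-modules, where $a_{11}:=\sum_{i=0}^d\alpha(i+1)e_{ii}+f$, $F_{\le d}:=\bigoplus_{i,j=0}^dKe_{ij}$, $\mathcal{H}_0:=\bigoplus_{i=0}^dKe_{i0}$, $\mathcal{V}_0:=\bigoplus_{j=0}^dKe_{0j}$ and $C_{\alpha,d}:=\bigoplus_{i\ge1,j>d}\{Ke_{i+j,j}\mid j+1\text{ is a root of the polynomial }\tau^i(\alpha)-\alpha\}$. (e) $[\mathrm{Cen}_{\mathbb{I}_1}(a),\mathrm{Cen}_{\mathbb{I}_1}(a)]\subseteq\mathrm{Cen}_F(a)$, $\dim_K(\mathrm{Cen}_F(a))=\infty$, and $\mathrm{Cen}_F(a)=\mathrm{tor}_{K[a]}(\mathrm{Cen}_{\mathbb{I}_1}(a))$. (3) Let $a\in(K+F)\setminus K$, i.e. $a=\lambda+f$ for some $\lambda\in K$ and $f=\sum_{i,j=0}^d\lambda_{ij}e_{ij}\in F\setminus\{0\}$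 where $d:=\deg_F(f)$. Then (a) $\mathrm{Cen}_{\mathbb{I}_1}(a)$ is a finitely generated algebra which is neither left nor right Noetherian. Moreover, it contains infinite direct sums of nonzero left and right ideals. In particular, $\mathrm{Cen}_{\mathbb{I}_1}(a)$ is not a finitely generated $K[a]$-module. (b) $\mathrm{Cen}_{\mathbb{I}_1}(a)=\mathrm{Cen}_{F_{\le d}}(f)\oplus\bigoplus_{j>d}\mathcal{K}e_{0j}\oplus\bigoplus_{i>d}e_{i0}\mathcal{K}'\oplus e_d'\mathbb{I}_1e_d'$, where $\mathcal{K}:=\ker_{\oplus_{i=0}^dKe_{i0}}(f\cdot)$ and $\mathcal{K}':=\ker_{\oplus_{j=0}^dKe_{0j}}(\cdot f)$. (c) $[\mathrm{Cen}_{\mathbb{I}_1}(a),\mathrm{Cen}_{\mathbb{I}_1}(a)]\not\subseteq\mathrm{Cen}_F(a)$, $\dim_K(\mathrm{Cen}_F(a))=\infty$, and $\mathrm{tor}_{K[a]}(\mathrm{Cen}_{\mathbb{I}_1}(a))=\mathrm{Cen}_{\mathbb{I}_1}(a)\ne\mathrm{Cen}_F(a)$.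
   Context: $K$ is a field of characteristic zero. $\mathbb{I}_1$ is the subalgebra of $\mathrm{End}_K(K[x])$ generated by (multiplication by) $x$, $\partial=\frac{d}{dx}$ and $\int: x^n\mapsto \frac{x^{n+1}}{n+1}$. Put $H:=\partial x$ and $e_{ij}:=\int^i\partial^j-\int^{i+1}\partial^{j+1}$ ($i,j\ge0$), so $e_{ij}e_{kl}=\delta_{jk}e_{il}$; $F:=\bigoplus_{i,j\ge0}Ke_{ij}$ is an ideal of $\mathbb{I}_1$. Put $v_i:=\int^i$ for $i>0$, $v_0:=1$, $v_i:=\partial^{|i|}$ for $i<0$. Each $a\in\mathbb{I}_1$ is a unique finite sum $a=\sum_{i\in\mathbb{Z}}b_iv_i+\sum_{i,j\ge0}\lambda_{ij}e_{ij}$ with $b_i\in K[H]$, $\lambda_{ij}\in K$. For $a\notin F$: $\pi_+(a):=\max\{i\mid b_i\ne0\}$, $\pi_-(a):=\min\{i\mid b_i\ne0\}$. With $a_F:=\sum\lambda_{ij}e_{ij}$, $\deg_F(a):=\min\{n\ge0\mid a_F\in\bigoplus_{i,j=0}^nKe_{ij}\}$ if $a_F\neq0$, and $\deg_F(a):=-1$ if $a_F=0$. For $d\ge-1$: $e_d:=\sum_{i=0}^de_{ii}$ and $e_d':=1-e_d$ (sums from $0$ to $-1$ are zero). $\tau$ is the automorphism of $K[H]$ with $\tau(H)=H+1$; $\alpha(j+1)$ is the value of $\alpha\in K[H]$ at $H=j+1$. The involution $*$ is the $K$-algebra anti-automorphism of $\mathbb{I}_1$ with $\partial^*=\int$, $\int^*=\partial$,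 $H^*=H$; thus $e_{ij}^*=e_{ji}$. For $a\in\mathbb{I}_1$, $\mathrm{Cen}_{\mathbb{I}_1}(a)$ is the centralizer, $\mathrm{Cen}_F(a):=F\cap\mathrm{Cen}_{\mathbb{I}_1}(a)$, and $\mathrm{Cen}_{F_{\le d}}(b)$ is the set of elements of $F_{\le d}=\bigoplus_{i,j=0}^dKe_{ij}$ commuting with $b$. For a subspace $V$ of $\mathbb{I}_1$, $\ker_V(b\cdot)=\{v\in V\mid bv=0\}$, $\ker_V(\cdot b)=\{v\in V\mid vb=0\}$, where in expressions such as $a_{11}-\alpha(j+1)$ the scalar acts by multiplication. For an algebra $A$, $[A,A]$ is the subspace generated by all commutators. $K[a]$ is the subalgebra generated by $a$; a $K[a]$-module is regarded as a $K[t]$-module with $t$ acting as $a$, its rank is $\dim_{K(t)}(K(t)\otimes_{K[t]}M)$, and $\mathrm{tor}_{K[a]}(M):=\{m\in M\mid p(a)m=0\text{ for some }0\ne p\in K[t]\}$. *)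

(* Defs.v *)
From HB Require Import structures.
From mathcomp Require Import all_boot all_order all_algebra.
From mathcomp Require Import boolp classical_sets functions cardinality fsbigop.

Set Implicit Arguments.
Unset Strict Implicit.
Unset Printing Implicit Defensive.

Import Order.TTheory GRing.Theory Num.Theory.

Local Open Scope classical_set_scope.
Local Open Scope ring_scope.

Section Modules.
Variables (R : nzRingType) (V : lmodType R).

Definition is_submod (S : set V) : Prop :=
  [/\ S 0, forall x y, S x -> S y -> S (x + y) & forall c x, S x -> S (c *: x)].

Record submod := Submod { submod_set :> set V; submodP : is_submod submod_set }.

Definition submod_pred (S : submod) : {pred V} := fun x => `[< submod_set S x >].

Lemma submod_pred_closed (S : submod) : GRing.submod_closed (submod_pred S).
Proof.
case: S => S [S0 SD SZ]; split=> [|c x y]; rewrite !unfold_in /=.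
  exact/asboolP.
by move=> /asboolP Sx /asboolP Sy; apply/asboolP/SD => //; apply: SZ.
Qed.

HB.instance Definition _ (S : submod) :=
  GRing.isSubmodClosed.Build R V (submod_pred S) (submod_pred_closed S).

Record submod_type (S : submod) :=
  SubmodElt { submod_val : V; _ : submod_val \in submod_pred S }.

HB.instance Definition _ (S : submod) := [isSub for @submod_val S].
HB.instance Definition _ (S : submod) := [Choice of submod_type S by <:].
HB.instance Definition _ (S : submod) :=
  [SubChoice_isSubLmodule of submod_type S by <:].

Definition fg_module : Prop :=
  exists s : seq V, smallest is_submod [set` s] = setT.

Definition fam_sum (I : choiceType) (D : set I) (U : I -> set V) : set V :=
  [set x | exists u : I -> V, [/\ forall i, D i -> U i (u i),
     finite_set [set i | D i /\ u i <> 0] & x = \sum_(i \in D) u i]].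

Definition independent (I : choiceType) (D : set I) (U : I -> set V) : Prop :=
  forall u : I -> V, (forall i, D i -> U i (u i)) ->
    finite_set [set i | D i /\ u i <> 0] ->
    \sum_(i \in D) u i = 0 -> forall i, D i -> u i = 0.

Definition is_dsum (I : choiceType) (D : set I) (U : I -> set V) (W : set V)
    : Prop :=
  [/\ forall i, D i -> is_submod (U i), W = fam_sum D U & independent D U].

(* Finite direct sum of the terms of [s], repetitions included. *)
Definition is_dsum_seq (s : seq (set V)) (W : set V) : Prop :=
  is_dsum [set: 'I_(size s)] (fun i => nth set0 s i) W.

End Modules.

Definition mod_iso (R : nzRingType) (M N : lmodType R) : Prop :=
  exists f : {linear M -> N}, bijective f.

Section Algebras.
Variables (K : fieldType) (A : algType K).

Definition is_subalg (S : set A) : Prop :=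
  [/\ is_submod S, S 1 & forall x y, S x -> S y -> S (x * y)].

Lemma subalg_submod (S : set A) : is_subalg S -> is_submod S.
Proof. by case. Qed.

Record subalg := Subalg { subalg_set :> set A; subalgP : is_subalg subalg_set }.

Definition subalg_pred (S : subalg) : {pred A} := fun x => `[< subalg_set S x >].

Lemma subalg_pred_closed (S : subalg) : GRing.subalg_closed (subalg_pred S).
Proof.
case: S => S [[S0 SD SZ] S1 SM]; split=> [|c x y|x y]; rewrite !unfold_in /=.
- exact/asboolP.
- by move=> /asboolP Sx /asboolP Sy; apply/asboolP/SD => //; apply: SZ.
- by move=> /asboolP Sx /asboolP Sy; apply/asboolP/SM.
Qed.

HB.instance Definition _ (S : subalg) :=
  GRing.isSubalgClosed.Build K A (subalg_pred S) (subalg_pred_closed S).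

Record subalg_type (S : subalg) :=
  SubalgElt { subalg_val : A; _ : subalg_val \in subalg_pred S }.

HB.instance Definition _ (S : subalg) := [isSub for @subalg_val S].
HB.instance Definition _ (S : subalg) := [Choice of subalg_type S by <:].
HB.instance Definition _ (S : subalg) :=
  [SubChoice_isSubAlgebra of subalg_type S by <:].

Lemma smallest_subalgP (G : set A) : is_subalg (smallest is_subalg G).
Proof.
split; first split.
- by move=> S [[[S0 _ _] _ _] _].
- move=> x y Gx Gy S SG; have [[[_ SD _] _ _] _] := SG.
  by apply: SD; [apply: Gx | apply: Gy].
- move=> c x Gx S SG; have [[[_ _ SZ] _ _] _] := SG.
  by apply: SZ; apply: Gx.
- by move=> S [[_ S1 _] _].
- move=> x y Gx Gy S SG; have [[_ _ SM] _] := SG.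
  by apply: SM; [apply: Gx | apply: Gy].
Qed.

Definition gen_subalg (G : set A) : subalg := Subalg (smallest_subalgP G).

Definition fg_algebra : Prop :=
  exists s : seq A, smallest is_subalg [set` s] = setT.

Definition left_ideal (I : set A) : Prop :=
  [/\ I 0, forall x y, I x -> I y -> I (x + y) & forall r x, I x -> I (r * x)].

Definition right_ideal (I : set A) : Prop :=
  [/\ I 0, forall x y, I x -> I y -> I (x + y) & forall r x, I x -> I (x * r)].

Definition left_noetherian : Prop :=
  forall I, left_ideal I -> exists s : seq A, I = smallest left_ideal [set` s].

Definition right_noetherian : Prop :=
  forall I, right_ideal I -> exists s : seq A, I = smallest right_ideal [set` s].

Definition has_infinite_dsum (ideal : set A -> Prop) : Prop :=
  exists U : nat -> set A, [/\ forall n, ideal (U n),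
    forall n, U n <> [set 0] & independent [set: nat] U].

Definition commutator_space (S : set A) : set A :=
  smallest (@is_submod K A) [set x * y - y * x | x in S & y in S].

Definition line (x : A) : set A := range (fun c : K => c *: x).

Definition finite_dim (W : set A) : Prop :=
  exists s : seq A, W = smallest (@is_submod K A) [set` s].

Definition centralizer (a : A) : set A := [set x | a * x = x * a].

Definition kerl (W : set A) (b : A) : set A := [set v | W v /\ b * v = 0].
Definition kerr (W : set A) (b : A) : set A := [set v | W v /\ v * b = 0].

End Algebras.

(* [A] as a [K[t]]-module, [t] acting as left multiplication by [a]. *)
Definition tmod (K : fieldType) (A : algType K) (a : A) : Type := A.

Section TMod.
Variables (K : fieldType) (A : algType K) (a : A).

HB.instance Definition _ := GRing.Zmodule.copy (tmod a) A.

Definition tmod_scale (p : {poly K}) (m : tmod a) : tmod a :=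
  (horner_alg a p : A) * (m : A).

Fact tmod_scaleA p q m : tmod_scale p (tmod_scale q m) = tmod_scale (p * q) m.
Proof. by rewrite /tmod_scale mulrA -rmorphM. Qed.

Fact tmod_scale1 : left_id 1 tmod_scale.
Proof. by move=> m; rewrite /tmod_scale rmorph1 mul1r. Qed.

Fact tmod_scaleDr : right_distributive tmod_scale +%R.
Proof. by move=> p m n; rewrite /tmod_scale mulrDr. Qed.

Fact tmod_scaleDl m : {morph tmod_scale^~ m : p q / p + q}.
Proof. by move=> p q; rewrite /tmod_scale rmorphD mulrDl. Qed.

HB.instance Definition _ := GRing.Zmodule_isLmodule.Build {poly K} (tmod a)
  tmod_scaleA tmod_scale1 tmod_scaleDr tmod_scaleDl.

Lemma horner_alg_stable (P : A -> Prop) (p : {poly K}) :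
    P 0 -> (forall x y, P x -> P y -> P (x + y)) ->
    (forall c x, P x -> P (c *: x)) -> (forall x, P x -> P (a * x)) ->
  forall m, P m -> P ((horner_alg a p : A) * m).
Proof.
move=> P0 PD PZ Pa m Pm; elim/poly_ind: p => [|p c IH].
  by rewrite rmorph0 mul0r.
rewrite rmorphD rmorphM /= horner_algX horner_algC mulrDl -scalerAl mul1r.
apply: PD; last exact: PZ.
have -> : (horner_alg a p : A) * a = a * horner_alg a p.
  have := congr1 (horner_alg a) (mulrC p 'X).
  by rewrite !rmorphM /= horner_algX.
by rewrite -mulrA; apply: Pa.
Qed.

Lemma tmod_submod (P : set A) :
    is_submod P -> (forall x, P x -> P (a * x)) -> is_submod (P : set (tmod a)).
Proof.
move=> [P0 PD PZ] Pa; split=> // p x Px.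
exact: horner_alg_stable.
Qed.

End TMod.

Section Rank.
Variable K : fieldType.

Definition torsion (M : lmodType {poly K}) (S : set M) : set M :=
  [set m | S m /\ exists p : {poly K}, p != 0 /\ p *: m = 0].

Local Notation Kt := {fraction {poly K}}.

Definition balanced (M : lmodType {poly K}) (P : zmodType)
    (g : Kt -> M -> P) : Prop :=
  [/\ forall c d m, g (c + d) m = g c m + g d m,
      forall c m n, g c (m + n) = g c m + g c n &
      forall c p m, g (c * tofrac p) m = g c (p *: m)].

(* [T], with pure tensors [tens c m], is the tensor product of [K(t)] and [M]
   over [K[t]], with [K(t)] acting on the left factor. *)
Definition is_tensor (M : lmodType {poly K}) (T : lmodType Kt)
    (tens : Kt -> M -> T) : Prop :=
  [/\ balanced tens, forall c d m, tens (c * d) m = c *: tens d m &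
      forall (P : zmodType) (g : Kt -> M -> P), balanced g ->
        exists! h : T -> P, (forall x y, h (x + y) = h x + h y) /\
                            (forall c m, h (tens c m) = g c m)].

Definition has_rank (M : lmodType {poly K}) (r : nat) : Prop :=
  exists (T : vectType Kt) (tens : Kt -> M -> T),
    is_tensor tens /\ \dim {:T} = r.

End Rank.

Section Endo.
Variable K : fieldType.

Definition endo : Type := {linear {poly K} -> {poly K}}.

HB.instance Definition _ := gen_eqMixin endo.
HB.instance Definition _ := gen_choiceMixin endo.

Implicit Types f g h : endo.

Lemma endoP f g : (forall p, f p = g p) -> f = g.
Proof.
move=> fg; have {}fg : (f : {poly K} -> {poly K}) = g by apply/funext.
case: f g fg => [f cf] [g cg] /= fg; subst g; congr GRing.Linear.Pack.
case: cf cg => [[a1] [b1]] [[a2] [b2]].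
by rewrite (Prop_irrelevance a1 a2) (Prop_irrelevance b1 b2).
Qed.

Definition endo_zero : endo := (\0 : {poly K} -> {poly K}).
Definition endo_opp f : endo := (\- f).
Definition endo_add f g : endo := (f \+ g).
Definition endo_one : endo := @idfun {poly K}.
Definition endo_mul f g : endo := (f \o g).
Definition endo_scale (c : K) f : endo := (c \*: f).

Fact endo_addA : associative endo_add.
Proof. by move=> f g h; apply: endoP => p /=; rewrite addrA. Qed.
Fact endo_addC : commutative endo_add.
Proof. by move=> f g; apply: endoP => p /=; rewrite addrC. Qed.
Fact endo_add0 : left_id endo_zero endo_add.
Proof. by move=> f; apply: endoP => p /=; rewrite add0r. Qed.
Fact endo_addN : left_inverse endo_zero endo_opp endo_add.
Proof. by move=> f; apply: endoP => p /=; rewrite addNr. Qed.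
HB.instance Definition _ := GRing.isZmodule.Build endo
  endo_addA endo_addC endo_add0 endo_addN.

Fact endo_mulA : associative endo_mul.
Proof. by move=> f g h; apply: endoP. Qed.
Fact endo_mul1 : left_id endo_one endo_mul.
Proof. by move=> f; apply: endoP. Qed.
Fact endo_mulr1 : right_id endo_one endo_mul.
Proof. by move=> f; apply: endoP. Qed.
Fact endo_mulDl : left_distributive endo_mul +%R.
Proof. by move=> f g h; apply: endoP. Qed.
Fact endo_mulDr : right_distributive endo_mul +%R.
Proof. by move=> f g h; apply: endoP => p /=; rewrite linearD. Qed.
Fact endo_one_neq0 : endo_one != 0.
Proof.
apply/eqP => /(congr1 (fun f : endo => f 1)) /= /eqP.
by rewrite oner_eq0.
Qed.
HB.instance Definition _ := GRing.Zmodule_isNzRing.Build endo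
  endo_mulA endo_mul1 endo_mulr1 endo_mulDl endo_mulDr endo_one_neq0.

Fact endo_scaleA c d f : endo_scale c (endo_scale d f) = endo_scale (c * d) f.
Proof. by apply: endoP => p /=; rewrite scalerA. Qed.
Fact endo_scale1 : left_id 1 endo_scale.
Proof. by move=> f; apply: endoP => p /=; rewrite scale1r. Qed.
Fact endo_scaleDr : right_distributive endo_scale +%R.
Proof. by move=> c f g; apply: endoP => p /=; rewrite scalerDr. Qed.
Fact endo_scaleDl f : {morph endo_scale^~ f : c d / c + d}.
Proof. by move=> c d; apply: endoP => p /=; rewrite scalerDl. Qed.
HB.instance Definition _ := GRing.Zmodule_isLmodule.Build K endo
  endo_scaleA endo_scale1 endo_scaleDr endo_scaleDl.

Fact endo_scaleAl (c : K) f g : c *: (f * g) = (c *: f) * g.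
Proof. by apply: endoP. Qed.
HB.instance Definition _ := GRing.Lmodule_isLalgebra.Build K endo endo_scaleAl.
Fact endo_scaleAr (c : K) f g : c *: (f * g) = f * (c *: g).
Proof. by apply: endoP => p /=; rewrite linearZ. Qed.
HB.instance Definition _ := GRing.Lalgebra_isAlgebra.Build K endo endo_scaleAr.

Lemma endo_mulE f g p : (f * g) p = f (g p). Proof. by []. Qed.
Lemma endo_addE f g p : (f + g) p = f p + g p. Proof. by []. Qed.
Lemma endo_oneE p : (1 : endo) p = p. Proof. by []. Qed.

Definition mulx (p : {poly K}) : {poly K} := 'X * p.
Fact mulx_linear : linear mulx.
Proof. by move=> c p q; rewrite /mulx mulrDr scalerAr. Qed.
HB.instance Definition _ :=
  GRing.isLinear.Build K {poly K} {poly K} *:%R mulx mulx_linear.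

Definition integ (p : {poly K}) : {poly K} :=
  \sum_(n < size p) (p`_n / n.+1%:R) *: 'X^(n.+1).
Lemma coef_integ p i : (integ p)`_i = if i is j.+1 then p`_j / j.+1%:R else 0.
Proof.
rewrite /integ coef_sum; case: i => [|j].
  by rewrite big1 // => n _; rewrite coefZ coefXn mulr0.
have [ltjp|lepj] := ltnP j (size p); last first.
  rewrite nth_default // mul0r big1 // => n _; rewrite coefZ coefXn eqSS.
  by rewrite [(_ == _)]gtn_eqF ?mulr0 // (leq_trans _ lepj).
rewrite (bigD1 (Ordinal ltjp)) //= coefZ coefXn eqxx mulr1 big1 ?addr0 // => n.
rewrite coefZ coefXn eqSS -val_eqE /= eq_sym => /negPf ->.
by rewrite mulr0.
Qed.
Fact integ_linear : linear integ.
Proof.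
move=> c p q; apply/polyP => -[|i]; rewrite coefD coefZ !coef_integ.
  by rewrite mulr0 addr0.
by rewrite coefD coefZ mulrDl mulrA.
Qed.
HB.instance Definition _ :=
  GRing.isLinear.Build K {poly K} {poly K} *:%R integ integ_linear.

Definition endoX : endo := mulx.
Definition endoD : endo := @deriv K.
Definition endoI : endo := integ.

Definition I1 : algType K := subalg_type (gen_subalg [set endoX; endoD; endoI]).

Fact endoX_I1 : endoX \in subalg_pred (gen_subalg [set endoX; endoD; endoI]).
Proof. by apply/asboolP => S [_]; apply; left; left. Qed.
Fact endoD_I1 : endoD \in subalg_pred (gen_subalg [set endoX; endoD; endoI]).
Proof. by apply/asboolP => S [_]; apply; left; right. Qed.
Fact endoI_I1 : endoI \in subalg_pred (gen_subalg [set endoX; endoD; endoI]).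
Proof. by apply/asboolP => S [_]; apply; right. Qed.

Definition opX : I1 := SubalgElt endoX_I1.
Definition opD : I1 := SubalgElt endoD_I1.
Definition opI : I1 := SubalgElt endoI_I1.

Definition opH : I1 := opD * opX.

Definition e (i j : nat) : I1 := opI ^+ i * opD ^+ j - opI ^+ i.+1 * opD ^+ j.+1.

Definition v (i : int) : I1 :=
  match i with Posz n => opI ^+ n | Negz n => opD ^+ n.+1 end.

Definition Kspan (G : set I1) : set I1 := smallest (@is_submod K I1) G.

Definition KI1 : set I1 := range (fun c : K => c%:A).
Definition KH : set I1 := gen_subalg [set opH].
Definition F : set I1 := Kspan [set x | exists i j, x = e i j].
Definition Fle (d : int) : set I1 :=
  Kspan [set x | exists i j : nat, [/\ i%:Z <= d, j%:Z <= d & x = e i j]].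

Definition evalH (p : {poly K}) : I1 := horner_alg opH p.

(** Normal forms: [a = \sum_i b_i v_i + \sum_(i, j) l_(i, j) e_(i, j)] with
    finite supports.  Every [a] has exactly one, so the choice made by [xget]
    in [nf], [pi_plus], [pi_minus] and [degF] is never arbitrary, except for
    the values of [pi_plus] and [pi_minus] on [F]. *)
Definition normal_form (a : I1) (c : (int -> {poly K}) * (nat * nat -> K)) : Prop :=
  [/\ finite_set [set i | c.1 i <> 0], finite_set [set ij | c.2 ij <> 0] &
      a = \sum_(i \in [set: int]) evalH (c.1 i) * v i
        + \sum_(ij \in [set: nat * nat]) c.2 ij *: e ij.1 ij.2].

Definition nf (a : I1) : (int -> {poly K}) * (nat * nat -> K) :=
  xget (fun=> 0, fun=> 0) [set c | normal_form a c].

Definition pi_plus (a : I1) : int :=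
  xget 0 [set i | (nf a).1 i <> 0 /\ forall k, (nf a).1 k <> 0 -> k <= i].

Definition pi_minus (a : I1) : int :=
  xget 0 [set i | (nf a).1 i <> 0 /\ forall k, (nf a).1 k <> 0 -> i <= k].

Definition Fpart (a : I1) : I1 :=
  \sum_(ij \in [set: nat * nat]) (nf a).2 ij *: e ij.1 ij.2.

Definition degF (a : I1) : int :=
  if Fpart a == 0 then -1
  else (xget 0%N [set n : nat | Fle n (Fpart a) /\
                   forall k : nat, Fle k (Fpart a) -> (n <= k)%N])%:Z.

(* The index bound is the natural number [d + 1], for [d >= -1]. *)
Definition e_le (d : int) : I1 := \sum_(0 <= i < absz (d + 1)) e i i.
Definition e_gt (d : int) : I1 := 1 - e_le d.

(* The elements of [K[H]] are the [evalH p], and [evalH] is injective; [tau] is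
   the automorphism [H |-> H + 1] read on [p]. *)
Definition tau (p : {poly K}) : {poly K} := p \Po ('X + 1).

(** There is exactly one map with these properties. *)
Definition is_star (s : I1 -> I1) : Prop :=
  (forall (c : K) x y, s (c *: x + y) = c *: s x + s y) /\
  (s 1 = 1) /\ (forall x y, s (x * y) = s y * s x) /\ involutive s /\
  (s opD = opI) /\ (s opI = opD) /\ (s opH = opH).

Definition star : I1 -> I1 := @xget (I1 -> I1) id [set s | is_star s].

Lemma centralizer_subalg (a : I1) : is_subalg (centralizer a).
Proof.
split; [split| |] => /=; rewrite /centralizer /=.
- by rewrite mulr0 mul0r.
- by move=> x y ax ay; rewrite mulrDr mulrDl ax ay.
- by move=> c x ax; rewrite -scalerAr -scalerAl ax.
- by rewrite mulr1 mul1r.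
- by move=> x y ax ay; rewrite mulrA ax -mulrA ay mulrA.
Qed.

Definition Cen (a : I1) : subalg I1 := Subalg (centralizer_subalg a).

Definition CenF (a : I1) : set I1 := F `&` Cen a.

Definition CenFle (d : int) (b : I1) : set I1 := Fle d `&` Cen b.

Lemma smallest_submodP (R : nzRingType) (V : lmodType R) (G : set V) :
  is_submod (smallest (@is_submod R V) G).
Proof.
split.
- by move=> S [[S0 _ _] _].
- move=> x y Gx Gy S SG; have [[_ SD _] _] := SG.
  by apply: SD; [apply: Gx | apply: Gy].
- move=> c x Gx S SG; have [[_ _ SZ] _] := SG.
  by apply: SZ; apply: Gx.
Qed.

Lemma Cen_comm (a x : I1) : centralizer a x -> centralizer a (a * x).
Proof. by rewrite /centralizer /= => ax; rewrite -mulrA -ax. Qed.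

Definition Kalg (a : I1) : set I1 := smallest (@is_subalg K I1) [set a].

Lemma Kalg_mul (a x : I1) : Kalg a x -> Kalg a (a * x).
Proof.
move=> ax; have [_ _ SM] := smallest_subalgP [set a].
by apply: SM => // S [_]; apply.
Qed.

Definition Cen_mod (a : I1) : submod (tmod a) :=
  Submod (tmod_submod (subalg_submod (centralizer_subalg a))
            (@Cen_comm a)).

Definition Kalg_mod (a : I1) : submod (tmod a) :=
  Submod (tmod_submod (subalg_submod (smallest_subalgP [set a]))
            (@Kalg_mul a)).

Section IdealF.
Hypothesis charK : [pchar K] =i pred0.

Lemma endoDI : endoD * endoI = 1.
Proof.
apply: endoP => p; rewrite endo_mulE endo_oneE; apply/polyP => i.
rewrite coef_deriv coef_integ /= -[LHS]mulr_natr divfK //.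
by move/pcharf0P: charK => ->.
Qed.

Lemma endoIDX : endoI * endoD * endoX = endoX.
Proof.
apply: endoP => p; rewrite !endo_mulE; apply/polyP => -[|i].
  by rewrite coef_integ coefXM.
rewrite coef_integ coef_deriv coefXM /= -[X in X / _]mulr_natr mulfK //.
by move/pcharf0P: charK => ->.
Qed.

Lemma endoDX : endoD * endoX = endoX * endoD + 1.
Proof.
apply: endoP => p; rewrite endo_addE !endo_mulE endo_oneE.
by rewrite [LHS]derivM derivX mul1r addrC.
Qed.

Lemma opDI : opD * opI = 1.
Proof. exact/val_inj/endoDI. Qed.

Lemma opIDX : opI * opD * opX = opX.
Proof. exact/val_inj/endoIDX. Qed.

Lemma opDX : opD * opX = opX * opD + 1.
Proof. exact/val_inj/endoDX. Qed.

Lemma opD_e0 j : opD * e 0 j = 0.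
Proof. by rewrite /e expr0 expr1 mul1r mulrBr !mulrA opDI mul1r exprS subrr. Qed.

Lemma opD_eS i j : opD * e i.+1 j = e i j.
Proof.
by rewrite /e mulrBr ![opI ^+ _.+1]exprS !mulrA opDI !mul1r.
Qed.

Lemma opI_e i j : opI * e i j = e i.+1 j.
Proof. by rewrite /e mulrBr !mulrA -!exprS. Qed.

Lemma opH_e i j : opH * e i j = i.+1%:R *: e i j.
Proof.
elim: i => [|i IH].
  rewrite scale1r {1}/opH opDX mulrDl mul1r -mulrA opD_e0 mulr0 add0r //.
rewrite -opI_e mulrA.
have -> : opH * opI = opI * opH + opI.
  by rewrite {1}/opH opDX mulrDl mul1r -mulrA opDI mulr1 /opH mulrA opIDX.
by rewrite mulrDl -mulrA IH -scalerAr -[in RHS]natr1 scalerDl scale1r.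
Qed.

Lemma opX_e i j : opX * e i j = i.+1%:R *: e i.+1 j.
Proof.
have -> : opX = opI * opH by rewrite /opH mulrA opIDX.
by rewrite -mulrA opH_e -scalerAr opI_e.
Qed.

Lemma F_e i j : F (e i j).
Proof. by move=> S [_]; apply; exists i, j. Qed.

Lemma F_stable_gen (h : I1) :
  (forall i j, F (h * e i j)) -> forall x, F x -> F (h * x).
Proof.
move=> hF x /(_ [set z | F (h * z)]); apply.
split; last by move=> _ [i [j ->]]; apply: hF.
have [F0 FD FZ] : is_submod F by exact: smallest_submodP.
split=> [|y z|c y] /=.
- by rewrite mulr0.
- by rewrite mulrDr; apply: FD.
- by rewrite -scalerAr; apply: FZ.
Qed.

Lemma F_stable (a x : I1) : F x -> F (a * x).
Proof.
have [F0 FD FZ] : is_submod F by exact: smallest_submodP.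
pose P : set endo :=
  [set y | exists h : I1, val h = y /\ forall x, F x -> F (h * x)].
suff [h [/val_inj ->]] : P (val a) by apply.
have /asboolP /(_ P) := valP a; apply; split; first split; first split.
- by exists 0; split=> // z _; rewrite mul0r.
- move=> _ _ [g [<- gF]] [h [<- hF]]; exists (g + h); split=> // z Fz.
  by rewrite mulrDl; apply: FD; [apply: gF | apply: hF].
- move=> c _ [g [<- gF]]; exists (c *: g); split=> // z Fz.
  by rewrite -scalerAl; apply: FZ; apply: gF.
- by exists 1; split=> // z; rewrite mul1r.
- move=> _ _ [g [<- gF]] [h [<- hF]]; exists (g * h); split=> // z Fz.
  by rewrite -mulrA; apply: gF; apply: hF.
- move=> _ [[->|->]|->].
  + exists opX; split=> //; apply: F_stable_gen => i j.
    by rewrite opX_e; apply: FZ; apply: F_e.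
  + exists opD; split=> //; apply: F_stable_gen => -[|i] j.
      by rewrite opD_e0.
    by rewrite opD_eS; apply: F_e.
  + exists opI; split=> //; apply: F_stable_gen => i j.
    by rewrite opI_e; apply: F_e.
Qed.

Lemma CenF_submod (a : I1) : is_submod (CenF a).
Proof.
have [F0 FD FZ] : is_submod F by exact: smallest_submodP.
have [C0 CD CZ] := subalg_submod (centralizer_subalg a).
split=> [|x y [Fx Cx] [Fy Cy]|c x [Fx Cx]]; split.
- exact: F0.
- exact: C0.
- exact: FD.
- exact: CD.
- exact: FZ.
- exact: CZ.
Qed.

Lemma CenF_mul (a x : I1) : CenF a x -> CenF a (a * x).
Proof. by move=> [Fx Cx]; split; [apply: F_stable | apply: Cen_comm]. Qed.

Definition CenF_mod (a : I1) : submod (tmod a) :=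
  Submod (tmod_submod (CenF_submod a) (@CenF_mul a)).

End IdealF.

Definition CenA (a : I1) : algType K := subalg_type (Cen a).
Definition CenM (a : I1) : lmodType {poly K} := submod_type (Cen_mod a).
Definition KalgM (a : I1) : lmodType {poly K} := submod_type (Kalg_mod a).
Definition CenFM (charK : [pchar K] =i pred0) (a : I1) : lmodType {poly K} :=
  submod_type (CenF_mod charK a).

Definition idx_gt (d : int) : set nat := [set j : nat | d < j%:Z].

Definition H0 (d : int) : set I1 :=
  Kspan [set x | exists i : nat, i%:Z <= d /\ x = e i 0].
Definition V0 (d : int) : set I1 :=
  Kspan [set x | exists j : nat, j%:Z <= d /\ x = e 0 j].

Definition diag_line (j : nat) : set I1 := line (e j j).

Definition C_index (alpha : {poly K}) (d : int) : set (nat * nat) :=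
  [set ij : nat * nat | [/\ (1 <= ij.1)%N, d < ij.2%:Z
                          & root (iter ij.1 tau alpha - alpha) ij.2.+1%:R]].
Definition C_line (ij : nat * nat) : set I1 := line (e (ij.1 + ij.2) ij.2).
Definition C_space (alpha : {poly K}) (d : int) : set I1 :=
  fam_sum (C_index alpha d) C_line.

Definition a11 (alpha : {poly K}) (f : I1) (d : int) : I1 :=
  \sum_(0 <= i < absz (d + 1)) alpha.[i.+1%:R] *: e i i + f.

Definition kerH (b : I1) (alpha : {poly K}) (d : int) (j : nat) : set I1 :=
  [set u * e 0 j | u in kerl (H0 d) (b - alpha.[j.+1%:R]%:A)].
Definition kerV (b : I1) (alpha : {poly K}) (d : int) (i : nat) : set I1 :=
  [set e i 0 * u | u in kerr (V0 d) (b - alpha.[i.+1%:R]%:A)].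

End Endo.

Arguments opX {K}.
Arguments opD {K}.
Arguments opI {K}.
Arguments opH {K}.
Arguments e {K}.
Arguments v {K}.
Arguments KI1 {K}.
Arguments KH {K}.
Arguments F {K}.
Arguments Fle {K}.
Arguments e_le {K}.
Arguments e_gt {K}.
Arguments star {K}.
Arguments H0 {K}.
Arguments V0 {K}.
Arguments diag_line {K}.
Arguments C_line {K}.

(* Main.v *)
Require Import Defs.
From HB Require Import structures.
From mathcomp Require Import all_boot all_order all_algebra all_fingroup.
From mathcomp Require Import boolp classical_sets functions cardinality fsbigop.
From mathcomp Require Import generic_quotient zify ring.

(** Let [u j = x^j / j!]. In this basis of [K[x]], integration and derivation are the
    two shifts and [H] is diagonal, so that the operators become infinite matrices:
    outside of a finite block, the entries along each diagonal are the values of a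
    polynomial, and only finitely many diagonals are not zero ([has_symbol_ex]).
    The ideal F consists of the finite matrices, and the involution is the
    transposition ([starP]). Every operator that is not in F has a degree and a
    polynomial leading coefficient, both multiplicative ([topM]).

    Nonzero degree. If the degree of [a] is [m > 0], then [a] raises all large degrees
    by [m], so that [K[x]] is a finitely generated [K[a]]-module. This controls the
    centralizer. No element of it outside of F lowers degrees ([Cen_deg_ge0]). Its
    elements in F map into small degrees and are determined on generators of [K[x]],
    whence a finite dimension ([CenF_sub_finite]). Leading coefficients of the same
    degree are proportional, since commuting with [a] is a recurrence of step [m]
    ([comm_top_prop]). So the centralizer modulo F is filtered with steps of dimension
    at most one. Elements of minimal degree in each residue class modulo [m] that
    occurs are a basis over [K[a]] ([Fbasis_residues]); the classes form a subgroup of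
    [Z/m], so their number divides [m] ([Fbasis_Cen_dvd]). The same argument applies to
    any [K[a]]-submodule, and this gives the chain conditions. Commutators are in F
    by a descent that uses characteristic zero ([comm_F]). When [a] lowers degrees
    instead, all this is applied to its transpose ([tame_star]), and the number of
    elements of a basis does not depend on the side ([Fbasis_uniq]).

    Degree zero. If [a = alpha(H) + f] with [f] in the block of indices at most [d],
    then [a] is block diagonal: a finite block, followed by the scalars
    [alpha(j + 1)]. When [alpha] is not constant, an element commuting with [a] has only
    its diagonal coefficient in its symbol ([Cen_mod_F]), so that modulo F the
    centralizer is [K[H]], which is free over [K[alpha]] by Euclidean division
    ([Fbasis_zero_degree]). The part in F is determined entry by entry and block by
    block ([CenF_dsum6]). When [alpha] is constant, the whole corner of indices larger
    than [d] commutes with [a] ([scalar_dsum]), and this corner is a copy of the whole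
    algebra ([shift_Cen], [shift_subalg]). In both cases the idempotents [e_jj] with
    [j > d] belong to the centralizer and refute the finiteness conditions
    ([diag_chain], [zero_degree_not_fg_algebra], [scalar_not_fg_module]).

    In all cases where [a] is not in [K + F], the module statements follow from a basis
    modulo F alone ([Fbasis_mod_iso], [Fbasis_rank], [Fbasis_torsion]): what is left
    over is finite dimensional over each element, hence torsion ([CenF_torsion]). *)

Set Implicit Arguments.
Unset Strict Implicit.
Unset Printing Implicit Defensive.

Import Order.TTheory GRing.Theory Num.Theory.

Local Open Scope classical_set_scope.
Local Open Scope ring_scope.

(** As a class, so that the hypothesis, on which almost everything depends, is
    found by instance resolution. *)
Class charZero (K : fieldType) := charZeroP : [pchar K] =i pred0.

(** * The matrix of an integro-differential operator *)

Section Matrices.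
Context {K : fieldType}.
Implicit Types (x y : I1 K) (p : {poly K}).

Definition app x : {linear {poly K} -> {poly K}} := \val x.

(** In the basis [u j] the operators become very simple: [opI] and [opD] are the
    two shifts, [opH] is diagonal and the [e i j] are the matrix units. *)
Definition u (j : nat) : {poly K} := (j`!%:R)^-1 *: 'X^j.

Definition cf x (k j : nat) : K := k`!%:R * (app x (u j))`_k.

Lemma appM x y p : app (x * y) p = app x (app y p). Proof. by []. Qed.
Lemma appD x y p : app (x + y) p = app x p + app y p. Proof. by []. Qed.
Lemma appZ (c : K) x p : app (c *: x) p = c *: app x p. Proof. by []. Qed.
Lemma app1 p : app 1 p = p. Proof. by []. Qed.
Lemma app0 p : app 0 p = 0. Proof. by []. Qed.

Lemma cfD x y k j : cf (x + y) k j = cf x k j + cf y k j.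
Proof. by rewrite /cf appD coefD mulrDr. Qed.
Lemma cfZ c x k j : cf (c *: x) k j = c * cf x k j.
Proof. by rewrite /cf appZ coefZ mulrCA. Qed.
Lemma cf0 k j : cf 0 k j = 0.
Proof. by rewrite /cf app0 coef0 mulr0. Qed.
Lemma cfN x k j : cf (- x) k j = - cf x k j.
Proof. by rewrite -scaleN1r cfZ mulN1r. Qed.
Lemma cfB x y k j : cf (x - y) k j = cf x k j - cf y k j.
Proof. by rewrite cfD cfN. Qed.

Lemma cf_sum I (r : seq I) (P : pred I) (E : I -> I1 K) k j :
  cf (\sum_(i <- r | P i) E i) k j = \sum_(i <- r | P i) cf (E i) k j.
Proof. by elim/big_rec2: _ => [|i y1 y2 _ <-]; rewrite ?cf0 ?cfD. Qed.

Lemma app_eq0P x : app x =1 (fun=> 0) -> x = 0.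
Proof. by move=> x0; apply/val_inj/endoP => p; apply: x0. Qed.

Lemma I1_ind (P : I1 K -> Prop) :
  P 1 -> (forall c x y, P x -> P y -> P (c *: x + y)) ->
  (forall x y, P x -> P y -> P (x * y)) -> P opX -> P opD -> P opI ->
  forall x, P x.
Proof.
move=> P1 PZD PM PX PD PI x.
have P0 : P 0 by rewrite -[0](subrr 1) addrC -scaleN1r; apply: PZD.
pose Q : set (endo K) := [set z | exists h : I1 K, val h = z /\ P h].
suff [h [/val_inj ->]] : Q (val x) by [].
have /asboolP /(_ Q) := valP x; apply; split; first split; first split.
- by exists 0.
- move=> _ _ [g [<- gP]] [h [<- hP]]; exists (g + h); split=> //.
  by rewrite -[g]scale1r; apply: PZD.
- move=> c _ [g [<- gP]]; exists (c *: g); split=> //.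
  by rewrite -[_ *: _]addr0; apply: PZD.
- by exists 1.
- by move=> _ _ [g [<- gP]] [h [<- hP]]; exists (g * h); split=> //; apply: PM.
- by move=> _ [[->|->]|->]; [exists opX|exists opD|exists opI].
Qed.

End Matrices.

Section CharZero.
Context {K : fieldType} {charK : charZero K}.
Implicit Types (x y : I1 K) (p : {poly K}).

Lemma natf_eq0 n : ((n%:R : K) == 0) = (n == 0%N).
Proof. by move/pcharf0P: charK => ->. Qed.

Lemma natSf_neq0 n : (n.+1%:R : K) != 0. Proof. by rewrite natf_eq0. Qed.

Lemma factf_neq0 n : (n`!%:R : K) != 0.
Proof. by rewrite natf_eq0 -lt0n fact_gt0. Qed.

Lemma natf_inj : injective (fun n : nat => n%:R : K).
Proof.
move=> m n /eqP; wlog le_mn : m n / (m <= n)%N => [W|].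
  by case/orP: (leq_total m n) => /W {}W => [/W //|]; rewrite eq_sym => /W.
rewrite eq_sym -subr_eq0 -natrB // natf_eq0 subn_eq0 => le_nm.
by apply/eqP; rewrite eqn_leq le_mn.
Qed.

(** The natural numbers are pairwise distinct in [K], so that they are too many to
    be roots. *)
Lemma poly_nat_eq0 p N : (forall j : nat, (N <= j)%N -> p.[j%:R] = 0) -> p = 0.
Proof.
move=> p0; apply/eqP; apply: contraT => pN0.
have := @max_poly_roots _ p [seq j%:R | j <- iota N (size p)] pN0.
rewrite size_map size_iota ltnn map_inj_uniq ?iota_uniq; last exact: natf_inj.
move=> -> //; apply/allP => _ /mapP [j + ->].
by rewrite mem_iota => /andP[le_Nj _]; apply/rootP/p0.
Qed.

Lemma poly_nat_eq p q N :
  (forall j : nat, (N <= j)%N -> p.[j%:R] = q.[j%:R]) -> p = q.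
Proof.
move=> pq; apply/eqP; rewrite -subr_eq0; apply/eqP.
by apply: (@poly_nat_eq0 _ N) => j le_Nj; rewrite hornerD hornerN pq ?subrr.
Qed.

Lemma poly_nat_neq0 p : p != 0 ->
  exists N, forall j : nat, (N <= j)%N -> p.[j%:R] != 0.
Proof.
elim: {p}(size p) {-2}p (leqnn (size p)) => [|n IH] p le_pn p0.
  by move: le_pn; rewrite leqn0 size_poly_eq0 (negPf p0).
have [[j0 /rootP/factor_theorem [q pq]]|/forallNP no_root] :=
  pselect (exists j : nat, p.[j%:R] = 0); last first.
  by exists 0%N => j _; apply/eqP/no_root.
have q0 : q != 0 by apply: contraNneq p0 => q0; rewrite pq q0 mul0r.
have [|N NP] := IH q _ q0.
  by move: le_pn; rewrite pq size_Mmonic ?monicXsubC // size_XsubC addn2.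
exists (maxn N j0.+1) => j; rewrite geq_max => /andP[le_N lt_j0].
rewrite pq hornerM hornerXsubC mulf_neq0 ?NP // -natrB 1?ltnW //.
by rewrite natf_eq0 -lt0n subn_gt0.
Qed.

Lemma poly_uE p M : (size p <= M)%N -> p = \sum_(l < M) (l`!%:R * p`_l) *: u l.
Proof.
move=> le_pM; rewrite -[p in LHS](take_poly_id le_pM) /take_poly poly_def.
apply: eq_bigr => i _; rewrite /u scalerA mulrAC mulfV ?mul1r //.
exact: factf_neq0.
Qed.

Lemma coef_u k j : (k`!%:R * (u j)`_k : K) = (k == j)%:R.
Proof.
rewrite coefZ coefXn; case: eqP => [->|_]; last by rewrite !mulr0.
by rewrite mulr1 mulfV ?factf_neq0.
Qed.

Lemma cf_app x p k M : (size p <= M)%N ->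
  k`!%:R * (app x p)`_k = \sum_(l < M) cf x k l * (l`!%:R * p`_l).
Proof.
move=> le_pM; rewrite {1}(poly_uE le_pM) linear_sum coef_sum mulr_sumr.
by apply: eq_bigr => l _; rewrite linearZ coefZ mulrCA mulrC.
Qed.

Lemma cf_inj x y : (forall k j, cf x k j = cf y k j) -> x = y.
Proof.
move=> xy; apply/eqP; rewrite -subr_eq0; apply/eqP/app_eq0P => p.
apply/polyP => k; rewrite coef0.
have := cf_app (x - y) k (leqnn (size p)); rewrite big1 => [/eqP|l _].
  by rewrite mulf_eq0 (negPf (factf_neq0 k)) => /eqP.
by rewrite cfB xy subrr mul0r.
Qed.

Lemma cf_col x j : exists N, forall k, (N <= k)%N -> cf x k j = 0.
Proof.
by exists (size (app x (u j))) => k le; rewrite /cf nth_default ?mulr0.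
Qed.

Lemma cf_cols x M :
  exists N, forall k j, (j < M)%N -> (N <= k)%N -> cf x k j = 0.
Proof.
have /choice [g gP] := cf_col x.
exists (\max_(j < M) g j) => k j lt_jM le; apply: gP; apply: leq_trans le.
exact: (leq_bigmax (Ordinal lt_jM)).
Qed.

(** Columns are finite, so a matrix product is a finite sum. *)
Lemma cfM x y k j M : (forall l, (M <= l)%N -> cf y l j = 0) ->
  cf (x * y) k j = \sum_(l < M) cf x k l * cf y l j.
Proof.
move=> y0; rewrite {1}/cf appM (@cf_app x _ k M) //.
apply/leq_sizeP => l /y0 /eqP; rewrite /cf mulf_eq0 (negPf (factf_neq0 l)).
by move=> /eqP.
Qed.

Lemma cfM1 x y k j l0 : (forall l, l != l0 -> cf x k l * cf y l j = 0) ->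
  cf (x * y) k j = cf x k l0 * cf y l0 j.
Proof.
move=> H; have [M MP] := cf_col y j.
have MP' l : (M + l0.+1 <= l)%N -> cf y l j = 0.
  by move=> le; apply: MP; lia.
have lt : (l0 < M + l0.+1)%N by lia.
rewrite (cfM x k MP') (bigD1 (Ordinal lt)) //= big1 ?addr0 // => l.
by rewrite -val_eqE => /H.
Qed.

Lemma cf_neq0M x y k j : (forall l, cf x k l * cf y l j = 0) -> cf (x * y) k j = 0.
Proof. by move=> H; rewrite (@cfM1 _ _ _ _ 0%N). Qed.

Lemma cf1 k j : cf (1 : I1 K) k j = (k == j)%:R.
Proof. by rewrite /cf app1 coef_u. Qed.

Lemma cf_opDM y k j : cf (opD * y) k j = cf y k.+1 j.
Proof.
rewrite /cf appM; have -> p : app opD p = p^`() by [].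
by rewrite coef_deriv factS natrM -mulr_natl; ring.
Qed.

Lemma cf_opIM0 y j : cf (opI * y) 0 j = 0.
Proof.
rewrite /cf appM; have -> p : app opI p = integ p by [].
by rewrite coef_integ mulr0.
Qed.

Lemma cf_opIMS y k j : cf (opI * y) k.+1 j = cf y k j.
Proof.
rewrite /cf appM; have -> p : app opI p = integ p by [].
by rewrite coef_integ factS natrM -mulrA mulrCA [X in _ * X]mulrCA divff ?mulr1 ?natSf_neq0.
Qed.

Lemma cf_opHM y k j : cf (opH * y) k j = k.+1%:R * cf y k j.
Proof.
rewrite /opH -mulrA cf_opDM /cf appM; have -> p : app opX p = 'X * p by [].
by rewrite coefXM factS natrM mulrA.
Qed.

Lemma cf_evalHM p y k j : cf (evalH p * y) k j = p.[k.+1%:R] * cf y k j.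
Proof.
elim/poly_ind: p y => [|p c IH] y; first by rewrite /evalH rmorph0 mul0r horner0 mul0r cf0.
rewrite /evalH rmorphD rmorphM /= horner_algX horner_algC hornerMXaddC.
rewrite mulrDl cfD -mulrA IH cf_opHM -scalerAl mul1r cfZ; ring.
Qed.

Lemma cf_evalH p k j : cf (evalH p) k j = p.[k.+1%:R] * (k == j)%:R.
Proof. by rewrite -[evalH p]mulr1 cf_evalHM cf1. Qed.

Lemma cf_opDXM n y k j : cf (opD ^+ n * y) k j = cf y (k + n) j.
Proof.
elim: n k => [|n IH] k; first by rewrite expr0 mul1r addn0.
by rewrite exprS -mulrA cf_opDM IH addSnnS.
Qed.

Lemma cf_opIXM n y k j :
  cf (opI ^+ n * y) k j = if (n <= k)%N then cf y (k - n) j else 0.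
Proof.
elim: n k => [|n IH] [|k]; rewrite ?expr0 ?mul1r ?subn0 // exprS -mulrA.
  by rewrite cf_opIM0.
by rewrite cf_opIMS IH ltnS subSS.
Qed.

Lemma cf_eM i j y k l : cf (e i j * y) k l = (k == i)%:R * cf y j l.
Proof.
rewrite /e mulrBl -!mulrA cfB !cf_opIXM !cf_opDXM.
case: (ltngtP k i) => [lt|lt|->].
- by rewrite subrr mul0r.
- by rewrite mul0r (_ : k - i + j = k - i.+1 + j.+1)%N ?subrr //; lia.
- by rewrite subnn add0n subr0 mul1r.
Qed.

Lemma cf_e i j k l : cf (e i j : I1 K) k l = ((k == i) && (j == l))%:R.
Proof. by rewrite -[e i j]mulr1 cf_eM cf1 -natrM mulnb. Qed.

Lemma cf_Me y i j k l : cf (y * e i j) k l = cf y k i * (j == l)%:R.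
Proof.
rewrite (@cfM1 _ _ _ _ i) => [|m /negPf mi]; first by rewrite cf_e eqxx.
by rewrite cf_e mi mulr0.
Qed.

Lemma eM i j k l : e i j * e k l = (j == k)%:R *: e i l :> I1 K.
Proof.
apply: cf_inj => m n; rewrite cf_eM cfZ !cf_e -!natrM !mulnb.
by congr (nat_of_bool _)%:R; case: (m == i); case: (j == k).
Qed.

Lemma e_eqM i j l : e i j * e j l = e i l :> I1 K.
Proof. by rewrite eM eqxx scale1r. Qed.

Lemma cf_v i k j : cf (v i : I1 K) k j = (k%:Z == j%:Z + i)%:R.
Proof.
case: i => n; rewrite /v -[_ ^+ _]mulr1.
  have -> : (k%:Z == j%:Z + n%:Z) = (n <= k)%N && (k - n == j)%N by lia.
  by rewrite cf_opIXM cf1; case: ifP.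
have -> : (k%:Z == j%:Z + Negz n) = (k + n.+1 == j)%N by lia.
by rewrite cf_opDXM cf1.
Qed.

End CharZero.

(** * Finitely supported sums and spans *)

Lemma fsum_seq (V : zmodType) (T : choiceType) (D : set T) (s : seq T)
    (E : T -> V) :
  uniq s -> (forall i, i \in s -> D i) ->
  (forall i, D i -> i \notin s -> E i = 0) ->
  \sum_(i \in D) E i = \sum_(i <- s) E i.
Proof.
move=> us sD E0; rewrite (@fsbig_seq _ _ _ _ s _ us); apply/esym/fsbig_widen => // i.
by case=> Di /= /negP; apply: E0.
Qed.

Lemma fsum_fin (V : zmodType) (T : choiceType) (D : set T) (E : T -> V) :
  finite_set [set i | D i /\ E i <> 0] ->
  exists s : seq T, [/\ uniq s, forall i, i \in s -> D i,
    forall i, D i -> i \notin s -> E i = 0 &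
    \sum_(i \in D) E i = \sum_(i <- s) E i].
Proof.
move=> /finite_seqP [s sE]; have sP i : (i \in s) = `[< D i /\ E i <> 0 >].
  apply/idP/asboolP => [|DE]; first by have -> : (i \in s) = [set` s] i :> Prop by []; rewrite -sE.
  by have : [set` s] i by rewrite -sE.
have [us sD sE0] : [/\ uniq (undup s), forall i, i \in undup s -> D i &
    forall i, D i -> i \notin undup s -> E i = 0].
  split=> [|i|i Di]; rewrite ?undup_uniq // mem_undup sP.
    by case/asboolP.
  by move/asboolPn/not_andP => [] // /contrapT.
by exists (undup s); split=> //; apply: fsum_seq.
Qed.

Lemma fsum1 (V : zmodType) (T : choiceType) (D : set T) (E : T -> V) i0 :
  D i0 -> (forall i, D i -> i <> i0 -> E i = 0) -> \sum_(i \in D) E i = E i0.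
Proof.
move=> Di0 E0; rewrite (@fsum_seq _ _ _ [:: i0]) ?big_seq1 //.
  by move=> i; rewrite inE => /eqP ->.
by move=> i Di; rewrite inE => /eqP; apply: E0.
Qed.

Lemma fsum_morph (V W : zmodType) (T : choiceType) (D : set T) (E : T -> V)
    (phi : V -> W) :
  phi 0 = 0 -> {morph phi : x y / x + y} ->
  finite_set [set i | D i /\ E i <> 0] ->
  phi (\sum_(i \in D) E i) = \sum_(i \in D) phi (E i).
Proof.
move=> phi0 phiD /fsum_fin [s [us sD sE ->]].
rewrite (fsum_seq us) //; first by elim/big_rec2: _ => // i y1 y2 _ <-.
by move=> i Di /(sE _ Di) ->.
Qed.

Section Spans.
Context {R : nzRingType} {V : lmodType R}.
Implicit Types (S W : set V).

Lemma submod_sum S (I : Type) (r : seq I) (P : pred I) (E : I -> V) :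
  is_submod S -> (forall i, P i -> S (E i)) -> S (\sum_(i <- r | P i) E i).
Proof.
by case=> S0 SD _ SE; elim/big_rec: _ => // i x Pi Sx; apply: SD => //; apply: SE.
Qed.

Lemma submodN S x : is_submod S -> S x -> S (- x).
Proof. by move=> [_ _ SZ] Sx; rewrite -scaleN1r; apply: SZ. Qed.

Lemma submodB S x y : is_submod S -> S x -> S y -> S (x - y).
Proof. by move=> SS Sx Sy; have [_ SD _] := SS; apply: SD => //; apply: submodN. Qed.

Lemma submod_fsum S (I : choiceType) (D : set I) (E : I -> V) :
  is_submod S -> finite_set [set i | D i /\ E i <> 0] ->
  (forall i, D i -> S (E i)) -> S (\sum_(i \in D) E i).
Proof.
move=> SS /fsum_fin [s [_ sD _ ->]] SE; rewrite big_seq.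
by apply: submod_sum => // i /sD; apply: SE.
Qed.

Lemma span_least (G S : set V) :
  is_submod S -> G `<=` S -> smallest (@is_submod R V) G `<=` S.
Proof. by move=> SS GS x; apply; split. Qed.

Lemma gen_in_span (G : set V) : G `<=` smallest (@is_submod R V) G.
Proof. by move=> x Gx S [_]; apply. Qed.

Lemma span_seqP (s : seq V) x :
  smallest (@is_submod R V) [set` s] x ->
  exists c : 'I_(size s) -> R, x = \sum_i c i *: s`_i.
Proof.
pose S := [set x | exists c : 'I_(size s) -> R, x = \sum_i c i *: s`_i].
apply: (@span_least _ S); last first.
  move=> y /= ys; exists (fun i => (i == index y s :> nat)%:R).
  have lt : (index y s < size s)%N by rewrite index_mem.
  rewrite (bigD1 (Ordinal lt)) //= eqxx scale1r nth_index // big1 ?addr0 // => i.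
  by rewrite -val_eqE => /negPf /= ->; rewrite scale0r.
split=> [|_ _ [c ->] [d ->]|k _ [c ->]].
- by exists (fun=> 0); rewrite big1 // => i _; rewrite scale0r.
- exists (fun i => c i + d i); rewrite -big_split /=.
  by apply: eq_bigr => i _; rewrite scalerDl.
- exists (fun i => k * c i); rewrite scaler_sumr.
  by apply: eq_bigr => i _; rewrite scalerA.
Qed.

Section Families.
Context {I : choiceType} {D : set I} {U : I -> set V}.
Hypothesis U_submod : forall i, D i -> is_submod (U i).

Lemma fam_sum_sub W :
  is_submod W -> (forall i, D i -> U i `<=` W) -> fam_sum D U `<=` W.
Proof.
move=> WW UW _ [E [UE fE ->]]; apply: submod_fsum => // i Di.
exact/UW/UE.
Qed.

Lemma fam_sum_mem i x : D i -> U i x -> fam_sum D U x.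
Proof.
move=> Di Ux; exists (fun j => if j == i then x else 0); split.
- move=> j Dj; case: eqP => [->//|_].
  by have [] := U_submod Dj.
- apply: (sub_finite_set _ (finite_set1 i)) => j /= [_].
  by case: eqP => [->|].
- by rewrite (fsum1 Di) ?eqxx // => j _ /eqP /negPf ->.
Qed.

Lemma fam_sum_submod : is_submod (fam_sum D U).
Proof.
split.
- exists (fun=> 0); split=> [i Di||]; first by case: (U_submod Di).
    by apply: (sub_finite_set _ (@finite_set0 I)) => i [].
  by rewrite fsbig1.
- move=> _ _ [E [UE fE ->]] [E' [UE' fE' ->]].
  have f2 : finite_set [set i | D i /\ E i + E' i <> 0].
    apply: (@sub_finite_set _ _ ([set i | D i /\ E i <> 0]
                                 `|` [set i | D i /\ E' i <> 0])).
      move=> i [Di]; have [Ei|Ei _] := pselect (E i = 0); last by left.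
      by rewrite Ei add0r; right.
    by rewrite finite_setU.
  exists (fun i => E i + E' i); split=> // [i Di|].
    by have [_ + _] := U_submod Di; apply; [apply: UE|apply: UE'].
  have [s [us sD sE sEE]] := fsum_fin fE.
  have [s' [us' sD' sE' sEE']] := fsum_fin fE'.
  have us'' := undup_uniq (s ++ s').
  have sD'' i : i \in undup (s ++ s') -> D i.
    by rewrite mem_undup mem_cat => /orP [/sD|/sD'].
  rewrite !(fsum_seq us'') -?big_split // => i Di;
    rewrite mem_undup mem_cat negb_or => /andP [/(sE _ Di) h /(sE' _ Di) h'] //.
  by rewrite h h' addr0.
- move=> k _ [E [UE fE ->]]; exists (fun i => k *: E i); split=> [i Di||].
  + by have [_ _] := U_submod Di; apply; apply: UE.
  + apply: sub_finite_set fE => i [Di kE]; split=> // Ei.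
    by apply: kE; rewrite Ei scaler0.
  + by apply: (@fsum_morph _ _ _ _ _ ( *:%R k)); rewrite ?scaler0 // => x y;
      rewrite scalerDr.
Qed.

End Families.
End Spans.

(** * Symbols and normal forms *)

Lemma finite_intP (A : set int) :
  finite_set A <-> exists B : nat, forall i, A i -> (`|i| < B)%N.
Proof.
split=> [/finite_seqP [s ->]|[B AB]].
  exists (\max_(i <- s) `|i|%N).+1 => i /= si; rewrite ltnS.
  exact: (@leq_bigmax_seq _ s xpredT absz _ si isT).
apply: (@sub_finite_set _ _ [set` [seq i%:Z - B%:Z | i <- iota 0 (B + B)]]).
  move=> i /AB lt /=; apply/mapP; exists (absz (i + B%:Z)); last by lia.
  by rewrite mem_iota; lia.
exact: finite_seq.
Qed.

Lemma finite_nat2P (A : set (nat * nat)) :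
  finite_set A <-> exists B : nat, forall i j, A (i, j) -> (i < B)%N /\ (j < B)%N.
Proof.
split=> [/finite_seqP [s ->]|[B AB]].
  exists (\max_(i <- s) (i.1 + i.2)%N).+1 => i j /= si.
  have := @leq_bigmax_seq _ s xpredT (fun i : nat * nat => i.1 + i.2)%N _ si isT => /=; lia.
apply: (@sub_finite_set _ _ [set` [seq (i, j) | i <- iota 0 B, j <- iota 0 B]]).
  move=> [i j] /AB [lti ltj] /=.
  by apply/allpairsP; exists (i, j); rewrite /= !mem_iota.
exact: finite_seq.
Qed.

Section Symbols.
Context {K : fieldType} {charK : charZero K}.
Implicit Types (x y a : I1 K) (p : {poly K}).

(** The coefficients of the [v i] in the normal form of [x], read on its matrix:
    outside of a finite block, the [i]-th diagonal of the matrix is given by the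
    values of the polynomial [c i]. *)
Definition has_symbol x (c : int -> {poly K}) := exists B : nat,
  (forall i, (B <= `|i|)%N -> c i = 0) /\
  forall k j, (B <= k)%N || (B <= j)%N -> cf x k j = (c (k%:Z - j%:Z)).[k.+1%:R].

Lemma has_symbolZD l x y c d : has_symbol x c -> has_symbol y d ->
  has_symbol (l *: x + y) (fun i => l *: c i + d i).
Proof.
move=> [B [c0 cE]] [B' [d0 dE]]; exists (maxn B B'); split=> [i|k j le].
  by rewrite geq_max => /andP [/c0 -> /d0 ->]; rewrite scaler0 addr0.
rewrite cfD cfZ cE ?dE ?hornerD ?hornerZ //; lia.
Qed.

Lemma has_symbol_evalH p : has_symbol (evalH p) (fun i => if i == 0 then p else 0).
Proof.
exists 1%N; split=> [i|k j le]; first by case: eqP => // ->.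
rewrite cf_evalH (_ : (k%:Z - j%:Z == 0) = (k == j)); last by lia.
by case: eqP => _; rewrite ?mulr1 // horner0 mulr0.
Qed.

Lemma symbol_opDM y c : has_symbol y c ->
  has_symbol (opD * y) (fun i => c (i + 1) \Po ('X + 1)).
Proof.
move=> [B [c0 cE]]; exists B.+1; split=> [i le|k j le].
  by rewrite c0 ?comp_poly0 //; lia.
rewrite cf_opDM cE; last by lia.
rewrite horner_comp !hornerE natr1; congr (c _).[_]; lia.
Qed.

Lemma symbol_opIM y c : has_symbol y c ->
  has_symbol (opI * y) (fun i => c (i - 1) \Po ('X - 1)).
Proof.
move=> [B [c0 cE]]; exists B.+2; split=> [i le|[|k] j le].
- by rewrite c0 ?comp_poly0 //; lia.
- by rewrite cf_opIM0 c0 ?comp_poly0 ?horner0 //; lia.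
rewrite cf_opIMS cE; last by lia.
rewrite horner_comp !hornerE -[k.+2%:R]natr1 addrK; congr (c _).[_]; lia.
Qed.

Lemma symbol_opHM y c : has_symbol y c -> has_symbol (opH * y) (fun i => 'X * c i).
Proof.
move=> [B [c0 cE]]; exists B; split=> [i /c0 ->|k j le]; first by rewrite mulr0.
by rewrite cf_opHM cE // hornerM hornerX.
Qed.

Lemma opXE : opX = opI * opH :> I1 K.
Proof. by rewrite /opH mulrA (opIDX charK). Qed.

(** Having a symbol is preserved by left multiplication by each generator, hence
    by all operators; apply them to [1]. *)
Lemma has_symbol_ex x : exists c, has_symbol x c.
Proof.
suff /(_ 1) : forall y, (exists c, has_symbol y c) -> exists c, has_symbol (x * y) c.
  rewrite mulr1; apply; exists (fun i => if i == 0 then 1 else 0).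
  have -> : (1 : I1 K) = evalH 1 by rewrite /evalH rmorph1.
  exact: has_symbol_evalH.
elim/(@I1_ind K): x => [y|l x x' IH IH' y yc|x x' IH IH' y yc|y|y|y].
- by rewrite mul1r.
- have [[c cP] [d dP]] := (IH _ yc, IH' _ yc).
  by rewrite mulrDl -scalerAl; exists (fun i => l *: c i + d i); apply: has_symbolZD.
- by rewrite -mulrA; apply/IH/IH'.
- by move=> [c /symbol_opHM/symbol_opIM cP]; rewrite opXE -mulrA; eexists; exact: cP.
- by move=> [c /symbol_opDM cP]; eexists; exact: cP.
- by move=> [c /symbol_opIM cP]; eexists; exact: cP.
Qed.

Lemma has_symbol_uniq x c d : has_symbol x c -> has_symbol x d -> c = d.
Proof.
move=> [B [c0 cE]] [B' [d0 dE]]; apply/funext => i.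
apply: (@poly_nat_eq _ _ _ _ (B + B' + absz i).+1) => -[//|k] le.
pose j := absz (k%:Z - i); have <- : k%:Z - j%:Z = i by lia.
by rewrite -cE -?dE //; lia.
Qed.

Lemma evalHC (l : K) : evalH l%:P = l%:A :> I1 K.
Proof. by rewrite /evalH horner_algC. Qed.

Lemma normal_form_cf a c : normal_form a c -> forall k j,
  cf a k j = (c.1 (k%:Z - j%:Z)).[k.+1%:R] + c.2 (k, j).
Proof.
case: c => c l [/= fc fl ->] k j; rewrite cfD.
have cD kk jj : {morph (fun x : I1 K => cf x kk jj) : x y / x + y}.
  by move=> x y; apply: cfD.
congr (_ + _).
  rewrite (@fsum_morph _ _ _ _ _ (fun x => cf x k j)) ?cf0 //; last first.
    apply: sub_finite_set fc => i [_ cv] ci; apply: cv.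
    by rewrite ci /evalH rmorph0 mul0r.
  rewrite (@fsum1 _ _ _ _ (k%:Z - j%:Z)) // => [|i _ ne].
    by rewrite cf_evalHM cf_v subrKC eqxx mulr1.
  rewrite cf_evalHM cf_v (_ : (k%:Z == j%:Z + i) = false) ?mulr0 //; lia.
rewrite (@fsum_morph _ _ _ _ _ (fun x => cf x k j)) ?cf0 //; last first.
  by apply: sub_finite_set fl => i [_ cv] ci; apply: cv; rewrite ci scale0r.
rewrite (@fsum1 _ _ _ _ (k, j)) // => [|[i i'] _ ne].
  by rewrite cfZ cf_e !eqxx mulr1.
rewrite cfZ cf_e /=; case: andP => [[/eqP ki /eqP ij]|]; rewrite ?mulr0 //.
by case: ne; rewrite ki ij.
Qed.

Lemma normal_formE a c : finite_set [set i | c.1 i <> 0] ->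
  finite_set [set ij | c.2 ij <> 0] ->
  (forall k j, cf a k j = (c.1 (k%:Z - j%:Z)).[k.+1%:R] + c.2 (k, j)) ->
  normal_form a c.
Proof.
move=> fc fl aE; split=> //; apply: cf_inj => k j; rewrite aE.
by rewrite (@normal_form_cf _ c).
Qed.

Lemma normal_form_symbol a c : normal_form a c -> has_symbol a c.1.
Proof.
move=> nf; have aE := normal_form_cf nf; case: nf => fc fl _.
have /finite_intP [B BP] := fc; have /finite_nat2P [B' BP'] := fl.
exists (maxn B B'); split=> [i le|k j le].
  by apply: contrapT => /BP; lia.
rewrite aE (_ : c.2 (k, j) = 0) ?addr0 //; apply: contrapT => /BP' []; lia.
Qed.

Lemma symbol_normal_form a c : has_symbol a c -> exists l, normal_form a (c, l).
Proof.
move=> [B [c0 cE]].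
exists (fun kj => cf a kj.1 kj.2 - (c (kj.1%:Z - kj.2%:Z)).[kj.1.+1%:R]).
apply: normal_formE => /= [||k j]; last by rewrite addrC subrK.
- apply/finite_intP; exists B => i; rewrite ltnNge => ci.
  by apply/negP => /c0.
- apply/finite_nat2P; exists B => i j /= ne.
  suff : ~~ ((B <= i)%N || (B <= j)%N) by lia.
  by apply/negP => /cE ?; apply: ne; apply/eqP; rewrite subr_eq0; apply/eqP.
Qed.

Lemma nf_uniq a c : normal_form a c -> nf a = c.
Proof.
move=> ac; apply: xget_unique => //= d ad.
have E1 : d.1 = c.1 by apply: has_symbol_uniq; apply: normal_form_symbol; eassumption.
case: c d => [c l] [d l'] /= in ac ad E1 *; congr pair => //.
apply/funext => -[k j]; have := normal_form_cf ac k j; rewrite (normal_form_cf ad) /=.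
by rewrite E1 => /addrI.
Qed.

Lemma nf_symbol a : has_symbol a (nf a).1.
Proof.
have [c /[dup] ac /symbol_normal_form [l /nf_uniq ->]] := has_symbol_ex a.
exact: ac.
Qed.

Lemma nfP a : normal_form a (nf a).
Proof.
have [l al] := symbol_normal_form (nf_symbol a).
by rewrite (nf_uniq al).
Qed.

(** * The ideal F of finite matrices *)

Definition block_sum N x := \sum_(k < N) \sum_(j < N) cf x k j *: e k j.

Lemma cf_block_sum N x k j :
  cf (block_sum N x) k j = if (k < N)%N && (j < N)%N then cf x k j else 0.
Proof.
rewrite cf_sum; under eq_bigr => k' _.
  rewrite cf_sum; under eq_bigr => j' _ do rewrite cfZ cf_e.
  over.
case: ifP => [/andP [ltk ltj]|].
  rewrite (bigD1 (Ordinal ltk)) //= (bigD1 (Ordinal ltj)) //= !eqxx mulr1.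
  rewrite big1 => [|j']; last by rewrite -val_eqE /= => /negPf ->; rewrite mulr0.
  rewrite addr0 big1 ?addr0 // => k'; rewrite -val_eqE eq_sym /= => /negPf ->.
  by rewrite big1 // => j' _; rewrite mulr0.
move=> /negP n; rewrite big1 // => k' _; rewrite big1 // => j' _.
case: andP; rewrite ?mulr0 // => -[/eqP kk /eqP jj]; case: n.
by rewrite kk -jj !ltn_ord.
Qed.

Lemma Kspan_submod (G : set (I1 K)) : is_submod (Kspan G).
Proof. exact: smallest_submodP. Qed.

Lemma F_submod : is_submod (@F K). Proof. exact: Kspan_submod. Qed.

Lemma supp_submod (R : nat -> nat -> Prop) :
  is_submod [set x : I1 K | forall k j, R k j -> cf x k j = 0].
Proof.
split=> [k j _|x y x0 y0 k j Rkj|l x x0 k j Rkj]; rewrite ?cf0 //.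
- by rewrite cfD x0 ?y0 ?addr0.
- by rewrite cfZ x0 ?mulr0.
Qed.

Lemma FleP d x :
  Fle d x <-> forall k j : nat, ~ (k%:Z <= d /\ j%:Z <= d) -> cf x k j = 0.
Proof.
split=> [|x0].
  apply: (@span_least _ _ _ _ (supp_submod (fun k j => ~ (k%:Z <= d /\ j%:Z <= d)))).
  move=> _ [i [j [id jd ->]]] k l nkl; rewrite cf_e.
  by case: andP => // -[/eqP ki /eqP jl]; case: nkl; rewrite ki -jl.
have [N NE] : exists N : nat, forall k : nat, (k < N)%N = (k%:Z <= d).
  by case: d {x0} => d; [exists d.+1|exists 0%N] => k; lia.
have -> : x = block_sum N x.
  apply: cf_inj => k j; rewrite cf_block_sum; case: ifP => // /negP nkj.
  by apply: x0 => -[kd jd]; apply: nkj; rewrite !NE kd.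
have [_ _ FZ] := Kspan_submod [set x : I1 K | exists i j : nat,
  [/\ i%:Z <= d, j%:Z <= d & x = e i j]].
apply: submod_sum (Kspan_submod _) _ => k _.
apply: submod_sum (Kspan_submod _) _ => j _; apply: FZ; apply: gen_in_span.
by exists k, j; split=> //; rewrite -NE.
Qed.

Lemma Fle_F d : Fle d `<=` @F K.
Proof.
apply: span_least F_submod _ => _ [i [j [_ _ ->]]]; apply: gen_in_span.
by exists i, j.
Qed.

Lemma FP x : F x <-> exists N : nat, forall k j : nat,
  (N <= k)%N || (N <= j)%N -> cf x k j = 0.
Proof.
split=> [|[N NP]]; last first.
  apply: (@Fle_F N%:Z); apply/FleP => k j n; apply: NP; lia.
apply: (@span_least _ _ _ [set x | exists N : nat, forall k j : nat,
  (N <= k)%N || (N <= j)%N -> cf x k j = 0]).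
  split=> [|y z [N NP] [M MP]|l y [N NP]].
  - by exists 0%N => k j _; rewrite cf0.
  - by exists (maxn N M) => k j le; rewrite cfD NP ?MP ?addr0 //; lia.
  - by exists N => k j /NP; rewrite cfZ => ->; rewrite mulr0.
move=> _ [i [j ->]]; exists (maxn i j).+1 => k l le; rewrite cf_e.
by case: andP => // -[/eqP ki /eqP jl]; lia.
Qed.

Lemma F_symbol0 x : F x <-> has_symbol x (fun=> 0).
Proof.
split=> [/FP [N NP]|[B [_ BP]]].
  by exists N; split=> // k j le; rewrite NP ?horner0.
by apply/FP; exists B => k j /BP ->; rewrite horner0.
Qed.

Lemma F_symbol x c : has_symbol x c -> (F x <-> forall i, c i = 0).
Proof.
move=> xc; split=> [/F_symbol0 x0 i|c0]; first by rewrite (has_symbol_uniq xc x0).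
by apply/F_symbol0; have <- : c = fun=> 0 by apply/funext.
Qed.

(** On each diagonal, a polynomial vanishes at all large integers. *)
Lemma F_cols x N : (forall k j, (N <= j)%N -> cf x k j = 0) -> F x.
Proof.
move=> x0; have [c xc] := has_symbol_ex x; apply/(F_symbol xc) => i.
have [B [c0 cE]] := xc.
apply: (@poly_nat_eq0 _ _ _ (B + N + absz i).+1) => -[//|k] le.
pose j := absz (k%:Z - i); have <- : k%:Z - j%:Z = i by lia.
by rewrite -cE ?x0 //; lia.
Qed.

Lemma FM x y : F y -> F (x * y). Proof. exact: F_stable. Qed.

Lemma F0 : F (0 : I1 K). Proof. by have [] := F_submod. Qed.

Lemma FD x y : F x -> F y -> F (x + y). Proof. by have [_ + _] := F_submod; apply. Qed.

Lemma FZ (l : K) x : F x -> F (l *: x).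
Proof. by have [_ _] := F_submod; apply. Qed.

Lemma FN x : F x -> F (- x). Proof. exact: submodN F_submod. Qed.
Lemma FB x y : F x -> F y -> F (x - y). Proof. exact: submodB F_submod. Qed.
Lemma F_eij i j : F (e i j : I1 K). Proof. exact: F_e. Qed.

Lemma F_sum I (r : seq I) (P : pred I) (E : I -> I1 K) :
  (forall i, P i -> F (E i)) -> F (\sum_(i <- r | P i) E i).
Proof. exact: submod_sum F_submod. Qed.

Lemma F_block x : F x -> exists N0, forall N, (N0 <= N)%N -> x = block_sum N x.
Proof.
move=> /FP [N0 NP]; exists N0 => N le; apply: cf_inj => k j.
by rewrite cf_block_sum; case: ifP => // n; apply: NP; lia.
Qed.

Lemma FMr x y : F x -> F (x * y).
Proof.
move=> Fx; elim/(@I1_ind K): y x Fx => [x|l y z IH IH' x Fx|y z IH IH' x Fx|x|x|x].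
- by rewrite mulr1.
- rewrite mulrDr -scalerAr; apply: FD; first by apply: FZ; exact: IH.
  exact: IH'.
- by rewrite mulrA; apply: IH'; apply: IH.
all: move=> /FP [N NP]; apply: (@F_cols _ N.+1) => k j le; apply: cf_neq0M => l.
all: have [leN|ltN] := leqP N l; first by rewrite NP ?leN ?orbT ?mul0r.
all: rewrite [X in _ * X](_ : _ = 0) ?mulr0 //.
- rewrite opXE; case: l ltN => [|l] ltN; first by rewrite cf_opIM0.
  by rewrite cf_opIMS -[opH]mulr1 cf_opHM cf1 (_ : l == j = false) ?mulr0 //; lia.
- by rewrite -[opD]mulr1 cf_opDM cf1 (_ : l.+1 == j = false) //; lia.
- rewrite -[opI]mulr1; case: l ltN => [|l] ltN; first by rewrite cf_opIM0.
  by rewrite cf_opIMS cf1 (_ : l == j = false) //; lia.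
Qed.

End Symbols.

(** * The involution is the transposition of matrices *)

Section Star.
Context {K : fieldType} {charK : charZero K}.
Implicit Types (x y a : I1 K).

Definition transposed x y := forall k j, cf y k j = cf x j k.

Lemma cfM_transposed x y x' y' :
  transposed x x' -> transposed y y' -> transposed (x * y) (y' * x').
Proof.
move=> xx' yy' k j.
have [[M MP] [M' MP']] := (cf_col x' j, cf_col y k).
rewrite (@cfM _ _ _ _ _ _ (M + M')) => [|l le]; last by apply: MP; lia.
rewrite (@cfM _ _ _ _ _ _ (M + M')) => [|l le]; last by apply: MP'; lia.
by apply: eq_bigr => l _; rewrite mulrC xx' yy'.
Qed.

Lemma transposed1 : transposed 1 1.
Proof. by move=> k j; rewrite !cf1 eq_sym. Qed.

Lemma transposed_opD : transposed opD opI.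
Proof.
move=> k j; rewrite -[opD]mulr1 -[opI]mulr1 cf_opDM cf1.
by case: k => [|k]; rewrite ?cf_opIM0 ?cf_opIMS ?cf1 // eqSS eq_sym.
Qed.

Lemma transposed_sym x y : transposed x y -> transposed y x.
Proof. by move=> xy k j. Qed.

Lemma transposed_opH : transposed opH opH.
Proof.
move=> k j; rewrite -[opH]mulr1 !cf_opHM !cf1 eq_sym.
by case: eqP => [->|]; rewrite ?mulr0.
Qed.

Lemma transposed_opX : transposed opX (opH * opD).
Proof.
rewrite opXE; apply: cfM_transposed transposed_opH.
exact/transposed_sym/transposed_opD.
Qed.

Lemma transposed_ex x : exists y, transposed x y.
Proof.
elim/(@I1_ind K): x => [|l x y [x' xx'] [y' yy']|x y [x' xx'] [y' yy']|||].
- by exists 1; apply: transposed1.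
- by exists (l *: x' + y') => k j; rewrite !cfD !cfZ xx' yy'.
- by exists (y' * x'); apply: cfM_transposed.
- by eexists; apply: transposed_opX.
- by eexists; apply: transposed_opD.
- by eexists; apply/transposed_sym/transposed_opD.
Qed.

Lemma is_star_transposed s : is_star s -> forall x, transposed x (s x).
Proof.
move=> [sZD [s1 [sM [_ [sD [sI sH]]]]]]; elim/(@I1_ind K) => [|l x y xs ys|x y xs ys|||].
- by rewrite s1; apply: transposed1.
- by move=> k j; rewrite sZD !cfD !cfZ xs ys.
- by rewrite sM; apply: cfM_transposed.
- by rewrite {2}opXE sM sH sI; apply: transposed_opX.
- by rewrite sD; apply: transposed_opD.
- by rewrite sI; apply/transposed_sym/transposed_opD.
Qed.

(** The algebra is stable under transposition, since the transposes of its
    generators lie in it. *)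
Lemma starP : is_star (@star K).
Proof.
apply: xgetPex; have [s sP] := choice transposed_ex.
have sE x y : transposed x y -> s x = y.
  by move=> xy; apply: cf_inj => k j; rewrite sP xy.
exists s; split; [|split; [|split; [|split; [|split; [|split]]]]].
- by move=> l x y; apply: sE => k j; rewrite !cfD !cfZ !sP.
- exact/sE/transposed1.
- by move=> x y; apply/sE/cfM_transposed.
- by move=> x; apply: sE => k j; rewrite sP.
- exact/sE/transposed_opD.
- exact/sE/transposed_sym/transposed_opD.
- exact/sE/transposed_opH.
Qed.

Lemma cf_star x k j : cf (star x) k j = cf x j k.
Proof. exact: is_star_transposed starP x k j. Qed.

Lemma starD x y : star (x + y) = star x + star y.
Proof. by apply: cf_inj => k j; rewrite !(cf_star, cfD). Qed.
Lemma starN x : star (- x) = - star x.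
Proof. by apply: cf_inj => k j; rewrite !(cf_star, cfN). Qed.
Lemma starB x y : star (x - y) = star x - star y.
Proof. by rewrite starD starN. Qed.
Lemma starZ (l : K) x : star (l *: x) = l *: star x.
Proof. by apply: cf_inj => k j; rewrite !(cf_star, cfZ). Qed.
Lemma star0 : star 0 = 0 :> I1 K.
Proof. by apply: cf_inj => k j; rewrite !(cf_star, cf0). Qed.
Lemma star1 : star 1 = 1 :> I1 K.
Proof. by case: starP => _ []. Qed.
Lemma starM x y : star (x * y) = star y * star x.
Proof. by case: starP => _ [_ []]. Qed.
Lemma starK : involutive (@star K).
Proof. by case: starP => _ [_ [_ []]]. Qed.
Lemma star_e i j : star (e i j) = e j i :> I1 K.
Proof. by apply: cf_inj => k l; rewrite cf_star !cf_e andbC (eq_sym j) (eq_sym i). Qed.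

Lemma star_sum I (r : seq I) (P : pred I) (E : I -> I1 K) :
  star (\sum_(i <- r | P i) E i) = \sum_(i <- r | P i) star (E i).
Proof. by elim/big_rec2: _ => [|i y1 y2 _ <-]; rewrite ?star0 ?starD. Qed.

Lemma star_horner a p : star (horner_alg a p) = horner_alg (star a) p.
Proof.
elim/poly_ind: p => [|p l IH]; first by rewrite !rmorph0 star0.
rewrite (mulrC p) !rmorphD !rmorphM /= !horner_algX !horner_algC starD starM starZ star1.
rewrite IH; congr (_ + _); rewrite -{2}(horner_algX (star a)) -rmorphM mulrC.
by rewrite rmorphM /= horner_algX.
Qed.

Lemma star_F x : F x -> F (star x).
Proof.
by move=> /FP [N NP]; apply/FP; exists N => k j le; rewrite cf_star NP // orbC.
Qed.

Lemma star_FE x : F (star x) <-> F x.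
Proof. by split=> [/star_F|/star_F //]; rewrite starK. Qed.

Lemma star_Cen a x : centralizer (star a) (star x) <-> centralizer a x.
Proof.
rewrite /centralizer /= -!starM; split=> [/(congr1 star)|->//].
by rewrite !starK => ->.
Qed.

End Star.

(** * Leading terms *)

Section Top.
Context {K : fieldType} {charK : charZero K}.
Implicit Types (x y a : I1 K) (b : {poly K}).

(** Up to terms of degree less than [j + i], [x] maps [u j] to [b.[j] u_(j + i)]
    for all large [j]. The leading coefficient [b] is a polynomial in [j] and
    not in [H = j + i + 1]; it may vanish, and then [x] has degree less than [i]. *)
Definition top x (i : int) b := exists N : nat, forall j k : nat, (N <= j)%N ->
  (k%:Z = j%:Z + i -> cf x k j = b.[j%:R]) /\ (j%:Z + i < k%:Z -> cf x k j = 0).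

Lemma natr_addz (n k : nat) (i : int) : n%:Z = k%:Z + i -> n%:R = k%:R + i%:~R :> K.
Proof. by move=> nk; rewrite -[n%:R]/(n%:Z%:~R) nk intrD. Qed.

Lemma topZD l x y i b b' : top x i b -> top y i b' -> top (l *: x + y) i (l *: b + b').
Proof.
move=> [N NP] [M MP]; exists (maxn N M) => j k; rewrite geq_max => /andP [leN leM].
have [[x1 x2] [y1 y2]] := (NP _ k leN, MP _ k leM).
rewrite cfD cfZ hornerD hornerZ; split=> h; first by rewrite x1 ?y1.
by rewrite x2 ?y2 // mulr0 addr0.
Qed.

Lemma topZ l x i b : top x i b -> top (l *: x) i (l *: b).
Proof.
move=> [N NP]; exists N => j k /(NP _ k) [x1 x2].
by rewrite cfZ hornerZ; split=> h; [rewrite x1|rewrite x2 ?mulr0].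
Qed.

Lemma topD x y i b b' : top x i b -> top y i b' -> top (x + y) i (b + b').
Proof. by rewrite -[x in x + y]scale1r -[b in b + b']scale1r; apply: topZD. Qed.

Lemma topB x y i b b' : top x i b -> top y i b' -> top (x - y) i (b - b').
Proof.
by rewrite -scaleN1r -[- b']scaleN1r => xb /(topZ (-1)); apply: topD.
Qed.

Lemma top_lt x i i' b : top x i b -> i < i' -> top x i' 0.
Proof.
move=> [N NP] lt; exists N => j k /(NP _ k) [_ x2]; rewrite horner0.
by split=> h; apply: x2; lia.
Qed.

Lemma top_uniq x i b b' : top x i b -> top x i b' -> b = b'.
Proof.
move=> [N NP] [M MP]; apply: (@poly_nat_eq _ _ _ _ (N + M + absz i)) => j le.
pose k := absz (j%:Z + i); have kE : k%:Z = j%:Z + i by lia.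
have [|x1 _] := NP j k; first by lia.
have [|x2 _] := MP j k; first by lia.
by rewrite -x1 ?x2.
Qed.

Lemma top_lt_uniq x i i' b b' : top x i b -> top x i' b' -> b' != 0 -> i' <= i.
Proof.
move=> xb xb' b'0; rewrite leNgt; apply/negP => lt.
by move: b'0; rewrite (top_uniq xb' (top_lt xb lt)) eqxx.
Qed.

Lemma top_deg_uniq x i i' b b' :
  top x i b -> b != 0 -> top x i' b' -> b' != 0 -> i = i'.
Proof.
move=> xb b0 xb' b'0; apply/eqP; rewrite eq_le.
by rewrite (top_lt_uniq xb xb') ?(top_lt_uniq xb' xb).
Qed.

Lemma top_F x i : F x -> top x i 0.
Proof.
by move=> /FP [N NP]; exists N => j k le; split=> _; rewrite ?horner0 NP ?le ?orbT.
Qed.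

Lemma top_notF x i b : top x i b -> b != 0 -> ~ F x.
Proof.
move=> xb b0 Fx; move: b0.
by rewrite (top_uniq xb (top_F i Fx)) eqxx.
Qed.

Lemma top_symbol x c i : has_symbol x c -> (forall k, c k != 0 -> k <= i) ->
  top x i (c i \Po ('X + (i + 1)%:~R%:P)).
Proof.
move=> [B [c0 cE]] ci; exists (B + absz i)%N => j k le; split=> h.
  rewrite cE; last by lia.
  rewrite h addrAC subrr add0r horner_comp !hornerE; congr _.[_].
  by apply: natr_addz; lia.
rewrite cE; last by lia.
have [->|/ci] := eqVneq (c (k%:Z - j%:Z)) 0; first by rewrite horner0.
lia.
Qed.

Lemma comp_XaddC_eq0 b (l : K) : (b \Po ('X + l%:P) == 0) = (b == 0).
Proof. by rewrite comp_poly_eq0 // size_XaddC. Qed.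

Lemma int_max (P : set int) (B : nat) : (exists i, P i) ->
  (forall i, P i -> (absz i < B)%N) -> exists i, P i /\ forall k, P k -> k <= i.
Proof.
move=> [i0 Pi0] PB.
pose Q n := `[< P (n%:Z - B%:Z) >].
have exQ : exists n, Q n.
  exists (absz (i0 + B%:Z)); apply/asboolP; have := PB _ Pi0 => lt.
  by have -> : (absz (i0 + B%:Z))%:Z - B%:Z = i0 by lia.
have QB n : Q n -> (n <= B + B)%N by move=> /asboolP /PB; lia.
case: (ex_maxnP exQ QB) => m /asboolP Pm mP; exists (m%:Z - B%:Z); split=> // k Pk.
have := mP (absz (k + B%:Z)); have lt := PB _ Pk.
have -> : Q (absz (k + B%:Z)).
  by apply/asboolP; have -> : (absz (k + B%:Z))%:Z - B%:Z = k by lia.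
by move=> /(_ isT); lia.
Qed.

Lemma nf_symbol_max x (s : int -> int) : ~ F x -> (forall i, absz (s i) = absz i) ->
  involutive s -> exists m, (nf x).1 (s m) <> 0 /\ forall k, (nf x).1 k <> 0 -> s k <= m.
Proof.
move=> nFx sabs sK; have xc : has_symbol x (nf x).1 by apply: nf_symbol.
have [B [c0 _]] := xc.
have [|i Pi|m [cm mP]] := @int_max [set i | (nf x).1 (s i) <> 0] B.
- apply: contrapT => /forallNP h; apply: nFx; apply/(F_symbol xc) => i.
  by apply: contrapT; rewrite -[i]sK; apply: h.
- by rewrite ltnNge; apply/negP => le; apply: Pi; apply: c0; rewrite sabs.
exists m; split=> // k ck; apply: mP; by rewrite /= sK.
Qed.

Lemma pi_plusP x : ~ F x -> (nf x).1 (pi_plus x) <> 0 /\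
  forall k, (nf x).1 k <> 0 -> k <= pi_plus x.
Proof.
move=> nFx; apply: (@xgetPex _ 0 [set i | (nf x).1 i <> 0 /\ forall k, (nf x).1 k <> 0 -> k <= i]).
exact: (nf_symbol_max (s := id)).
Qed.

Lemma pi_minusP x : ~ F x -> (nf x).1 (pi_minus x) <> 0 /\
  forall k, (nf x).1 k <> 0 -> pi_minus x <= k.
Proof.
move=> nFx; apply: (@xgetPex _ 0 [set i | (nf x).1 i <> 0 /\ forall k, (nf x).1 k <> 0 -> i <= k]).
have [m [cm mP]] := nf_symbol_max nFx abszN (@opprK int).
by exists (- m); split=> // k /mP; rewrite lerNl.
Qed.

Lemma top_pi_plus x : ~ F x -> exists2 b, b != 0 & top x (pi_plus x) b.
Proof.
move=> nFx; have [cm mP] := pi_plusP nFx.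
have xc : has_symbol x (nf x).1 by apply: nf_symbol.
exists ((nf x).1 (pi_plus x) \Po ('X + (pi_plus x + 1)%:~R%:P)).
  by rewrite comp_XaddC_eq0; apply/eqP.
by apply: top_symbol => // k /eqP; apply: mP.
Qed.

Lemma top_ex x : ~ F x -> exists i b, b != 0 /\ top x i b.
Proof. by move=> /top_pi_plus [b b0 xb]; exists (pi_plus x), b. Qed.

Lemma symbol_star x c : has_symbol x c ->
  has_symbol (star x) (fun i => c (- i) \Po ('X - i%:~R%:P)).
Proof.
move=> [B [c0 cE]]; exists B; split=> [i le|k j le].
  by rewrite c0 ?comp_poly0 // abszN.
rewrite cf_star cE; last by rewrite orbC.
rewrite opprB horner_comp hornerD hornerN hornerX hornerC; congr _.[_].
by rewrite -mulrNz; apply: natr_addz; lia.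
Qed.

Lemma top_pi_minus x : ~ F x -> exists2 b, b != 0 & top (star x) (- pi_minus x) b.
Proof.
move=> nFx; have [cm mP] := pi_minusP nFx.
have xc : has_symbol x (nf x).1 by apply: nf_symbol.
eexists; last apply: top_symbol (symbol_star xc) _.
  by rewrite comp_XaddC_eq0 -polyCN comp_XaddC_eq0 opprK; apply/eqP.
by move=> k; rewrite -polyCN comp_XaddC_eq0 => /eqP /mP; rewrite lerNr.
Qed.

(** The finitely many columns of [x] where its leading coefficient is not yet valid
    have bounded height, so that they do not reach the degree [j + i + i']. *)
Lemma topM x y i i' b b' : top x i b -> top y i' b' ->
  top (x * y) (i + i') (b' * (b \Po ('X + i'%:~R%:P))).
Proof.
move=> [N NP] [M MP]; have [B BP] := cf_cols x N.
exists (M + N + B + absz i + absz i')%N => j k le.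
have y0 l : j%:Z + i' < l%:Z -> cf y l j = 0.
  by move=> lt; have [|_ h] := MP j l; [lia|apply: h].
have x0 l : (B <= k)%N -> l%:Z + i < k%:Z -> cf x k l = 0.
  move=> leB; have [leN|ltN _] := leqP N l; last exact: BP.
  by have [_] := NP l k leN; apply.
split=> h.
  rewrite (@cfM1 _ _ _ _ _ _ (absz (j%:Z + i'))) => [|l ne].
    have [|x1 _] := NP (absz (j%:Z + i')) k; first by lia.
    have [|y1 _] := MP j (absz (j%:Z + i')); first by lia.
    rewrite x1 ?y1; try by lia.
    rewrite mulrC hornerM horner_comp !hornerE.
    by rewrite -(@natr_addz (absz (j%:Z + i'))) //; lia.
  have [lt|le'] := ltP (j%:Z + i') l%:Z; first by rewrite y0 ?mulr0.
  by rewrite x0 ?mul0r //; lia.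
apply: cf_neq0M => l.
have [lt|le'] := ltP (j%:Z + i') l%:Z; first by rewrite y0 ?mulr0.
by rewrite x0 ?mul0r //; lia.
Qed.

Lemma topM_neq0 b b' (i' : int) : b != 0 -> b' != 0 ->
  b' * (b \Po ('X + i'%:~R%:P)) != 0.
Proof. by move=> b0 b'0; rewrite mulf_neq0 // comp_XaddC_eq0. Qed.

Lemma lead_topM b b' (i' : int) :
  lead_coef (b' * (b \Po ('X + i'%:~R%:P))) = lead_coef b' * lead_coef b.
Proof.
by rewrite lead_coefM lead_coef_comp ?size_XaddC // lead_coefXaddC expr1n mulr1.
Qed.

Lemma top1 : top (1 : I1 K) 0 1.
Proof.
exists 0%N => j k _; rewrite cf1 hornerC; split=> h.
  by rewrite (_ : k = j) ?eqxx //; lia.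
by have -> : (k == j) = false by lia.
Qed.

Lemma notF1 : ~ F (1 : I1 K).
Proof. exact: top_notF top1 (oner_neq0 _). Qed.

End Top.

(** * Centralizers of operators that raise degrees *)

Section FiniteSpan.
Context {K : fieldType} {V : lmodType K} {W : vectType K}.

(** A subspace that embeds in a finite dimensional space has a finite spanning
    family: any family whose image has the largest possible dimension. *)
Lemma finite_span (S : set V) (phi : {linear V -> W}) :
  is_submod S -> (forall x, S x -> phi x = 0 -> x = 0) ->
  exists s : seq V, S = smallest (@is_submod K V) [set` s].
Proof.
move=> SS phi_inj.
pose P d := `[< exists s : seq V, (forall x, x \in s -> S x) /\
                  \dim <<[seq phi x | x <- s]>>%VS = d >].
have exP : exists d, P d by exists (\dim <<[::] : seq W>>%VS); apply/asboolP; exists [::].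
have Pmax d : P d -> (d <= \dim {:W})%N.
  by move=> /asboolP [s [_ <-]]; apply/dimvS/subvf.
case: (ex_maxnP exP Pmax) => d /asboolP [s [sS sd]] dmax.
exists s; apply/seteqP; split=> [x Sx|]; last by apply: span_least.
set X := [seq phi y | y <- s] in sd.
have Xx : phi x \in <<X>>%VS.
  apply: contraT => nXx.
  have /dmax : P (\dim <<phi x :: X>>%VS).
    apply/asboolP; exists (x :: s); split=> // y; rewrite inE => /orP [/eqP ->//|].
    exact: sS.
  rewrite -sd leqNgt => /negP [].
  rewrite ltn_neqAle dimvS ?span_cons ?addvSr // andbT; apply: contraNneq nXx => dE.
  have /eqP -> : (<<X>> == <[phi x]> + <<X>>)%VS by rewrite eqEdim addvSr -dE leqnn.
  by rewrite (subvP (addvSl _ _)) ?memv_line.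
have [c cE] : exists c : 'I_(size s) -> K, phi x = phi (\sum_i c i *: s`_i).
  have := coord_span (X := in_tuple X) Xx => E.
  have sz : size X = size s by rewrite size_map.
  exists (fun i => coord (in_tuple X) (cast_ord (esym sz) i) (phi x)).
  rewrite linear_sum {1}E (reindex (cast_ord (esym sz))) /=; last first.
    by exists (cast_ord sz) => i _; rewrite ?cast_ordK ?cast_ordKV.
  by apply: eq_bigr => i _; rewrite linearZ (nth_map 0).
have Ss : smallest (@is_submod K V) [set` s] (\sum_i c i *: s`_i).
  have ss := @smallest_submodP _ _ [set` s]; apply: submod_sum => // i _.
  by have [_ _ sZ] := ss; apply: sZ; apply: gen_in_span; apply: mem_nth.
have -> // : x = \sum_i c i *: s`_i.
apply/eqP; rewrite -subr_eq0; apply/eqP; apply: phi_inj; last by rewrite linearB /= cE subrr.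
apply: submodB => //; apply: submod_sum => // i _.
by have [_ _] := SS; apply; apply: sS; apply: mem_nth.
Qed.

End FiniteSpan.

Section Degrees.
Context {K : fieldType} {charK : charZero K}.
Implicit Types (x y a : I1 K) (b p : {poly K}).

Lemma app_bounded x N : exists B, forall p, (size p <= N)%N -> (size (app x p) <= B)%N.
Proof.
have [B BP] := cf_cols x N; exists B => p le; apply/leq_sizeP => k leB.
have := @cf_app _ charK x _ k _ le; rewrite big1 => [/eqP|l _]; last by rewrite BP ?mul0r.
by rewrite mulf_eq0 (negPf (factf_neq0 k)) => /eqP.
Qed.

Lemma top_size x i b : top x i b -> b != 0 ->
  exists N, forall p, (N < size p)%N -> (size (app x p))%:Z = (size p)%:Z + i.
Proof.
move=> [N NP] b0; have [M MP] := poly_nat_neq0 b0; have [B BP] := cf_cols x N.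
exists (N + M + B + absz i)%N => p; case sp : (size p) => [//|l0] le.
have sp' : (size p <= l0.+1)%N by rewrite sp.
have cE k := @cf_app _ charK x _ k _ sp'.
have x0 k l : (B <= k)%N -> l%:Z + i < k%:Z -> cf x k l = 0.
  move=> leB lt; have [leN|ltN] := leqP N l; last exact: BP.
  by have [_] := NP l k leN; apply.
pose k0 := absz (l0%:Z + i).
have cK k : ((app x p)`_k == 0) = (k`!%:R * (app x p)`_k == 0).
  by rewrite mulf_eq0 (negPf (factf_neq0 k)).
suff -> : size (app x p) = k0.+1 by lia.
apply/eqP; rewrite eqn_leq; apply/andP; split.
  apply/leq_sizeP => k lek; apply/eqP; rewrite cK cE big1 // => l _.
  by rewrite x0 ?mul0r //; have := ltn_ord l; lia.
rewrite ltnNge; apply/negP => /leq_sizeP /(_ k0 (leqnn _)) /eqP.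
rewrite cK cE big_ord_recr /= big1 ?add0r => [|l _]; last first.
  by rewrite x0 ?mul0r //; have := ltn_ord l; lia.
have [|x1 _] := NP l0 k0; first by lia.
rewrite x1; last by lia.
rewrite !mulf_eq0 (negPf (factf_neq0 _)) (negPf (MP _ _)) /=; last by lia.
have -> : l0 = (size p).-1 by rewrite sp.
by rewrite -/(lead_coef p) lead_coef_eq0 -size_poly_eq0 sp.
Qed.

Lemma top_pred x i : top x i 0 -> exists b, top x (i - 1) b.
Proof.
move=> x0; have [Fx|nFx] := pselect (F x); first by exists 0; apply: top_F.
have [i' [b [b0 xb]]] := top_ex nFx.
pose proof (top_lt_uniq x0 xb b0) as le.
have [ii|ne] := eqVneq i' i.
  by move: b0; rewrite -ii in x0; rewrite (top_uniq xb x0) eqxx.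
have [ii|ne'] := eqVneq i' (i - 1); first by exists b; rewrite -ii.
by exists 0; apply: (top_lt xb); lia.
Qed.

Lemma wide_kernel n (A : 'M[K]_(n.+1, n)) : exists2 v : 'rV_n.+1, v != 0 & v *m A = 0.
Proof.
have : kermx A != 0.
  by rewrite -mxrank_eq0 mxrank_ker subn_eq0 -ltnNge ltnS rank_leq_col.
by move=> /rowV0Pn [v /sub_kermxP vA v0]; exists v.
Qed.

Lemma top_X x i b n : top x i b -> b != 0 ->
  exists2 b', b' != 0 & top (x ^+ n) (i *+ n) b'.
Proof.
move=> xb b0; elim: n => [|n [b' b'0 IH]].
  by exists 1; rewrite ?oner_neq0 //; exact: top1.
by exists (b' * (b \Po ('X + (i *+ n)%:~R%:P))); rewrite ?topM_neq0 // exprS mulrS; apply: topM.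
Qed.

Section Raising.
Context {a : I1 K} {m : nat} {b : {poly K}}.
Hypotheses (m_gt0 : (0 < m)%N) (b_neq0 : b != 0) (ab : top a m b).

Lemma raising_iter : exists N, forall p, (N < size p)%N -> forall l,
  size (app (a ^+ l) p) = (size p + l * m)%N.
Proof.
have [N NP] := top_size ab b_neq0; exists N => p lt; elim=> [|l IH].
  by rewrite expr0 app1 mul0n addn0.
have := NP (app (a ^+ l) p); rewrite IH exprS appM => h.
have := h ltac:(lia); lia.
Qed.

Lemma comm_app x p l : centralizer a x -> app x (app (a ^+ l) p) = app (a ^+ l) (app x p).
Proof.
move=> ax; have xa : GRing.comm x a by rewrite /GRing.comm ax.
by rewrite -!appM (commrX l xa).
Qed.

(** Otherwise a power [y] of [x] lowers degrees by more than the threshold [N]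
    above which [a] raises them. By dimension count, [y] kills some [p] of size
    larger than [N]; hence it kills all [a ^+ l p], whose degrees are unbounded,
    although [y] shifts large degrees by a constant. *)
Lemma Cen_deg_ge0 x i b' : centralizer a x -> top x i b' -> b' != 0 -> 0 <= i.
Proof.
move=> ax xb' b'0; rewrite leNgt; apply/negP => i_lt0.
have [N NP] := raising_iter; pose y := x ^+ N.+1.
have [b2 b20 yb2] := top_X N.+1 xb' b'0; rewrite -/y in yb2.
have ay : centralizer a y by apply: commrX.
have [N2 N2P] := top_size yb2 b20; have [B BP] := app_bounded y N2.
pose n := (B + N2 + N)%N.
(* The span of 'X^N, ..., 'X^(N + n) is mapped into the polynomials of size at
   most n, a space of smaller dimension. *)
pose A := \matrix_(i < n.+1, j < n) (app y ('X^(N + i)))`_j.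
have [v v0 vA] := wide_kernel A; pose p := \sum_i v 0 i *: 'X^(N + i).
have pc i0 : p`_(N + val i0) = v 0 i0.
  rewrite coef_sum (bigD1 i0) //= coefZ coefXn eqxx mulr1 big1 ?addr0 // => i1 ne.
  move: ne; rewrite coefZ coefXn eqn_add2l eq_sym -val_eqE => /negPf /= ->.
  by rewrite mulr0.
have lt_p : (N < size p)%N.
  have /rV0Pn [i0 vi0] := v0; rewrite ltnNge; apply/negP => /leq_sizeP le.
  by move: vi0; rewrite -pc le ?eqxx // leq_addr.
have le_p : (size p <= N + n.+1)%N.
  apply: leq_trans (size_sum _ _ _) _; apply/bigmax_leqP => i0 _; apply: leq_trans (size_scale_leq _ _) _.
  by rewrite size_polyXn; have := ltn_ord i0; lia.
have yp_small : (size (app y p) <= n)%N.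
  have [le|lt] := leqP (size p) N2; first by apply: leq_trans (BP _ le) _; lia.
  have := N2P _ lt; nia.
have yp0 : app y p = 0.
  apply/polyP => j; rewrite coef0; have [le|lt] := leqP n j.
    by rewrite nth_default // (leq_trans yp_small).
  have /matrixP /(_ 0 (Ordinal lt)) := vA; rewrite !mxE => vA0.
  rewrite -[RHS]vA0 linear_sum coef_sum; apply: eq_bigr => i0 _.
  by rewrite linearZ coefZ mxE.
pose l := (N2 + absz i * N.+1)%N.
have := N2P (app (a ^+ l) p); rewrite NP // comm_app // yp0 linear0 size_poly0; nia.
Qed.

Lemma Cen_top0 x : centralizer a x -> top x 0 0 -> F x.
Proof.
move=> ax x0; apply: contrapT => /top_ex [i [b' [b'0 xb']]].
pose proof (Cen_deg_ge0 ax xb' b'0) as le.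
pose proof (top_lt_uniq x0 xb' b'0) as le'.
have i0 : i = 0 by apply/eqP; rewrite eq_le le le'.
by move: b'0; rewrite i0 in xb'; rewrite (top_uniq xb' x0) eqxx.
Qed.

Lemma Cen_top_ex x : centralizer a x -> ~ F x ->
  exists n : nat, exists2 b', b' != 0 & top x n b'.
Proof.
move=> ax /top_ex [i [b' [b'0 xb']]].
by case: i xb' (Cen_deg_ge0 ax xb' b'0) => // n xb' _; exists n, b'.
Qed.

Lemma comm_topE x i c : centralizer a x -> top x i c ->
  c * (b \Po ('X + i%:~R%:P)) = b * (c \Po ('X + m%:~R%:P)).
Proof.
move=> ax xc; pose proof (topM ab xc) as axc; rewrite ax (addrC m%:Z) in axc.
exact: top_uniq axc (topM xc ab).
Qed.

(** The commutation relation is a first order recurrence with step [m] for the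
    values of [c]. *)
Lemma comm_eq0 c (t : nat) (i : int) : (forall j, (t <= j)%N -> b.[j%:R] != 0) ->
  c * (b \Po ('X + i%:~R%:P)) = b * (c \Po ('X + m%:~R%:P)) ->
  c.[t%:R] = 0 -> c = 0.
Proof.
move=> bt cE ct0; have ct k : c.[(t + k * m)%:R] = 0.
  elim: k => [|k IH]; first by rewrite mul0n addn0.
  have := congr1 (fun p => p.[(t + k * m)%:R]) cE.
  rewrite !hornerM IH mul0r horner_comp hornerD hornerX hornerC -natrD.
  move=> /esym/eqP; rewrite mulf_eq0 (negPf (bt _ _)) ?leq_addr //=.
  by rewrite mulSn (addnC m) addnA => /eqP.
have : c \Po (m%:R *: 'X + t%:R%:P) = 0.
  apply: (@poly_nat_eq0 _ _ _ 0) => j _.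
  rewrite horner_comp hornerD hornerZ hornerX hornerC.
  by rewrite -natrM -natrD addnC mulnC ct.
move=> /eqP; rewrite comp_poly_eq0; first by move=> /eqP.
have sX : size (m%:R *: 'X : {poly K}) = 2.
  by rewrite size_scale ?size_polyX // natf_eq0 -lt0n.
by rewrite size_polyDl sX // ltnS size_polyC_leq1.
Qed.

Lemma comm_top_prop x y i c c' : centralizer a x -> centralizer a y ->
  top x i c -> top y i c' -> c' != 0 -> exists l, c = l *: c'.
Proof.
move=> ax ay xc yc' c'0.
have [N1 N1P] := poly_nat_neq0 b_neq0; have [N2 N2P] := poly_nat_neq0 c'0.
pose t := (N1 + N2)%N; pose l := c.[t%:R] / c'.[t%:R]; exists l.
have az : centralizer a (x - l *: y).
  have CC := subalg_submod (centralizer_subalg a); apply: submodB => //.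
  by have [_ _] := CC; apply.
have zd : top (x - l *: y) i (c - l *: c') by apply: topB xc (topZ _ yc').
apply/eqP; rewrite -subr_eq0; apply/eqP.
apply: (@comm_eq0 _ t i) => [j le||]; first by apply: N1P; lia.
  exact: comm_topE az zd.
by rewrite hornerD hornerN hornerZ divfK ?subrr // N2P // leq_addl.
Qed.

End Raising.
End Degrees.

(** * Bases of the centralizer modulo F *)

Lemma frac_repr (R : idomainType) (z : {fraction R}) :
  exists2 nd : R * R, nd.2 != 0 & z * tofrac nd.2 = tofrac nd.1.
Proof.
elim/quotW: z => r; exists (frac r); first exact: denom_ratioP.
rewrite [LHS](_ : _ = FracField.mul (\pi_(FracField.type R) r)%qT (tofrac (frac r).2)) //.
unlock tofrac; rewrite -FracField.pi_mul; apply/eqmodP; rewrite /= FracField.equivfE /FracField.mulf.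
by rewrite !numden_Ratio ?mulr1 ?mul1r ?oner_eq0 ?denom_ratioP // mulrC.
Qed.

Lemma frac_common_denom (R : idomainType) n (z : 'I_n -> {fraction R}) :
  exists2 d : R, d != 0 & exists w : 'I_n -> R, forall i, z i * tofrac d = tofrac (w i).
Proof.
have /choice [nd ndP] : forall i, exists nd : R * R,
    nd.2 != 0 /\ z i * tofrac nd.2 = tofrac nd.1.
  by move=> i; have [nd] := frac_repr (z i); exists nd.
exists (\prod_i (nd i).2); first by apply/prodf_neq0 => i _; case: (ndP i).
exists (fun i => (nd i).1 * \prod_(j | j != i) (nd j).2) => i.
by rewrite (bigD1 i) //= !rmorphM mulrA; case: (ndP i) => _ ->.
Qed.

(** A wide matrix over an integral domain has a nonzero left kernel: clear the
    denominators of a kernel vector over the fraction field. *)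
Lemma wide_kernel_idomain (R : idomainType) n n' (M : 'M[R]_(n', n)) : (n < n')%N ->
  exists2 w : 'I_n' -> R, (exists s, w s != 0) & forall r, \sum_s w s * M s r = 0.
Proof.
move=> lt; pose Mf := map_mx (@tofrac R) M.
have : kermx Mf != 0.
  rewrite -mxrank_eq0 mxrank_ker subn_eq0 -ltnNge.
  exact: leq_ltn_trans (rank_leq_col _) lt.
move=> /rowV0Pn [v /sub_kermxP vM /rV0Pn [s0 vs0]].
have [d d0 [w wE]] := frac_common_denom (fun s => v 0 s).
exists w; first by exists s0; rewrite -tofrac_eq0 -wE mulf_neq0 ?tofrac_eq0.
move=> r; apply/eqP; rewrite -tofrac_eq0 rmorph_sum /=.
have /matrixP /(_ 0 r) := vM; rewrite !mxE => vMr.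
have -> : \sum_s tofrac (w s * M s r) = (\sum_s v 0 s * Mf s r) * tofrac d.
  by rewrite mulr_suml; apply: eq_bigr => s _; rewrite rmorphM /= -wE mxE mulrAC.
by rewrite vMr mul0r.
Qed.

Section Fbasis.
Context {K : fieldType} {charK : charZero K}.
Implicit Types (x y a : I1 K) (b p : {poly K}).

(** [c] is a basis over [K[a]] of the image of [I] modulo [F]. *)
Definition Fbasis a (I : set (I1 K)) rho (c : 'I_rho -> I1 K) : Prop :=
  [/\ forall r, I (c r),
      forall x, I x -> exists p : 'I_rho -> {poly K},
        F (x - \sum_r horner_alg a (p r) * c r) &
      forall p : 'I_rho -> {poly K},
        F (\sum_r horner_alg a (p r) * c r) -> forall r, p r = 0].

Lemma Cen_submod a : is_submod (centralizer a).
Proof. exact/subalg_submod/centralizer_subalg. Qed.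

Lemma Cen_mul a x y : centralizer a x -> centralizer a y -> centralizer a (x * y).
Proof. by have [_ _] := centralizer_subalg a; apply. Qed.

Lemma CenB a x y : centralizer a x -> centralizer a y -> centralizer a (x - y).
Proof. exact: submodB (Cen_submod a). Qed.

Lemma CenZ a (l : K) x : centralizer a x -> centralizer a (l *: x).
Proof. by have [_ _] := Cen_submod a; apply. Qed.

Lemma Cen1 a : centralizer a 1.
Proof. by have [] := centralizer_subalg a. Qed.

Lemma CenX a x n : centralizer a x -> centralizer a (x ^+ n).
Proof.
by move=> ax; elim: n => [|n IH]; [apply: Cen1|rewrite exprS; apply: Cen_mul].
Qed.

Lemma Cen_self a : centralizer a a. Proof. by []. Qed.

Lemma horner_stable a (I : set (I1 K)) p x : is_submod I ->
  (forall y, I y -> I (a * y)) -> I x -> I (horner_alg a p * x).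
Proof. by move=> [I0 ID IZ] Ia; apply: horner_alg_stable. Qed.

Lemma Cen_horner a p : centralizer a (horner_alg a p).
Proof.
rewrite -[horner_alg a p]mulr1; apply: horner_stable; [exact: Cen_submod| |exact: Cen1].
by move=> y; apply: Cen_mul; apply: Cen_self.
Qed.

Lemma horner_alg_comm a p x : centralizer a x -> horner_alg a p * x = x * horner_alg a p.
Proof.
move=> ax; elim/poly_ind: p => [|p l IH]; first by rewrite rmorph0 mul0r mulr0.
rewrite rmorphD rmorphM /= horner_algX horner_algC mulrDl mulrDr -mulrA ax !mulrA IH.
by rewrite -scalerAl -scalerAr mulr1 mul1r.
Qed.

Lemma horner_algXn a n : horner_alg a 'X^n = a ^+ n :> I1 K.
Proof. by rewrite rmorphXn /= horner_algX. Qed.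

(** A longer family, expressed on [c] modulo F, has a wide matrix of coordinates,
    hence a nontrivial linear relation. *)
Lemma Fbasis_le a (I : set (I1 K)) rho rho' c c' :
  @Fbasis a I rho c -> @Fbasis a I rho' c' -> (rho' <= rho)%N.
Proof.
move=> [Ic Ispan _] [Ic' _ free']; rewrite leqNgt; apply/negP => lt.
have /choice [q qP] := fun s => Ispan _ (Ic' s).
have [w [s0 ws0] wM] := wide_kernel_idomain (\matrix_(s, r) q s r) lt.
have : F (\sum_s horner_alg a (w s) * c' s).
  rewrite [X in F X](_ : _ = \sum_s horner_alg a (w s) *
      (c' s - \sum_r horner_alg a (q s r) * c r)).
    by apply: F_sum => s _; apply: FM; apply: qP.
  under [RHS]eq_bigr do rewrite mulrBr; rewrite sumrB.
  suff -> : \sum_s horner_alg a (w s) * (\sum_r horner_alg a (q s r) * c r) = 0.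
    by rewrite subr0.
  under eq_bigr do rewrite mulr_sumr; rewrite exchange_big big1 //= => r _.
  under eq_bigr do rewrite mulrA -rmorphM; rewrite -mulr_suml -rmorph_sum.
  have := wM r; under eq_bigr do rewrite mxE; move=> -> .
  by rewrite rmorph0 mul0r.
by move=> /free' /(_ s0) /eqP; rewrite (negPf ws0).
Qed.

Lemma Fbasis_uniq a (I : set (I1 K)) rho rho' c c' :
  @Fbasis a I rho c -> @Fbasis a I rho' c' -> rho = rho'.
Proof. by move=> cP cP'; apply/eqP; rewrite eqn_leq (Fbasis_le cP' cP) (Fbasis_le cP cP'). Qed.

Lemma Fbasis_gt0 a rho c : @Fbasis a (centralizer a) rho c -> (0 < rho)%N.
Proof.
move=> [_ span _]; have [p] := span _ (Cen1 a).
by case: rho c p {span} => // c p; rewrite big_ord0 subr0 => /notF1.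
Qed.

Lemma star_Fbasis a I rho c : I `<=` centralizer a ->
  @Fbasis a I rho c -> Fbasis (star a) (star @` I) (fun r => star (c r)).
Proof.
move=> IC [Ic span free].
have starE (p : 'I_rho -> {poly K}) : star (\sum_r horner_alg a (p r) * c r) =
               \sum_r horner_alg (star a) (p r) * star (c r).
  rewrite star_sum; apply: eq_bigr => r _; rewrite starM star_horner.
  by rewrite horner_alg_comm //; apply/star_Cen/IC.
split=> [r|_ [x Ix <-]|p].
- by exists (c r).
- by have [p pP] := span x Ix; exists p; rewrite -starE -starB; apply: star_F.
- by rewrite -starE => /star_FE; apply: free.
Qed.

(** What the centralizer inherits from an operator that raises, or lowers,
    all large degrees. *)
Record tame a : Prop := Tame {
  tame_basis : forall I, is_submod I -> I `<=` centralizer a ->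
    (forall x, I x -> I (a * x)) -> exists rho c, @Fbasis a I rho c;
  tame_finite : forall S : set (I1 K), is_submod S -> S `<=` CenF a ->
    exists s : seq (I1 K), S = smallest (@is_submod K (I1 K)) [set` s];
  tame_comm : forall x y, centralizer a x -> centralizer a y -> F (x * y - y * x) }.

Lemma star_submod (S : set (I1 K)) : is_submod S -> is_submod (star @` S).
Proof.
move=> [S0 SD SZ]; split.
- by exists 0; rewrite ?star0.
- by move=> _ _ [x Sx <-] [y Sy <-]; exists (x + y); rewrite ?starD //; apply: SD.
- by move=> l _ [x Sx <-]; exists (l *: x); rewrite ?starZ //; apply: SZ.
Qed.

Lemma star_imageK (S : set (I1 K)) : star @` (star @` S) = S.
Proof.
apply/seteqP; split=> [_ [_ [x Sx <-] <-]|x Sx]; first by rewrite starK.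
by exists (star x); [exists x|rewrite starK].
Qed.

Lemma tame_star a : tame (star a) -> tame a.
Proof.
case=> basis fin comm.
have sC x : centralizer a x -> centralizer (star a) (star x) by move=> /star_Cen.
have sF (I : set (I1 K)) : I `<=` centralizer a -> star @` I `<=` centralizer (star a).
  by move=> IC _ [x /IC /sC + <-].
split=> [I IS IC Ia|S SS SC|x y /sC ax /sC ay].
- have [|||rho [c cP]] := basis (star @` I); first exact: star_submod.
  + exact: sF.
  + move=> _ [x Ix <-]; exists (a * x); first exact: Ia.
    by rewrite (IC x Ix) starM.
  exists rho, (fun r => star (c r)).
  by have := star_Fbasis (sF _ IC) cP; rewrite starK star_imageK; apply.
- have [||s sE] := fin (star @` S); first exact: star_submod.
    by move=> _ [x /SC [Fx Cx] <-]; split; [apply: star_F|apply: sC].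
  exists [seq star x | x <- s]; apply/seteqP; split=> [x Sx|].
    have : (star @` S) (star x) by exists x.
    rewrite sE => /span_seqP [k xE]; rewrite -[x]starK xE star_sum.
    apply: submod_sum => [|i _]; first exact: smallest_submodP.
    have [_ _ sZ] := @smallest_submodP _ _ [set` [seq star x | x <- s]].
    rewrite starZ; apply: sZ; apply: gen_in_span => /=.
    by apply/mapP; exists s`_i; rewrite ?mem_nth.
  apply: span_least => // _ /mapP [x sx ->].
  have : (star @` S) x by rewrite sE; apply: gen_in_span.
  by move=> [y Sy <-]; rewrite starK.
- apply/star_FE; rewrite starB !starM -opprB; apply: FN.
  by apply: comm.
Qed.

Section Raising.
Context {a : I1 K} {m : nat} {b : {poly K}}.
Hypotheses (m_gt0 : (0 < m)%N) (b_neq0 : b != 0) (ab : top a m b).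

Lemma top_horner p : p != 0 ->
  exists2 b', b' != 0 & top (horner_alg a p) ((size p).-1 * m)%N b'.
Proof.
elim/poly_ind: p => [|p l IH]; first by rewrite eqxx.
have ta : top (l *: 1 : I1 K) 0 (l *: 1) by apply: topZ; apply: top1.
rewrite rmorphD rmorphM /= horner_algX horner_algC size_MXaddC.
have [->|p0] := eqVneq p 0.
  rewrite mul0r add0r polyC_eq0 => l0; rewrite (negPf l0) /= size_poly0 mul0n.
  rewrite rmorph0 mul0r add0r; exists (l *: 1) => //.
  by rewrite scale_poly_eq0 (negPf l0) oner_eq0.
move=> _; have [b' b'0 pb'] := IH p0; exists (b * (b' \Po ('X + m%:Z%:~R%:P)) + 0).
  by rewrite addr0 topM_neq0.
apply: topD; last by apply: (top_lt ta); rewrite /= ltz_nat muln_gt0 m_gt0 size_poly_gt0 p0.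
have -> : Posz ((size p).+1.-1 * m) = Posz ((size p).-1 * m) + Posz m.
  by rewrite -PoszD; congr Posz; move: p0; rewrite -size_poly_gt0; case: (size p) => // n _; rewrite mulSn addnC.
exact: topM.
Qed.

(** The term of highest degree cannot be cancelled. *)
Lemma top_distinct_sum n (x : 'I_n -> I1 K) (deg : 'I_n -> nat) (P : pred 'I_n) i1 :
  P i1 -> (forall i, P i -> exists2 b', b' != 0 & top (x i) (deg i) b') ->
  {in P &, injective deg} -> ~ F (\sum_(i | P i) x i).
Proof.
move=> Pi1 xP deg_inj; pose i0 := [arg max_(i > i1 | P i) deg i].
have [i2 Pi2 max] : {i2 | P i2 & forall i, P i -> (deg i <= deg i2)%N}.
  by exists i0; rewrite /i0; case: arg_maxnP.
have [b' b'0 xb'] := xP _ Pi2; rewrite (bigD1 i2) //=.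
suff x0 : top (\sum_(i | P i && (i != i2)) x i) (deg i2) 0.
  by apply: (@top_notF _ _ _ (deg i2) (b' + 0)); [apply: topD|rewrite addr0].
apply: (big_rec (fun y => top y (deg i2) 0)) => [|i y /andP [Pi ne] IH].
  by apply: top_F; apply: F0.
rewrite -[0]addr0; apply: topD => //; have [b2 _ xb2] := xP _ Pi.
apply: (top_lt xb2); rewrite ltz_nat ltn_neqAle max // andbT.
by apply: contraNneq ne => /deg_inj -> //.
Qed.

Definition has_deg x (n : nat) := exists2 b', b' != 0 & top x n b'.

Lemma has_degM x y n n' : has_deg x n -> has_deg y n' -> has_deg (x * y) (n + n').
Proof.
move=> [b1 b10 x1] [b2 b20 y2]; exists (b2 * (b1 \Po ('X + n'%:Z%:~R%:P))).
  by rewrite topM_neq0.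
by rewrite PoszD; apply: topM.
Qed.

Lemma has_deg1 : has_deg 1 0.
Proof. by exists 1; [rewrite oner_neq0|apply: top1]. Qed.

Lemma has_deg_X k : has_deg (a ^+ k) (k * m).
Proof.
elim: k => [|k IH]; first exact: has_deg1.
by rewrite exprS mulSn; apply: has_degM => //; exists b.
Qed.

Lemma has_deg_horner p : p != 0 -> has_deg (horner_alg a p) ((size p).-1 * m).
Proof. exact: top_horner. Qed.

(** Elements of minimal degree in each residue class modulo [m] of the degrees
    occurring in [I]: their degrees are distinct modulo [m], whence freeness, and
    multiplying them by powers of [a] reaches all degrees, whence generation. *)
Lemma Fbasis_residues (I : set (I1 K)) (m' : nat) : m = m'.+1 ->
  is_submod I -> I `<=` centralizer a -> (forall x, I x -> I (a * x)) ->
  exists c : 'I_#|[set r : 'I_m'.+1 | `[< exists x n, [/\ I x, has_deg x n & (n %% m)%N = r] >]]%SET|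
      -> I1 K, Fbasis a I c.
Proof.
move=> mE IS IC Ia; set A := [set r : _ | _]%SET.
pose P r n := `[< exists x, [/\ I x, has_deg x n & (n %% m)%N = r] >].
have gen (r : 'I_m'.+1) : exists gd : I1 K * nat, r \in A ->
    [/\ I gd.1, has_deg gd.1 gd.2, (gd.2 %% m)%N = r &
       forall x n, I x -> has_deg x n -> (n %% m)%N = r -> (gd.2 <= n)%N].
  have [rA|nrA] := boolP (r \in A); last by exists (0, 0%N).
  have exP : exists n, P r n.
    by move: rA; rewrite inE => /asboolP [x [n xn]]; exists n; apply/asboolP; exists x.
  case: (ex_minnP exP) => d /asboolP [g [Ig gd dr]] dmin; exists (g, d); split=> // x n Ix xn nr.
  by apply: dmin; apply/asboolP; exists x.
have {gen} /choice [gd gdP] := gen.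
pose c i := (gd (@enum_val _ (mem A) i)).1; pose d i := (gd (@enum_val _ (mem A) i)).2.
have cP i : [/\ I (c i), has_deg (c i) (d i), (d i %% m)%N = @enum_val _ (mem A) i &
       forall x n, I x -> has_deg x n -> (n %% m)%N = @enum_val _ (mem A) i -> (d i <= n)%N].
  by apply: gdP; apply: enum_valP.
exists c; split=> [i|x Ix|p Fp]; first by case: (cP i).
  have [n xn] : exists n : nat, top x n 0.
    have [Fx|nFx] := pselect (F x); first by exists 0%N; apply: top_F.
    have [n [b' _ xb']] := Cen_top_ex m_gt0 b_neq0 ab (IC _ Ix) nFx.
    by exists n.+1; apply: (top_lt xb'); rewrite ltz_nat.
  elim: n x Ix xn => [|n IH] x Ix xn.
    exists (fun=> 0); rewrite big1 => [|i _]; last by rewrite rmorph0 mul0r.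
    by rewrite subr0; apply: (Cen_top0 m_gt0 b_neq0 ab (IC _ Ix)).
  have [b' xb'] := top_pred xn.
  have nE : n.+1%:Z - 1 = n by lia.
  rewrite nE in xb'.
  have [b'0|b'0] := eqVneq b' 0; first by apply: IH; rewrite // -b'0.
  have rlt : (n %% m < m'.+1)%N by rewrite -mE ltn_mod.
  have rA : Ordinal rlt \in A.
    by rewrite inE; apply/asboolP; exists x, n; split=> //; exists b'.
  pose i := enum_rank_in rA (Ordinal rlt).
  have iE : @enum_val _ (mem A) i = Ordinal rlt by rewrite enum_rankK_in.
  have [Ici cid di dmin] := cP i; rewrite iE /= in di dmin.
  have le : (d i <= n)%N by apply: (dmin x) => //; exists b'.
  have [k kE] : exists k, n = (k * m + d i)%N.
    exists ((n - d i) %/ m)%N; rewrite divnK ?subnK // -eqn_mod_dvd //.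
    by rewrite di.
  have [b2 b20 cb2] : has_deg (a ^+ k * c i) n by rewrite kE; apply/has_degM/cid/has_deg_X.
  have Iac : I (a ^+ k * c i) by rewrite -horner_algXn; apply: horner_stable.
  have [l lE] := comm_top_prop m_gt0 b_neq0 ab (IC _ Ix) (IC _ Iac) xb' cb2 b20.
  have [||p pP] := IH (x - l *: (a ^+ k * c i)).
  - by apply: submodB => //; have [_ _] := IS; apply.
  - by rewrite -(subrr b') {2}lE; apply/topB/topZ.
  exists (fun j => p j + (if j == i then l *: 'X^k else 0)).
  under eq_bigr do rewrite rmorphD mulrDl; rewrite big_split /=.
  have -> : \sum_j horner_alg a (if j == i then l *: 'X^k else 0) * c j =
      l *: (a ^+ k * c i).
    rewrite (bigD1 i) //= eqxx linearZ /= horner_algXn big1 ?addr0 => [|j /negPf ->].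
      by rewrite mulr_algl -scalerAl.
    by rewrite rmorph0 mul0r.
  by rewrite addrC opprD addrA.
move=> i1; apply: contrapT => /eqP pi1; move: Fp.
rewrite (bigID (fun i => p i != 0)) /= [X in _ + X]big1 ?addr0; last first.
  by move=> i /negPn/eqP ->; rewrite rmorph0 mul0r.
apply: (top_distinct_sum (deg := fun i => ((size (p i)).-1 * m + d i)%N) pi1).
  by move=> i pi0; have [_ ci _ _] := cP i; apply/has_degM/ci/has_deg_horner.
move=> i j _ _ /(congr1 (modn^~ m)); rewrite /= !modnMDl.
by have [_ _ -> _] := cP i; have [_ _ -> _] := cP j => /val_inj/enum_val_inj.
Qed.

Lemma Fbasis_ex (I : set (I1 K)) :
  is_submod I -> I `<=` centralizer a -> (forall x, I x -> I (a * x)) ->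
  exists rho c, @Fbasis a I rho c.
Proof.
move=> IS IC Ia; have mE : m = m.-1.+1 by rewrite prednK.
by have [c cP] := Fbasis_residues mE IS IC Ia; eexists; exists c.
Qed.

(** The degrees of the elements of the centralizer form an additive monoid, so
    their residues modulo [m] form a subgroup of the cyclic group of order [m]. *)
Lemma Fbasis_Cen_dvd : exists rho c, @Fbasis a (centralizer a) rho c /\ (rho %| m)%N.
Proof.
have mE : m = m.-1.+1 by rewrite prednK.
have [c cP] := Fbasis_residues mE (Cen_submod a) (@subset_refl _ _)
  (fun x => @Defs.Cen_comm _ a x).
set A := [set r : _ | _]%SET in c cP; exists #|A|, c; split=> //.
have gA : group_set A.
  apply/group_setP; split.
    by rewrite inE; apply/asboolP; exists 1, 0%N; split; [apply: Cen1|apply: has_deg1|rewrite mod0n].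
  move=> r s; rewrite !inE => -[x [n [Cx xn nr]]] [y [k [Cy yk ks]]].
  exists (x * y), (n + k)%N; split; [exact: Cen_mul|exact: has_degM|].
  by rewrite /= -nr -ks -mE modnDm.
have := cardSg (finset.subsetT (Group gA)); rewrite cardsT card_ord => dvd.
by apply: dvdn_trans dvd _; rewrite prednK.
Qed.

End Raising.
End Fbasis.

Section RaisingTame.
Context {K : fieldType} {charK : charZero K}.
Context {a : I1 K} {m : nat} {b : {poly K}}.
Hypotheses (m_gt0 : (0 < m)%N) (b_neq0 : b != 0) (ab : top a m b).
Implicit Types (x y : I1 K).

(** ** Commutativity modulo F *)

(** [x ^+ s.+1 * y - y * x ^+ s.+1] is the sum of the [x ^+ j * c * x ^+ (s - j)],
    where [c = x * y - y * x]. These terms have the same degree, so that their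
    leading coefficients are proportional; as these have the same leading
    coefficient as polynomials, they are equal. They add up to [s.+1] times one
    of them, which is not zero in characteristic 0. *)
Lemma comm_topX x y i k c d s : centralizer a x -> centralizer a y ->
  top x i c -> c != 0 -> top (x * y - y * x) k d -> d != 0 ->
  exists2 g, lead_coef g = s.+1%:R * (lead_coef c ^+ s * lead_coef d) &
    top (x ^+ s.+1 * y - y * x ^+ s.+1) (i *+ s + k) g.
Proof.
move=> ax ay xc c0 xyd d0; elim: s => [|s [g gl IH]].
  by exists d; rewrite ?expr0 ?mul1r // expr1 mulr0n add0r.
have axs j : centralizer a (x ^+ j) by apply: CenX.
have cc j : centralizer a (x ^+ j * y - y * x ^+ j).
  by apply: CenB; apply: Cen_mul.
have xsE : x ^+ s.+2 * y - y * x ^+ s.+2 =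
    x * (x ^+ s.+1 * y - y * x ^+ s.+1) + (x * y - y * x) * x ^+ s.+1.
  by rewrite [x ^+ s.+2]exprS mulrBr mulrBl !mulrA addrA subrK.
have [c1 c10 xs1] := top_X s.+1 xc c0.
have c1l : lead_coef c1 = lead_coef c ^+ s.+1.
  elim: {IH xsE g gl}s c1 {c10} xs1 => [|s IHs] c1 xs1.
    by rewrite expr1 mulr1n in xs1 *; rewrite (top_uniq xs1 xc).
  have [c2 c20 xs2] := top_X s.+1 xc c0.
  pose proof (topM xc xs2) as xs3; rewrite -exprS -mulrS in xs3.
  by rewrite (top_uniq xs1 xs3) lead_topM (IHs _ xs2) mulrC -exprS.
pose proof (topM xc IH) as t1; pose proof (topM xyd xs1) as t2.
set g1 := (g * _) in t1; set g2 := (c1 * _) in t2.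
have g1l : lead_coef g1 = s.+1%:R * (lead_coef c ^+ s.+1 * lead_coef d).
  by rewrite lead_topM gl exprS; ring.
have g2l : lead_coef g2 = lead_coef c ^+ s.+1 * lead_coef d by rewrite lead_topM c1l.
have deg1 : i + (i *+ s + k) = i *+ s.+1 + k by rewrite mulrS addrA.
rewrite deg1 in t1; rewrite (addrC k) in t2.
have g20 : g2 != 0 by rewrite topM_neq0.
have a1 : centralizer a (x * (x ^+ s.+1 * y - y * x ^+ s.+1)) by apply: Cen_mul.
have a2 : centralizer a ((x * y - y * x) * x ^+ s.+1).
  by apply: Cen_mul => //; have := cc 1%N; rewrite expr1.
have [l lE] := comm_top_prop m_gt0 b_neq0 ab a1 a2 t1 t2 g20.
have ls : l = s.+1%:R.
  have : lead_coef g2 != 0 by rewrite lead_coef_eq0.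
  by move: g1l; rewrite lE lead_coefZ -g2l => /eqP + g20'; rewrite (inj_eq (mulIf g20')) => /eqP.
exists (g1 + g2); last by rewrite xsE; apply: topD.
by rewrite lE ls -{2}[g2]scale1r -scalerDl lead_coefZ g2l natr1.
Qed.

(** By descent on the drop [deg x + deg y - deg (x * y - y * x)], a natural number.
    Some [z = x ^+ m - l *: a ^+ i] has degree less than [i * m], where [i] is the
    degree of [x]. It has the same commutator with [y] as [x ^+ m], and the drop of
    [x ^+ m] is that of [x]; so the drop of [z] is smaller. *)
Lemma comm_F x y : centralizer a x -> centralizer a y -> F (x * y - y * x).
Proof.
move=> ax ay; apply: contrapT => nF.
have nFy : ~ F y by move=> Fy; apply: nF; apply: FB; [apply: FM|apply: FMr].
have [j [d0 d00 yd]] := Cen_top_ex m_gt0 b_neq0 ab ay nFy.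
have [n] : exists n : nat, forall (i k : int) c d, top x i c -> c != 0 ->
    top (x * y - y * x) k d -> d != 0 -> (absz (i + j%:Z - k)%R <= n)%N.
  have nFx : ~ F x by move=> Fx; apply: nF; apply: FB; [apply: FMr|apply: FM].
  have [i [c c0 xc]] := Cen_top_ex m_gt0 b_neq0 ab ax nFx.
  have [k [d [dn0 xyd]]] := top_ex nF.
  exists (absz (i%:Z + j%:Z - k)%R) => i' k' c' d' xc' c'0 xyd' d'0.
  by rewrite (top_deg_uniq xc' c'0 xc c0) (top_deg_uniq xyd' d'0 xyd dn0).
elim: n.+1 {-2}n (ltnSn n) x ax nF => // {}n IH n' lt x ax nF drop.
have nFx : ~ F x by move=> Fx; apply: nF; apply: FB; [apply: FMr|apply: FM].
have [i [c c0 xc]] := Cen_top_ex m_gt0 b_neq0 ab ax nFx.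
have [k [d [dn0 xyd]]] := top_ex nF.
have dn := drop _ _ _ _ xc c0 xyd dn0.
have [g gl xmy] := comm_topX m.-1 ax ay xc c0 xyd dn0.
rewrite prednK // in xmy gl.
have g0 : g != 0.
  by rewrite -lead_coef_eq0 gl !mulf_neq0 ?natf_eq0 -?lt0n ?expf_neq0 ?lead_coef_eq0.
have [c1 _ xm] := top_X m xc c0; have [b1 b10 ai] := top_X i ab b_neq0.
have degE : m%:Z *+ i = i%:Z *+ m by rewrite -[LHS]mulr_natr -[RHS]mulr_natr !natz mulrC.
rewrite degE in ai.
have aai : centralizer a (a ^+ i) by apply: CenX; apply: Cen_self.
have [l lE] := comm_top_prop m_gt0 b_neq0 ab (CenX m ax) aai xm ai b10.
pose z := x ^+ m - l *: a ^+ i.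
have az : centralizer a z by apply: CenB; [apply: CenX|apply: CenZ].
have zy : z * y - y * z = x ^+ m * y - y * x ^+ m.
  have ayi : GRing.comm y (a ^+ i) by apply: commrX; rewrite /GRing.comm ay.
  by rewrite /z mulrBl mulrBr -scalerAl -scalerAr ayi opprB addrA subrK.
rewrite -zy in xmy.
have z0 : top z (i%:Z *+ m) 0 by rewrite -(subrr c1) {2}lE; apply: topB => //; apply: topZ.
have nFzy : ~ F (z * y - y * z) by apply: top_notF xmy g0.
have nFz : ~ F z by move=> Fz; apply: nFzy; apply: FB; [apply: FMr|apply: FM].
have [iz [cz cz0 zc]] := Cen_top_ex m_gt0 b_neq0 ab az nFz.
pose proof (top_lt_uniq z0 zc cz0) as izle.
have izlt : iz%:Z < i%:Z *+ m.
  rewrite lt_neqAle izle andbT; apply/eqP => izE; rewrite izE in zc.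
  by move: cz0; rewrite (top_uniq zc z0) eqxx.
have zyB : top (z * y - y * z) (iz%:Z + j%:Z) (d0 * (cz \Po ('X + j%:Z%:~R%:P)) -
    cz * (d0 \Po ('X + iz%:Z%:~R%:P))).
  by apply: topB; [|rewrite addrC]; apply: topM.
pose proof (top_lt_uniq zyB xmy g0) as degle.
have mS : i%:Z *+ m = i%:Z *+ m.-1 + i%:Z by rewrite -[in LHS](prednK m_gt0) mulrS addrC.
apply: (IH (absz (iz%:Z + j%:Z - (i%:Z *+ m.-1 + k))%R) _ z az nFzy); first by lia.
move=> i' k' c' d' zc' c'0 zyd' d'0.
by rewrite (top_deg_uniq zc' c'0 zc cz0) (top_deg_uniq zyd' d'0 xmy g0).
Qed.

(** ** Finiteness of the centralizer in F *)

(** The image of [f] is a finite dimensional [a]-stable space, so that it lives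
    in the degrees where [a] does not raise degrees; and [f] is determined by its
    values on generators of the [K[a]]-module [K[x]]. *)
Lemma CenF_window : exists N M : nat,
  (forall f k j, CenF a f -> (N <= k)%N -> cf f k j = 0) /\
  (forall f, CenF a f -> (forall k j, (j < M)%N -> cf f k j = 0) -> f = 0).
Proof.
have [N NP] := raising_iter m_gt0 b_neq0 ab; exists N, (N + m).+1; split.
  move=> f k j [Ff Cf] le.
  have /FP [B BP] := Ff.
  have small p : (size (app f p) <= B)%N.
    apply/leq_sizeP => k' le'; have := @cf_app _ charK f p k' _ (leqnn _).
    rewrite big1 => [/eqP|l _]; last by rewrite BP ?le' ?mul0r.
    by rewrite mulf_eq0 (negPf (factf_neq0 k')) => /eqP.
  have le2 : (size (app f (u j)) <= N)%N.
    rewrite leqNgt; apply/negP => lt; have := NP _ lt B.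
    rewrite -(comm_app _ _ Cf); have := small (app (a ^+ B) (u j)); nia.
  by rewrite /cf nth_default ?mulr0 // (leq_trans le2).
move=> f [Ff Cf] f0; apply: app_eq0P => p.
elim: {p}(size p) {-2}p (leqnn (size p)) => [|n IH] p le.
  by move: le; rewrite leqn0 size_poly_eq0 => /eqP ->; rewrite linear0.
have [le'|lt] := leqP (size p) (N + m).
  apply/polyP => k; rewrite coef0; have := @cf_app _ charK f p k _ le'.
  rewrite big1 => [/eqP|l _]; last by rewrite f0 ?mul0r // ltnS ltnW.
  by rewrite mulf_eq0 (negPf (factf_neq0 k)) => /eqP.
pose q : {poly K} := 'X^((size p).-1 - m); have sq : size q = ((size p).-1 - m).+1 by rewrite size_polyXn.
have saq : size (app a q) = size p.
  have := NP q; rewrite sq => /(_ ltac:(lia) 1%N); rewrite expr1; lia.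
have aq0 : lead_coef (app a q) != 0 by rewrite lead_coef_eq0 -size_poly_eq0 saq; lia.
pose l := lead_coef p / lead_coef (app a q); pose r := p - l *: app a q.
have sr : (size r < size p)%N.
  have p0 : (0 < size p)%N by lia.
  rewrite -(prednK p0) ltnS; apply/leq_sizeP => k; rewrite leq_eqVlt => /orP [/eqP <-|ltk].
    rewrite coefB coefZ -/(lead_coef p) -saq -/(lead_coef (app a q)) divfK ?subrr //.
  have lek : (size p <= k)%N by move: ltk; rewrite prednK.
  by rewrite coefB coefZ !nth_default ?mulr0 ?subr0 ?saq.
have faq : app f (app a q) = 0.
  have -> : app f (app a q) = app a (app f q) by rewrite -!appM Cf.
  by rewrite IH ?linear0 // sq; lia.
have -> : p = r + l *: app a q by rewrite subrK.
rewrite linearD linearZ /= faq scaler0 addr0; apply: IH; lia.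
Qed.

Definition window (N M : nat) x : 'M[K]_(N, M) := \matrix_(k, j) cf x k j.

Fact window_linear N M : linear (@window N M).
Proof. by move=> l x y; apply/matrixP => k j; rewrite !mxE cfD cfZ. Qed.

HB.instance Definition _ N M :=
  GRing.isLinear.Build K (I1 K) 'M[K]_(N, M) *:%R (@window N M) (@window_linear N M).

Lemma CenF_sub_finite (S : set (I1 K)) : is_submod S -> S `<=` CenF a ->
  exists s : seq (I1 K), S = smallest (@is_submod K (I1 K)) [set` s].
Proof.
have [N [M [rowsP injP]]] := CenF_window; move=> SS SC.
apply: (@finite_span _ _ _ S (@window N M)) => // x Sx x0.
apply: injP (SC _ Sx) _ => k j ltM.
have [leN|ltN] := leqP N k; first exact: rowsP (SC _ Sx) leN.
by have /matrixP /(_ (Ordinal ltN) (Ordinal ltM)) := x0; rewrite !mxE.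
Qed.

Lemma raising_tame : tame a.
Proof.
split; first exact: Fbasis_ex m_gt0 b_neq0 ab.
  exact: CenF_sub_finite.
exact: comm_F.
Qed.

End RaisingTame.

(** * From bases modulo F to module isomorphisms and ranks *)

Section Iso.
Context {R : nzRingType} {M N : lmodType R}.

Lemma linear_bij_iso (g : N -> M) : linear g -> injective g ->
  (forall y, exists x, g x = y) -> mod_iso M N.
Proof.
move=> glin ginj /choice [h gh].
have hg : cancel g h by move=> x; apply: ginj; rewrite gh.
have hlin : linear h by move=> l x y; apply: ginj; rewrite glin !gh.
exists (HB.pack_for {linear M -> N} h (GRing.isLinear.Build R M N *:%R h hlin)).
by exists g.
Qed.

End Iso.

Section RankCriterion.
Context {K : fieldType} {M : lmodType {poly K}} {r : nat}.

(** Torsion dies in [K(t)^r], so a balanced map is determined by its values on the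
    [b i], and the latter can be prescribed: [K(t)^r] is the tensor product. *)
Lemma has_rank_coord (phi : {linear M -> 'rV[{poly K}]_r}) (b : 'I_r -> M) :
  (forall i, phi (b i) = delta_mx 0 i) ->
  (forall m, phi m = 0 -> exists2 p : {poly K}, p != 0 & p *: m = 0) ->
  has_rank M r.
Proof.
move=> phib tor.
pose Kt := {fraction {poly K}}.
pose tens (c : Kt) (m : M) : 'rV[Kt]_r := c *: map_mx (@tofrac {poly K}) (phi m).
have tensDl c d m : tens (c + d) m = tens c m + tens d m by rewrite /tens scalerDl.
have tensDr c m n : tens c (m + n) = tens c m + tens c n.
  by rewrite /tens linearD map_mxD scalerDr.
have tensM c p m : tens (c * tofrac p) m = tens c (p *: m).
  by rewrite /tens linearZ map_mxZ scalerA.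
exists 'rV[Kt]_r, tens; split; last by rewrite dimvf /dim /= mul1n.
split=> // [c d m|P g [gDl gDr gM]]; first by rewrite /tens scalerA.
have g0r c : g c 0 = 0 by apply: (addrI (g c 0)); rewrite -gDr !addr0.
have g0l m : g 0 m = 0 by apply: (addrI (g 0 m)); rewrite -gDl !addr0.
have g_sum c I (s : seq I) (E : I -> M) : g c (\sum_(i <- s) E i) = \sum_(i <- s) g c (E i).
  by elim/big_rec2: _ => // i y1 y2 _ <-.
have g_ker c m : phi m = 0 -> g c m = 0.
  move=> /tor [p p0 pm]; have pF0 : tofrac p != 0 :> Kt by rewrite tofrac_eq0.
  by rewrite -[c](divfK pF0) gM pm g0r.
have m_dec m : phi (m - \sum_i phi m 0 i *: b i) = 0.
  rewrite linearB linear_sum /= {1}[phi m]row_sum_delta.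
  by apply/eqP; rewrite subr_eq0; apply/eqP/eq_bigr => i _; rewrite linearZ /= phib.
have gE c m : g c m = \sum_i g (c * tofrac (phi m 0 i)) (b i).
  rewrite -[m in LHS](subrK (\sum_i phi m 0 i *: b i)) gDr g_ker ?add0r //.
  by rewrite g_sum; apply: eq_bigr => i _; rewrite gM.
pose h (w : 'rV[Kt]_r) := \sum_i g (w 0 i) (b i).
have hD x y : h (x + y) = h x + h y.
  by rewrite /h -big_split; apply: eq_bigr => i _; rewrite mxE gDl.
exists h; split; first split=> // c m.
  by rewrite gE; apply: eq_bigr => i _; rewrite !mxE.
move=> h' [h'D h'E]; apply/funext => w.
have h'0 : h' 0 = 0 by apply: (addrI (h' 0)); rewrite -h'D !addr0.
rewrite [w in RHS]row_sum_delta (big_morph h' h'D h'0); apply: eq_bigr => i _.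
by rewrite -h'E /tens phib map_delta_mx.
Qed.

End RankCriterion.

Section CenModule.
Context {K : fieldType} {charK : charZero K}.
Implicit Types (x y a : I1 K) (p : {poly K}).

(** The powers [a ^+ k * f] of an element [f] of F commuting with [a] live in
    the same finite block as [f], so that they are linearly dependent. *)
Lemma CenF_torsion a f : CenF a f -> exists2 p, p != 0 & horner_alg a p * f = 0.
Proof.
move=> [Ff Cf]; have /FP [N NP] := Ff.
have akP k i j : (N <= i)%N || (N <= j)%N -> cf (a ^+ k * f) i j = 0.
  have [leN|ltN /= leN] := leqP N i; last first.
    by apply: cf_neq0M => l; rewrite NP ?mulr0 // leN orbT.
  have ayk : centralizer a (a ^+ k) by apply: CenX; apply: Cen_self.
  have -> : a ^+ k * f = f * a ^+ k.
    by apply/esym/commrX; rewrite /GRing.comm -Cf.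
  by move=> _; apply: cf_neq0M => l; rewrite NP ?mul0r // leN.
pose A := \matrix_(k < (N * N).+1) mxvec (window N N (a ^+ k * f)).
have [v v0 vA] := wide_kernel A.
pose p := \poly_(k < (N * N).+1) v 0 (inord k).
exists p.
  have /rV0Pn [k0 vk0] := v0; apply: contraNneq vk0 => p0.
  by have := coef_poly (N * N).+1 (fun k => v 0 (inord k)) k0;
    rewrite -/p p0 coef0 ltn_ord inord_val => <-.
have pf : horner_alg a p * f = \sum_(k < (N * N).+1) v 0 k *: (a ^+ k * f).
  rewrite /p poly_def linear_sum mulr_suml; apply: eq_bigr => k _.
  by rewrite linearZ /= horner_algXn mulr_algl -scalerAl inord_val.
have W0 : window N N (horner_alg a p * f) = 0.
  rewrite pf linear_sum; apply: (can_inj mxvecK); rewrite linear0 -vA linear_sum mulmx_sum_row.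
  by apply: eq_bigr => k _; rewrite rowK !linearZ.
apply: cf_inj => i j; rewrite cf0.
have [le|] := boolP ((N <= i)%N || (N <= j)%N).
  by rewrite pf cf_sum big1 // => k _; rewrite cfZ akP ?mulr0.
rewrite negb_or -!ltnNge => /andP [lti ltj].
by have /matrixP /(_ (Ordinal lti) (Ordinal ltj)) := W0; rewrite !mxE.
Qed.

Lemma Kalg_horner a x : Kalg a x <-> exists p, x = horner_alg a p.
Proof.
split=> [|[p ->]].
  move/(_ [set y | exists p, y = horner_alg a p]); apply.
  split; last by move=> _ ->; exists 'X; rewrite horner_algX.
  split; first split.
  - by exists 0; rewrite rmorph0.
  - by move=> _ _ [p ->] [q ->]; exists (p + q); rewrite rmorphD.
  - by move=> l _ [p ->]; exists (l *: p); rewrite linearZ /= mulr_algl.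
  - by exists 1; rewrite rmorph1.
  - by move=> _ _ [p ->] [q ->]; exists (p * q); rewrite rmorphM.
have [[S0 SD SZ] S1 SM] := smallest_subalgP [set a].
elim/poly_ind: p => [|p l IH]; first by rewrite rmorph0.
rewrite rmorphD rmorphM /= horner_algX horner_algC; apply: SD; last exact: SZ.
by apply: SM => // S [_]; apply.
Qed.

Lemma KHP x : KH x <-> exists p, x = evalH p.
Proof. exact: Kalg_horner. Qed.

Section Basis.
Context {a : I1 K} {rho : nat} {c : 'I_rho -> I1 K}.
Hypothesis cP : Fbasis a (centralizer a) c.

Lemma Fbasis_comb_Cen (p : 'I_rho -> {poly K}) :
  centralizer a (\sum_r horner_alg a (p r) * c r).
Proof.
have [Ic _ _] := cP; apply: submod_sum; first exact: Cen_submod.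
by move=> r _; apply: Cen_mul; [apply: Cen_horner|apply: Ic].
Qed.

Lemma Fbasis_inj (p q : 'I_rho -> {poly K}) :
  F (\sum_r horner_alg a (p r) * c r - \sum_r horner_alg a (q r) * c r) -> p = q.
Proof.
have [_ _ free] := cP; rewrite -sumrB => Fpq; apply/funext => r; apply/eqP.
rewrite -subr_eq0; apply/eqP; apply: (free (fun r => p r - q r)).
by under eq_bigr do rewrite rmorphB mulrBl.
Qed.

Lemma in_CenM x : centralizer a x -> x \in submod_pred (Cen_mod a).
Proof. by move=> ax; apply/asboolP. Qed.

Lemma CenMP (z : CenM a) : centralizer a (val z : I1 K).
Proof. by case: z => z /= /asboolP. Qed.

Lemma KalgMP (z : KalgM a) : exists p, (val z : I1 K) = horner_alg a p.
Proof. by case: z => z /= /asboolP /Kalg_horner. Qed.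

Lemma in_KalgM p : (horner_alg a p : I1 K) \in submod_pred (Kalg_mod a).
Proof. by apply/asboolP/Kalg_horner; exists p. Qed.

Lemma in_CenFM x : CenF a x -> x \in submod_pred (CenF_mod charK a).
Proof. by move=> ax; apply/asboolP. Qed.

Lemma CenFMP (z : CenFM charK a) : CenF a (val z : I1 K).
Proof. by case: z => z /= /asboolP. Qed.

Lemma KalgM_linE p (z z' : KalgM a) :
  (val (p *: z + z') : I1 K) = horner_alg a p * (val z : I1 K) + (val z' : I1 K).
Proof. by []. Qed.

Lemma CenM_linE p (z z' : CenM a) :
  (val (p *: z + z') : I1 K) = horner_alg a p * (val z : I1 K) + (val z' : I1 K).
Proof. by []. Qed.

Definition comb (wf : {ffun 'I_rho -> KalgM a} * CenFM charK a) : I1 K :=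
  \sum_r (val (wf.1 r) : I1 K) * c r + (val wf.2 : I1 K).

Lemma comb_Cen wf : centralizer a (comb wf).
Proof.
have [Ic _ _] := cP; have [_ CD _] := Cen_submod a; apply: CD; last first.
  by have [_] := CenFMP wf.2.
apply: submod_sum; first exact: Cen_submod.
by move=> r _; have [p ->] := KalgMP (wf.1 r); apply: Cen_mul; [apply: Cen_horner|apply: Ic].
Qed.

Lemma Fbasis_mod_iso :
  mod_iso (CenM a) ({ffun 'I_rho -> KalgM a} * CenFM charK a)%type.
Proof.
have [Ic span free] := cP.
pose g wf : CenM a := SubmodElt (in_CenM (comb_Cen wf)).
apply: (@linear_bij_iso _ _ _ g).
- move=> p [w f] [w' f']; apply: val_inj; rewrite /= /comb /=.
  rewrite -[X in _ = X]/(horner_alg a p * (\sum_r (val (w r) : I1 K) * c r + (val f : I1 K)) +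
     (\sum_r (val (w' r) : I1 K) * c r + (val f' : I1 K))).
  rewrite mulrDr addrACA mulr_sumr -big_split /=; congr (_ + _).
  by apply: eq_bigr => r _; rewrite !ffunE KalgM_linE mulrDl mulrA.
- move=> [w f] [w' f'] /(congr1 (fun z : CenM a => val z : I1 K)) /=; rewrite /comb /= => E.
  have [Ff Ff'] : F (val f : I1 K) /\ F (val f' : I1 K).
    by have [? _] := CenFMP f; have [? _] := CenFMP f'.
  have /choice [p pP] := fun r => KalgMP (w r); have /choice [q qP] := fun r => KalgMP (w' r).
  have ww : w = w'.
    have pq : p = q.
      apply: Fbasis_inj; under eq_bigr do rewrite -pP.
      under [X in _ - X]eq_bigr do rewrite -qP.
      move/eqP: E; rewrite -subr_eq0 opprD addrACA addr_eq0 => /eqP ->.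
      by apply: FN; apply: FB.
    by apply/ffunP => r; apply: val_inj; rewrite [LHS]pP [RHS]qP pq.
  by congr pair => //; apply: val_inj; move: E; rewrite ww => /addrI.
- move=> y; have [p pP] := span _ (CenMP y).
  have Cy : CenF a ((val y : I1 K) - \sum_r horner_alg a (p r) * c r).
    by split=> //; apply: CenB; [apply: CenMP|apply: Fbasis_comb_Cen].
  exists ([ffun r => SubmodElt (in_KalgM (p r))], SubmodElt (in_CenFM Cy)).
  apply: val_inj; rewrite /= /comb /=; under eq_bigr do rewrite ffunE /=.
  by rewrite addrC subrK.
Qed.

Lemma Fbasis_torsion : CenF a = torsion (Cen_mod a).
Proof.
have [Ic span free] := cP; apply/seteqP; split=> [f Cf|x [Cx [p [p0 px]]]].
  have [p p0 pf] := CenF_torsion Cf; case: Cf => Ff Cf.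
  by split=> //; exists p.
split=> //; have {px} px : horner_alg a p * x = 0 := px.
have [q qP] := span x Cx.
have q0 : q = fun=> 0.
  apply/funext => r; apply/eqP; suff : p * q r == 0 by rewrite mulf_eq0 (negPf p0).
  apply/eqP; apply: (free (fun r => p * q r)).
  pose proof (FN (FM (horner_alg a p) qP)) as Fq.
  rewrite mulrBr px sub0r opprK mulr_sumr in Fq.
  by under eq_bigr do rewrite rmorphM -mulrA.
have : F (x - 0) by rewrite -[X in _ - X](_ : \sum_r horner_alg a (q r) * c r = 0) //
  q0 big1 // => r _; rewrite rmorph0 mul0r.
by rewrite subr0.
Qed.

Lemma Fbasis_coord x (p q : 'I_rho -> {poly K}) :
  F (x - \sum_r horner_alg a (p r) * c r) ->
  F (x - \sum_r horner_alg a (q r) * c r) -> p = q.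
Proof.
by move=> Fp Fq; apply: Fbasis_inj; have := FB Fq Fp; rewrite opprB addrC addrA subrK.
Qed.

Lemma Fbasis_rank : has_rank (CenM a) rho.
Proof.
have [Ic span free] := cP.
have /choice [co coP] := fun z : CenM a => span _ (CenMP z).
pose phi z := \row_r co z r.
have philin : linear phi.
  move=> p x y; apply/rowP => r; rewrite !mxE.
  suff -> : co (p *: x + y) = fun r => p * co x r + co y r by [].
  apply: (Fbasis_coord (coP (p *: x + y))).
  rewrite CenM_linE.
  under eq_bigr do rewrite rmorphD rmorphM mulrDl -mulrA.
  rewrite big_split /= -mulr_sumr opprD addrACA -mulrBr.
  by apply: FD; [apply: FM|]; apply: coP.
pose phiL : {linear CenM a -> 'rV[{poly K}]_rho} :=
  HB.pack_for {linear CenM a -> 'rV[{poly K}]_rho} phi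
    (GRing.isLinear.Build _ (CenM a) 'rV[{poly K}]_rho *:%R phi philin).
apply: (@has_rank_coord _ _ _ phiL (fun i => SubmodElt (in_CenM (Ic i)))) => [i|m m0].
  apply/rowP => r; rewrite !mxE eqxx /=.
  suff -> : co (SubmodElt (in_CenM (Ic i))) = fun r => (r == i)%:R by [].
  apply: (Fbasis_coord (coP _)); rewrite /= (bigD1 i) //= eqxx rmorph1 mul1r big1 ?addr0.
    by rewrite subrr; apply: F0.
  by move=> j /negPf ->; rewrite rmorph0 mul0r.
have cm0 : co m = fun=> 0.
  by apply/funext => r; have /rowP /(_ r) := m0; rewrite !mxE.
have [] : CenF a (val m : I1 K).
  split; last exact: CenMP.
  by have := coP m; rewrite cm0 big1 ?subr0 // => r _; rewrite rmorph0 mul0r.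
move=> Fm Cm; have [p p0 pm] := CenF_torsion (conj Fm Cm : CenF a (val m : I1 K)).
by exists p => //; apply: val_inj.
Qed.

End Basis.
End CenModule.

(** * Finite generation and chain conditions, read in the ambient algebra *)

Section Generation.
Context {K : fieldType} {charK : charZero K}.
Implicit Types (x y a : I1 K) (p : {poly K}) (W I : set (I1 K)).

Definition a_stable a W := forall x, W x -> W (a * x).

(** [s] generates [I] as a [K[a]]-module. *)
Definition generates a (s : seq (I1 K)) I :=
  (forall x, x \in s -> I x) /\
  forall W, is_submod W -> a_stable a W -> (forall x, x \in s -> W x) -> I `<=` W.

(** A basis modulo F, together with a finite spanning set of the part in F. *)
Lemma tame_generates a I : tame a -> is_submod I -> I `<=` centralizer a ->
  a_stable a I -> exists s, generates a s I.
Proof.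
move=> ta IS IC Ia; have [rho [c [Ic span free]]] := tame_basis ta IS IC Ia.
have [||s sE] := tame_finite ta (S := [set x | F x /\ I x]).
- have [[F0 FD FZ] [I0 ID IZ]] := (@F_submod K, IS).
  split=> [|x y [Fx Ix] [Fy Iy]|l x [Fx Ix]]; split=> //.
  + exact: FD.
  + exact: ID.
  + exact: FZ.
  + exact: IZ.
- by move=> x [Fx Ix]; split=> //; apply: IC.
exists (s ++ [seq c r | r <- enum 'I_rho]); split=> [x|W WS Wa Ws x Ix].
  rewrite mem_cat => /orP [sx|/mapP [r _ ->]]; last exact: Ic.
  have : smallest (@is_submod K (I1 K)) [set` s] x by apply: gen_in_span.
  by rewrite -sE => -[].
have [p pP] := span x Ix.
have Wc : W (\sum_r horner_alg a (p r) * c r).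
  apply: submod_sum => // r _; apply: horner_stable => //; apply: Ws.
  by rewrite mem_cat map_f ?orbT // mem_enum.
rewrite -[x](subrK (\sum_r horner_alg a (p r) * c r)).
have [_ WD _] := WS; apply: WD => //.
have : smallest (@is_submod K (I1 K)) [set` s] (x - \sum_r horner_alg a (p r) * c r).
  rewrite -sE; split=> //; apply: submodB => //; apply: submod_sum => // r _.
  exact: horner_stable.
by apply: span_least => // y sy; apply: Ws; rewrite mem_cat sy.
Qed.

Lemma in_CenA a x : centralizer a x -> x \in subalg_pred (Cen a).
Proof. by move=> ax; apply/asboolP. Qed.

Lemma CenAP a (z : CenA a) : centralizer a (val z : I1 K).
Proof. by case: z => z /= /asboolP. Qed.

Lemma seq_lift (T : eqType) (P : {pred T}) (sT : subType P) (s : seq T) :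
  (forall x : T, x \in s -> x \in P) -> exists s' : seq sT, map val s' = s.
Proof.
elim: s => [|x s IH] sP; first by exists [::].
have [|s' s'E] := IH; first by move=> y ys; apply: sP; rewrite inE ys orbT.
have Px : P x := sP x (mem_head _ _).
by exists (Sub x Px :: s'); rewrite /= SubK s'E.
Qed.

(** The structures on [CenM a] and [CenA a] are compared with subsets of the algebra
    of all operators, where generation is easier to handle. *)
Lemma generates_fg_module a s : generates a s (centralizer a) -> fg_module (CenM a).
Proof.
move=> [sC sW].
have [s' s'E] := @seq_lift _ (submod_pred (Cen_mod a)) (CenM a) s (fun x sx => in_CenM (sC x sx)).
exists s'; apply/seteqP; split=> // z _ S [[S0 SD SZ] Ss].
have : [set x | exists2 y : CenM a, S y & (val y : I1 K) = x] (val z).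
  apply: sW (CenMP z); last 1 first.
  - move=> x; rewrite -s'E => /mapP [y ys ->]; exists y => //; exact: Ss.
  - split.
    + by exists 0.
    + by move=> _ _ [x Sx <-] [y Sy <-]; exists (x + y); first exact: SD.
    + move=> l _ [x Sx <-]; exists (l%:P *: x); first exact: SZ.
      by rewrite -[_ *: x]addr0 CenM_linE addr0 horner_algC mulr_algl.
  - move=> _ [x Sx <-]; exists ('X *: x); first exact: SZ.
    by rewrite -[_ *: x]addr0 CenM_linE addr0 horner_algX.
by move=> [y Sy /val_inj <-].
Qed.

Lemma fg_module_generates a : fg_module (CenM a) -> exists s, generates a s (centralizer a).
Proof.
move=> [s sE]; exists (map (fun y : CenM a => val y : I1 K) s); split.
  by move=> _ /mapP [y _ ->]; apply: CenMP.
move=> W WS Wa Ws x Cx.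
have : smallest (@is_submod _ (CenM a)) [set` s] (SubmodElt (in_CenM Cx)) by rewrite sE.
move=> /(_ [set z : CenM a | W (val z : I1 K)]); apply; split.
  have [W0 WD WZ] := WS; split=> // [y z Wy Wz|p z Wz]; first exact: WD.
  suff : W (val (p *: z : CenM a) : I1 K) by [].
  by rewrite -[_ *: z]addr0 CenM_linE addr0; apply: horner_stable.
by move=> y ys; apply: Ws; apply: map_f.
Qed.

Lemma subalg_fg_algebra a (s : seq (I1 K)) : (forall x, x \in s -> centralizer a x) ->
  (forall W, is_subalg W -> (forall x, x \in s -> W x) -> centralizer a `<=` W) ->
  fg_algebra (CenA a).
Proof.
move=> sC sW.
have [s' s'E] := @seq_lift _ (subalg_pred (Cen a)) (CenA a) s (fun x sx => in_CenA (sC x sx)).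
exists s'; apply/seteqP; split=> // z _ S [[[S0 SD SZ] S1 SM] Ss].
have : [set x | exists2 y : CenA a, S y & (val y : I1 K) = x] (val z).
  apply: sW (CenAP z); last first.
    by move=> x; rewrite -s'E => /mapP [y ys ->]; exists y => //; apply: Ss.
  split; first split.
  - by exists 0.
  - by move=> _ _ [x Sx <-] [y Sy <-]; exists (x + y); first exact: SD.
  - by move=> l _ [x Sx <-]; exists (l *: x); first exact: SZ.
  - by exists 1.
  - by move=> _ _ [x Sx <-] [y Sy <-]; exists (x * y); first exact: SM.
by move=> [y Sy /val_inj <-].
Qed.

Lemma fg_algebra_subalg a : fg_algebra (CenA a) ->
  exists s : seq (I1 K), (forall x, x \in s -> centralizer a x) /\
  (forall W, is_subalg W -> (forall x, x \in s -> W x) -> centralizer a `<=` W).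
Proof.
move=> [s sE]; exists (map (fun y : CenA a => val y : I1 K) s); split.
  by move=> _ /mapP [y _ ->]; apply: CenAP.
move=> W [[W0 WD WZ] W1 WM] Ws x Cx.
have : smallest (@is_subalg _ (CenA a)) [set` s] (SubalgElt (in_CenA Cx)) by rewrite sE.
move=> /(_ [set z : CenA a | W (val z : I1 K)]); apply; split; last first.
  by move=> y ys; apply: Ws; apply: map_f.
split; first split=> //= [y z Wy Wz|l z Wz]; first exact: WD.
- exact: WZ.
- exact: W1.
- by move=> y z Wy Wz; apply: WM.
Qed.

Lemma generates_fg_algebra a s : generates a s (centralizer a) -> fg_algebra (CenA a).
Proof.
move=> [sC sW]; apply: (@subalg_fg_algebra _ (a :: s)).
  by move=> x; rewrite inE => /orP [/eqP ->|/sC].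
move=> W [WS W1 WM] Ws; apply: sW => // [x Wx|x sx].
  by apply: WM => //; apply: Ws; apply: mem_head.
by apply: Ws; rewrite inE sx orbT.
Qed.

(** One-sided ideals are in particular [K[a]]-submodules, and these are finitely
    generated. *)
Lemma tame_noetherian_aux a (I : set (CenA a)) : tame a ->
  I 0 -> (forall z t, I z -> I t -> I (z + t)) ->
  (forall (l : K) z, I z -> I (l *: z)) ->
  (forall z, I z -> I (SubalgElt (in_CenA (Cen_self a)) * z)) ->
  exists s : seq (CenA a), (forall z, z \in s -> I z) /\
    forall J : set (CenA a), J 0 -> (forall z t, J z -> J t -> J (z + t)) ->
      (forall (l : K) z, J z -> J (l *: z)) ->
      (forall z, J z -> J (SubalgElt (in_CenA (Cen_self a)) * z)) ->
      (forall z, z \in s -> J z) -> I `<=` J.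
Proof.
move=> ta I0 ID IZ Ia.
pose im (J : set (CenA a)) : set (I1 K) := [set x | exists2 y : CenA a, J y & (val y : I1 K) = x].
have im_sub J : J 0 -> (forall z t, J z -> J t -> J (z + t)) ->
    (forall (l : K) z, J z -> J (l *: z)) -> is_submod (im J).
  move=> J0 JD JZ; split.
  - by exists 0.
  - by move=> _ _ [x Sx <-] [y Sy <-]; exists (x + y); first exact: JD.
  - by move=> l _ [x Sx <-]; exists (l *: x); first exact: JZ.
have im_st J : (forall z, J z -> J (SubalgElt (in_CenA (Cen_self a)) * z)) -> a_stable a (im J).
  by move=> Ja _ [x Jx <-]; exists (SubalgElt (in_CenA (Cen_self a)) * x); first exact: Ja.
have [|s [sI sW]] := tame_generates ta (im_sub I I0 ID IZ) _ (im_st I Ia).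
  by move=> _ [x _ <-]; apply: CenAP.
have sC x : x \in s -> x \in subalg_pred (Cen a).
  by move=> /sI [y _ <-]; apply/in_CenA/CenAP.
have [s' s'E] := @seq_lift _ (subalg_pred (Cen a)) (CenA a) s sC.
exists s'; split=> [x xs|J J0 JD JZ Ja Js x Ix].
  have : (val x : I1 K) \in s by rewrite -s'E map_f.
  by move=> /sI [y Iy /val_inj <-].
have : im J (val x).
  apply: (sW (im J)); [exact: im_sub|exact: im_st| |by exists x].
  by move=> y; rewrite -s'E => /mapP [z zs ->]; exists z => //; apply: Js.
by move=> [y Jy /val_inj <-].
Qed.

Lemma tame_left_noetherian a : tame a -> left_noetherian (CenA a).
Proof.
move=> ta I [I0 ID IM].
have IZ (J : set (CenA a)) : left_ideal J -> forall (l : K) z, J z -> J (l *: z).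
  by move=> [_ _ JM] l x Jx; rewrite -mulr_algl; apply: JM.
have [||s [sI sJ]] := tame_noetherian_aux ta I0 ID; first exact: IZ.
  by move=> x; apply: IM.
exists s; apply/seteqP; split=> [x Ix J [Jl Js]|x]; last by apply; split.
by have [J0 JD JM] := Jl; apply: sJ => //; [apply: IZ|move=> y; apply: JM].
Qed.

Lemma tame_right_noetherian a : tame a -> right_noetherian (CenA a).
Proof.
move=> ta I [I0 ID IM].
have IZ (J : set (CenA a)) : right_ideal J -> forall (l : K) z, J z -> J (l *: z).
  by move=> [_ _ JM] l x Jx; rewrite -[x]mulr1 scalerAr; apply: JM.
have aE z : SubalgElt (in_CenA (Cen_self a)) * z = z * SubalgElt (in_CenA (Cen_self a)).
  by apply: val_inj; apply: CenAP.
have [||s [sI sJ]] := tame_noetherian_aux ta I0 ID; first exact: IZ.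
  by move=> x; rewrite aE; apply: IM.
exists s; apply/seteqP; split=> [x Ix J [Jl Js]|x]; last by apply; split.
by have [J0 JD JM] := Jl; apply: sJ => //; [apply: IZ|move=> y; rewrite aE; apply: JM].
Qed.

(** ** The case of nonzero degree *)

Lemma comm_space_F a : (forall x y, centralizer a x -> centralizer a y -> F (x * y - y * x)) ->
  commutator_space (Cen a) `<=` CenF a.
Proof.
move=> comm; apply: span_least; first exact: CenF_submod.
move=> _ [x Cx [y Cy <-]]; split; first exact: comm.
by apply: CenB; apply: Cen_mul.
Qed.

Lemma nonzero_degree a : ~ [set x + y | x in KH & y in F] a ->
  pi_minus a < 0 \/ 0 < pi_plus a.
Proof.
move=> nKH; apply: contrapT => /not_orP [/negP + /negP]; rewrite -!leNgt => pm pp.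
apply: nKH; exists (evalH ((nf a).1 0)); first by apply/KHP; exists ((nf a).1 0).
exists (a - evalH ((nf a).1 0)); last by rewrite addrC subrK.
have [Fa|nFa] := pselect (F a).
  have ac : has_symbol a (nf a).1 by apply: nf_symbol.
  by rewrite ((F_symbol ac).1 Fa) /evalH rmorph0 subr0.
have [_ ppP] := pi_plusP nFa; have [_ pmP] := pi_minusP nFa.
have ac : has_symbol (-1 *: evalH ((nf a).1 0) + a)
    (fun i => -1 *: (if i == 0 then (nf a).1 0 else 0) + (nf a).1 i).
  by apply: has_symbolZD; [apply: has_symbol_evalH|apply: nf_symbol].
have -> : a - evalH ((nf a).1 0) = -1 *: evalH ((nf a).1 0) + a by rewrite scaleN1r addrC.
apply: (F_symbol ac).2 => i; have [->|i0] := eqVneq i 0; first by rewrite scaleN1r addNr.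
rewrite scaler0 add0r; apply: contrapT => ci.
by move/eqP: i0; apply; apply/eqP; rewrite eq_le (le_trans (ppP _ ci)) ?(le_trans _ (pmP _ ci)).
Qed.

End Generation.

Section NonzeroDegree.
Context {K : fieldType} {charK : charZero K}.
Implicit Types (x y a : I1 K) (p : {poly K}).

Lemma pi_plus_basis a : ~ F a -> 0 < pi_plus a ->
  tame a /\ exists rho c, @Fbasis K a (centralizer a) rho c /\ (rho %| absz (pi_plus a))%N.
Proof.
move=> nFa; have [b b0 ab] := top_pi_plus nFa.
case: (pi_plus a) ab => // m ab m0; have {}m0 : (0 < m)%N by lia.
by split; [apply: raising_tame m0 b0 ab|apply: Fbasis_Cen_dvd m0 b0 ab].
Qed.

Lemma star_Cen_image a : star @` centralizer (star a) = centralizer a.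
Proof.
apply/seteqP; split=> [_ [x /star_Cen + <-]|x /star_Cen Cx]; first by rewrite starK.
by exists (star x); rewrite ?starK.
Qed.

Lemma pi_minus_basis a : ~ F a -> pi_minus a < 0 ->
  tame a /\ exists rho c, @Fbasis K a (centralizer a) rho c /\ (rho %| absz (pi_minus a))%N.
Proof.
move=> nFa; have [b b0 ab] := top_pi_minus nFa.
rewrite -[pi_minus a]opprK; case: (- pi_minus a) ab => [m|m] ab m0; last by lia.
have {}m0 : (0 < m)%N by lia.
split; first by apply: tame_star; apply: raising_tame m0 b0 ab.
have [rho [c [cP dvd]]] := Fbasis_Cen_dvd m0 b0 ab.
exists rho, (fun r => star (c r)); split; last by rewrite abszN.
by have := star_Fbasis (@subset_refl _ _) cP; rewrite starK star_Cen_image; apply.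
Qed.

Lemma F_sub_KHF x : F x -> [set x + y | x in KH & y in F] x.
Proof.
by move=> Fx; exists 0; [apply/KHP; exists 0; rewrite /evalH rmorph0|exists x; rewrite ?add0r].
Qed.

(** When [a] raises the degrees and lowers them as well, each side gives a basis
    whose length divides the degree on that side; the lengths agree. *)
Lemma nonzero_degree_tame a : ~ [set x + y | x in KH & y in F] a ->
  tame a /\ exists rho c, [/\ @Fbasis K a (centralizer a) rho c,
    pi_minus a < 0 -> (rho %| absz (pi_minus a))%N &
    0 < pi_plus a -> (rho %| absz (pi_plus a))%N].
Proof.
move=> nKHF; have nFa : ~ F a by move=> /F_sub_KHF.
have [pm|pp] := nonzero_degree nKHF.
  have [ta [rho [c [cP dvd]]]] := pi_minus_basis nFa pm.
  split=> //; exists rho, c; split=> // /(pi_plus_basis nFa) [_ [rho' [c' [cP' dvd']]]].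
  by rewrite (Fbasis_uniq cP cP').
have [ta [rho [c [cP dvd]]]] := pi_plus_basis nFa pp.
split=> //; exists rho, c; split=> // /(pi_minus_basis nFa) [_ [rho' [c' [cP' dvd']]]].
by rewrite (Fbasis_uniq cP cP').
Qed.

Theorem nonzero_degree_Cen a : ~ [set x + y | x in KH & y in F] a ->
    exists rho : nat,
      ((1 <= rho)%N /\ fg_module (CenM a) /\ has_rank (CenM a) rho /\
       fg_algebra (CenA a) /\ left_noetherian (CenA a) /\
       right_noetherian (CenA a)) /\
      (mod_iso (CenM a) ({ffun 'I_rho -> KalgM a} * CenFM charK a)%type /\
       (pi_minus a < 0 -> (rho %| absz (pi_minus a))%N) /\
       (0 < pi_plus a -> (rho %| absz (pi_plus a))%N)) /\
      (commutator_space (Cen a) `<=` CenF a /\ finite_dim (CenF a) /\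
       CenF a = torsion (Cen_mod a)).
Proof.
move=> /nonzero_degree_tame [ta [rho [c [cP dvdm dvdp]]]]; exists rho.
have [s gs] := tame_generates ta (Cen_submod a) (@subset_refl _ _) (@Cen_comm _ a).
split; [split; [|split; [|split; [|split; [|split]]]]|split; [split; [|split]|split; [|split]]].
- exact: Fbasis_gt0 cP.
- exact: generates_fg_module gs.
- exact: Fbasis_rank cP.
- exact: generates_fg_algebra gs.
- exact: tame_left_noetherian.
- exact: tame_right_noetherian.
- exact: Fbasis_mod_iso cP.
- exact: dvdm.
- exact: dvdp.
- by apply: comm_space_F => x y; apply: tame_comm.
- by apply: (tame_finite ta); [apply: CenF_submod|apply: subset_refl].
- exact: Fbasis_torsion cP.
Qed.

End NonzeroDegree.

(** * Operators that are diagonal outside of a finite block *)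

Section DirectSums.
Context {K : fieldType} {charK : charZero K}.
Implicit Types (x y a : I1 K) (W : set (I1 K)).

(** Each entry of the sum comes from a single term. *)
Lemma supp_independent (I : choiceType) (D : set I) (U : I -> set (I1 K))
    (R : I -> nat -> nat -> Prop) :
  (forall i x, D i -> U i x -> forall k j, ~ R i k j -> cf x k j = 0) ->
  (forall i i' k j, D i -> D i' -> R i k j -> R i' k j -> i = i') ->
  independent D U.
Proof.
move=> UR Rinj w Uw fw w0 i Di; apply: cf_inj => k j; rewrite cf0.
have [Rkj|nR] := pselect (R i k j); last exact: UR (Uw i Di) _ _ nR.
have : cf (\sum_(i \in D) w i) k j = 0 by rewrite w0 cf0.
rewrite (fsum_morph (phi := fun x => cf x k j)) ?cf0 //; last first.
  by move=> x y; rewrite cfD.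
rewrite (fsum1 Di) // => i' Di' ne.
by apply: (UR i' _ Di' (Uw i' Di')) => Rkj'; apply: ne; apply: Rinj Rkj' Rkj.
Qed.

Lemma is_dsum_tmod a (I : choiceType) (D : set I) (U : I -> set (I1 K)) W :
  is_dsum D U W -> (forall i, D i -> a_stable a (U i)) ->
  @is_dsum {poly K} (tmod a) I D U W.
Proof.
move=> [US WE Uind] Ua; split=> // i Di.
exact: tmod_submod (US i Di) (Ua i Di).
Qed.

Lemma fam_sum_dsum (I : choiceType) (D : set I) (U : I -> set (I1 K)) R :
  (forall i, D i -> is_submod (U i)) ->
  (forall i x, D i -> U i x -> forall k j, ~ R i k j -> cf x k j = 0) ->
  (forall i i' k j, D i -> D i' -> R i k j -> R i' k j -> i = i') ->
  is_dsum D U (fam_sum D U).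
Proof. by move=> US UR Rinj; split=> //; apply: supp_independent UR Rinj. Qed.

Lemma fam_sum_supp (I : choiceType) (D : set I) (U : I -> set (I1 K)) (R : nat -> nat -> Prop) :
  (forall i, D i -> is_submod (U i)) ->
  (forall i x, D i -> U i x -> forall k j, ~ R k j -> cf x k j = 0) ->
  forall x, fam_sum D U x -> forall k j, ~ R k j -> cf x k j = 0.
Proof.
move=> US UR; apply: (fam_sum_sub (supp_submod (fun k j => ~ R k j))) => i Di x Ux k j.
exact: UR Ux k j.
Qed.

Lemma fam_sum_stable a (I : choiceType) (D : set I) (U : I -> set (I1 K)) :
  (forall i, D i -> is_submod (U i)) -> (forall i, D i -> a_stable a (U i)) ->
  a_stable a (fam_sum D U).
Proof.
move=> US Ua x; have FS := fam_sum_submod US.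
suff : fam_sum D U `<=` [set y | fam_sum D U (a * y)] by apply.
apply: fam_sum_sub => [|i Di y Uy /=]; last first.
  by apply: (fam_sum_mem US Di); apply: Ua.
have [F0 FD FZ] := FS; split=> [|y z|l y] /=; first by rewrite mulr0.
  by rewrite mulrDr; apply: FD.
by rewrite -scalerAr; apply: FZ.
Qed.

Lemma line_submod x : is_submod (line x).
Proof.
split; first by exists 0; rewrite ?scale0r.
  by move=> _ _ [l _ <-] [l' _ <-]; exists (l + l'); rewrite ?scalerDl.
by move=> l _ [l' _ <-]; exists (l * l'); rewrite ?scalerA.
Qed.

Lemma line_stable a l x : a * x = l *: x -> a_stable a (line x).
Proof. by move=> ax _ [l' _ <-]; exists (l' * l); rewrite // -scalerAr ax scalerA. Qed.

Lemma image_submod (phi : I1 K -> I1 K) W : is_submod W ->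
  (forall l x y, phi (l *: x + y) = l *: phi x + phi y) -> is_submod [set phi w | w in W].
Proof.
move=> [W0 WD WZ] phi_lin; have phi0 : phi 0 = 0.
  by have := phi_lin (-1) 0 0; rewrite scaler0 addr0 scaleN1r addNr.
split; first by exists 0.
  move=> _ _ [x Wx <-] [y Wy <-]; exists (x + y); first exact: WD.
  by rewrite -[x]scale1r phi_lin !scale1r.
move=> l _ [x Wx <-]; exists (l *: x); first exact: WZ.
by rewrite -[l *: x]addr0 phi_lin phi0 addr0.
Qed.

End DirectSums.

Section Blocks.
Context {K : fieldType} {charK : charZero K}.
Context {alpha : {poly K}} {f : I1 K} {d : int}.
Hypotheses (d_ge : -1 <= d) (fd : Fle d f).
Implicit Types (x y : I1 K).

Local Notation a := (evalH alpha + f).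
Local Notation P := (@e_le K d).
Local Notation Q := (@e_gt K d).
Local Notation eigen j := (alpha.[j.+1%:R]).

Lemma cf_e_le k j : cf P k j = ((k == j) && (k%:Z <= d))%:R.
Proof.
rewrite /e_le cf_sum; under eq_bigr do rewrite cf_e.
rewrite big_mkord; case: (boolP (k%:Z <= d)) => kd; last first.
  rewrite andbF big1 // => i _; case: andP => // -[/eqP ki _]; have := ltn_ord i.
  lia.
have lt : (k < absz (d + 1)%R)%N by lia.
rewrite (bigD1 (Ordinal lt)) //= eqxx big1 ?addr0 => [|i ne]; first by rewrite andbT.
rewrite (_ : (k == i) = false) //; apply: contraNF ne => /eqP ki; exact/eqP/val_inj.
Qed.

Lemma cf_PM x k j : cf (P * x) k j = if k%:Z <= d then cf x k j else 0.
Proof.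
rewrite (@cfM1 _ _ _ _ _ _ k) => [|l /negPf ne].
  by rewrite cf_e_le eqxx; case: ifP; rewrite ?mul1r ?mul0r.
by rewrite cf_e_le eq_sym ne mul0r.
Qed.

Lemma cf_MP x k j : cf (x * P) k j = if j%:Z <= d then cf x k j else 0.
Proof.
rewrite (@cfM1 _ _ _ _ _ _ j) => [|l /negPf ne].
  by rewrite cf_e_le eqxx; case: ifP; rewrite ?mulr1 ?mulr0.
by rewrite cf_e_le ne mulr0.
Qed.

Lemma cf_QM x k j : cf (Q * x) k j = if k%:Z <= d then 0 else cf x k j.
Proof. by rewrite mulrBl mul1r cfB cf_PM; case: ifP; rewrite ?subrr ?subr0. Qed.

Lemma cf_MQ x k j : cf (x * Q) k j = if j%:Z <= d then 0 else cf x k j.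
Proof. by rewrite mulrBr mulr1 cfB cf_MP; case: ifP; rewrite ?subrr ?subr0. Qed.

Lemma P_F : F P. Proof. by apply: F_sum => i _; apply: F_eij. Qed.

Lemma cf_f0 k j : ~ (k%:Z <= d /\ j%:Z <= d) -> cf f k j = 0.
Proof. by move/FleP: fd; apply. Qed.

Lemma cf_a k j : cf a k j = eigen k * (k == j)%:R + cf f k j.
Proof. by rewrite cfD cf_evalH. Qed.

Lemma cf_aM x k j : ~ k%:Z <= d -> cf (a * x) k j = eigen k * cf x k j.
Proof.
move=> kd; rewrite (@cfM1 _ _ _ _ _ _ k) => [|l /negPf ne].
  by rewrite cf_a eqxx mulr1 cf_f0 ?addr0 // => -[].
by rewrite cf_a eq_sym ne mulr0 cf_f0 ?addr0 ?mul0r // => -[].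
Qed.

Lemma cf_Ma x k j : ~ j%:Z <= d -> cf (x * a) k j = eigen j * cf x k j.
Proof.
move=> jd; rewrite (@cfM1 _ _ _ _ _ _ j) => [|l /negPf ne].
  by rewrite cf_a eqxx mulr1 cf_f0 ?addr0 1?mulrC // => -[].
by rewrite cf_a ne mulr0 cf_f0 ?addr0 ?mulr0 // => -[].
Qed.

Lemma aP : a * P = P * a.
Proof.
apply: cf_inj => k j; rewrite cf_MP cf_PM cf_a.
case: ifP => [jd|/negP jd]; case: ifP => [kd|/negP kd] //; rewrite cf_f0 ?addr0; try by case.
- by rewrite (_ : (k == j) = false) ?mulr0 //; lia.
- by rewrite (_ : (k == j) = false) ?mulr0 //; lia.
Qed.

Lemma a_e k j : ~ k%:Z <= d -> a * e k j = eigen k *: e k j.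
Proof.
move=> kd; apply: cf_inj => i l; rewrite cfZ cf_Me cf_e cf_a.
have [->|ne] := eqVneq i k; last by rewrite mulr0 cf_f0 ?addr0 ?mul0r ?mulr0 // => -[].
by rewrite mulr1 cf_f0 ?addr0 // => -[].
Qed.

Lemma e_a k j : ~ j%:Z <= d -> e k j * a = eigen j *: e k j.
Proof.
move=> jd; apply: cf_inj => i l; rewrite cfZ cf_eM cf_e cf_a.
have [jl|ne] := eqVneq j l; last by rewrite mulr0 cf_f0 ?addr0 ?andbF ?mulr0 // => -[].
by rewrite -jl mulr1 andbT cf_f0 ?addr0 1?mulrC // => -[].
Qed.

Lemma a11E : a11 alpha f d = a * P.
Proof.
apply: cf_inj => k j; rewrite cfD cf_MP cf_a cf_sum.
under eq_bigr do rewrite cfZ cf_e.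
case: ifP => [jd|/negP jd]; last first.
  rewrite cf_f0 ?addr0; last by case.
  rewrite big_mkord big1 // => i _; case: andP => [[/eqP ki /eqP ij]|]; rewrite ?mulr0 //.
  by have := ltn_ord i; lia.
congr (_ + _); rewrite big_mkord.
have lt : (j < absz (d + 1)%R)%N by lia.
rewrite (bigD1 (Ordinal lt)) //= eqxx andbT big1 ?addr0 => [|i ne].
  by case: eqP => [->|]; rewrite ?mulr0.
rewrite [(i : nat) == j](_ : _ = false) ?andbF ?mulr0 //.
by apply: contraNF ne => /eqP ij; apply/eqP/val_inj.
Qed.

Lemma H0P x : H0 d x <-> forall k j, ~ (k%:Z <= d /\ j = 0%N) -> cf x k j = 0.
Proof.
split=> [|x0].
  apply: (span_least (supp_submod (fun k j => ~ (k%:Z <= d /\ j = 0%N)))).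
  move=> _ [i [id ->]] k j n; rewrite cf_e; case: andP => // -[/eqP ki /eqP j0].
  by case: n; rewrite ki.
have -> : x = \sum_(i < absz (d + 1)%R) cf x i 0 *: e i 0.
  apply: cf_inj => k j; rewrite cf_sum; under eq_bigr do rewrite cfZ cf_e.
  have [[kd ->]|n] := pselect (k%:Z <= d /\ j = 0%N).
    have lt : (k < absz (d + 1)%R)%N by lia.
    rewrite (bigD1 (Ordinal lt)) //= eqxx mulr1 big1 ?addr0 // => i ne.
    rewrite (_ : (k == i) = false) ?mulr0 //.
    by apply: contraNF ne => /eqP ki; apply/eqP/val_inj.
  rewrite x0 // big1 // => i _; case: andP => [[/eqP ki /eqP j0]|]; rewrite ?mulr0 //.
  by case: n; split=> //; have := ltn_ord i; lia.
have [_ _ HZ] := Kspan_submod [set x : I1 K | exists i : nat, i%:Z <= d /\ x = e i 0].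
apply: submod_sum (Kspan_submod _) _ => i _; apply: HZ; apply: gen_in_span.
by exists i; split=> //; have := ltn_ord i; lia.
Qed.

Lemma star_V0 x : V0 d x <-> H0 d (star x).
Proof.
have Ve (j : nat) : j%:Z <= d -> V0 d (e 0 j : I1 K).
  by move=> jd; apply: gen_in_span; exists j.
have He (j : nat) : j%:Z <= d -> H0 d (e j 0 : I1 K).
  by move=> jd; apply: gen_in_span; exists j.
have sub (W : set (I1 K)) : is_submod W -> is_submod [set y | W (star y)].
  move=> [W0 WD WZ]; split=> [|y z|l y] /=; rewrite ?star0 ?starD ?starZ //.
  - exact: WD.
  - exact: WZ.
split=> [|Hx].
  apply: (span_least (sub _ (Kspan_submod _))) => _ [j [jd ->]] /=.
  by rewrite star_e; apply: He.
rewrite -[x]starK; move: (star x) Hx.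
apply: (span_least (sub _ (Kspan_submod _))) => _ [j [jd ->]] /=.
by rewrite star_e; apply: Ve.
Qed.

Lemma V0P x : V0 d x <-> forall k j, ~ (j%:Z <= d /\ k = 0%N) -> cf x k j = 0.
Proof.
split=> [/star_V0/H0P x0 k j n|x0]; first by rewrite -[cf x k j]cf_star x0.
by apply/star_V0/H0P => k j n; rewrite cf_star x0.
Qed.

End Blocks.

Section BlockDecomposition.
Context {K : fieldType} {charK : charZero K}.
Context {alpha : {poly K}} {f : I1 K} {d : int}.
Hypotheses (d_ge : -1 <= d) (fd : Fle d f).
Implicit Types (x y : I1 K).

Local Notation a := (evalH alpha + f).
Local Notation b := (a11 alpha f d).
Local Notation P := (@e_le K d).
Local Notation Q := (@e_gt K d).
Local Notation eigen j := (alpha.[j.+1%:R]).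
Local Notation kerHj := (kerH b alpha d).
Local Notation kerVi := (kerV b alpha d).

Lemma P_H0 x : H0 d x -> P * x = x.
Proof.
move=> /(H0P d_ge) x0; apply: cf_inj => k j; rewrite (cf_PM d_ge); case: ifP => // /negP kd.
by rewrite x0 //; case.
Qed.

Lemma V0_P x : V0 d x -> x * P = x.
Proof.
move=> /(V0P d_ge) x0; apply: cf_inj => k j; rewrite (cf_MP d_ge); case: ifP => // /negP kd.
by rewrite x0 //; case.
Qed.

Lemma P_Fle x : Fle d x -> P * x = x.
Proof.
move=> /FleP x0; apply: cf_inj => k j; rewrite (cf_PM d_ge); case: ifP => // /negP kd.
by rewrite x0 //; case.
Qed.

Lemma Fle_P x : Fle d x -> x * P = x.
Proof.
move=> /FleP x0; apply: cf_inj => k j; rewrite (cf_MP d_ge); case: ifP => // /negP kd.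
by rewrite x0 //; case.
Qed.

Lemma bP : b = P * a. Proof. by rewrite (a11E d_ge fd) (aP d_ge fd). Qed.

Lemma b_eigen (l : K) x : P * x = x -> (b - l%:A) * x = a * x - l *: x.
Proof. by move=> Px; rewrite (a11E d_ge fd) mulrBl -mulrA Px mulr_algl. Qed.

Lemma eigen_b (l : K) x : x * P = x -> x * (b - l%:A) = x * a - l *: x.
Proof. by move=> Px; rewrite bP mulrBr mulrA Px -scalerAr mulr1. Qed.

Lemma Fle_Cen x : Fle d x -> (centralizer b x <-> centralizer a x).
Proof.
move=> xd; rewrite /centralizer /=.
have -> : b * x = a * x by rewrite (a11E d_ge fd) -mulrA P_Fle.
by have -> : x * b = x * a by rewrite bP mulrA Fle_P.
Qed.

Lemma Cen_P : centralizer a P. Proof. exact: aP. Qed.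

Lemma block_dec x : x = P * x * P + P * x * Q + Q * x * P + Q * x * Q.
Proof.
apply: cf_inj => k j; rewrite !cfD !(cf_MP d_ge, cf_MQ d_ge) !(cf_PM d_ge, cf_QM d_ge).
by case: (j%:Z <= d); case: (k%:Z <= d); rewrite ?addr0 ?add0r.
Qed.

Lemma PxP_Fle x : Fle d (P * x * P).
Proof.
apply/FleP => k j n; rewrite (cf_MP d_ge) (cf_PM d_ge).
by case: ifP => // jd; case: ifP => // kd; case: n.
Qed.

(** ** The mixed blocks *)

Lemma in_kerH x j : d < j%:Z -> centralizer a x -> kerHj j (P * x * e j j).
Proof.
move=> dj Cx; have nj : ~ j%:Z <= d by lia.
exists (P * x * e j 0); last by rewrite -mulrA e_eqM.
have uH : H0 d (P * x * e j 0).
  apply/(H0P d_ge) => k i n; rewrite cf_Me (cf_PM d_ge); case: ifP => kd; last by rewrite mul0r.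
  by case: eqP => i0; rewrite ?mulr0 //; case: n.
split=> //; rewrite b_eigen; last exact: P_H0.
have -> : a * (P * x * e j 0) = P * x * (a * e j 0).
  by rewrite 2!(mulrA a) (aP d_ge fd) -(mulrA P a) Cx !mulrA.
by rewrite (a_e fd) // -scalerAr subrr.
Qed.

Lemma in_kerV x i : d < i%:Z -> centralizer a x -> kerVi i (e i i * x * P).
Proof.
move=> di Cx; have ni : ~ i%:Z <= d by lia.
exists (e 0 i * x * P); last by rewrite !mulrA e_eqM.
have uV : V0 d (e 0 i * x * P).
  apply/(V0P d_ge) => k j n; rewrite (cf_MP d_ge) cf_eM; case: ifP => // jd.
  by case: eqP => k0; rewrite ?mul0r //; case: n.
split=> //; rewrite eigen_b; last exact: V0_P.
have -> : e 0 i * x * P * a = e 0 i * a * x * P.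
  by rewrite -(mulrA _ P) -(aP d_ge fd) mulrA -(mulrA (e 0 i) x) -Cx !mulrA.
by rewrite (e_a fd) // -!scalerAl subrr.
Qed.

Lemma kerH_submod j : is_submod (kerHj j).
Proof.
apply: image_submod => [|l x y]; last by rewrite mulrDl scalerAl.
have [H0 HD HZ] := Kspan_submod [set x : I1 K | exists i : nat, i%:Z <= d /\ x = e i 0].
split=> [|x y [Hx bx] [Hy by_]|l x [Hx bx]]; split=> //; rewrite ?mulr0 //.
- exact: HD.
- by rewrite mulrDr bx by_ addr0.
- exact: HZ.
- by rewrite -scalerAr bx scaler0.
Qed.

Lemma kerV_submod i : is_submod (kerVi i).
Proof.
apply: image_submod => [|l x y]; last by rewrite mulrDr scalerAr.
have [V0 VD VZ] := Kspan_submod [set x : I1 K | exists j : nat, j%:Z <= d /\ x = e 0 j].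
split=> [|x y [Vx bx] [Vy by_]|l x [Vx bx]]; split=> //; rewrite ?mul0r //.
- exact: VD.
- by rewrite mulrDl bx by_ addr0.
- exact: VZ.
- by rewrite -scalerAl bx scaler0.
Qed.

Lemma kerH_supp j x k l : kerHj j x -> ~ (k%:Z <= d /\ l = j) -> cf x k l = 0.
Proof.
move=> [u [Hu _] <-] n; rewrite cf_Me; case: eqP => [jl|]; rewrite ?mulr0 //.
by rewrite mulr1; move/(H0P d_ge): Hu; apply=> -[kd _]; apply: n.
Qed.

Lemma kerV_supp i x k l : kerVi i x -> ~ (l%:Z <= d /\ k = i) -> cf x k l = 0.
Proof.
move=> [u [Vu _] <-] n; rewrite cf_eM; case: eqP => [ki|]; rewrite ?mul0r //.
by rewrite mul1r; move/(V0P d_ge): Vu; apply=> -[ld _]; apply: n.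
Qed.

Lemma kerH_eigen j x : kerHj j x -> a * x = eigen j *: x.
Proof.
move=> [u [Hu +] <-]; rewrite b_eigen ?mulrA; last exact: P_H0.
by move=> /eqP; rewrite subr_eq0 => /eqP ->; rewrite scalerAl.
Qed.

Lemma kerV_eigen i x : kerVi i x -> x * a = eigen i *: x.
Proof.
move=> [u [Vu +] <-]; rewrite eigen_b -?mulrA; last exact: V0_P.
by move=> /eqP; rewrite subr_eq0 => /eqP ->; rewrite scalerAr.
Qed.

Lemma kerH_Cen j x : d < j%:Z -> kerHj j x -> centralizer a x.
Proof.
move=> dj kx; have ax := kerH_eigen kx; case: kx ax => u _ <- ax.
by rewrite /centralizer /= ax -mulrA (e_a fd) ?scalerAr //; lia.
Qed.

Lemma kerV_Cen i x : d < i%:Z -> kerVi i x -> centralizer a x.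
Proof.
move=> di kx; have xa := kerV_eigen kx; case: kx xa => u _ <- xa.
by rewrite /centralizer /= xa mulrA (a_e fd) ?scalerAl //; lia.
Qed.

Lemma kerH_F j x : kerHj j x -> F x.
Proof. by move=> [u _ <-]; apply: FM; apply: F_eij. Qed.

Lemma kerV_F i x : kerVi i x -> F x.
Proof. by move=> [u _ <-]; apply: FMr; apply: F_eij. Qed.

Lemma kerH_stable j : a_stable a (kerHj j).
Proof. by move=> x kx; rewrite (kerH_eigen kx); have [_ _] := kerH_submod j; apply. Qed.

Lemma kerV_stable i : d < i%:Z -> a_stable a (kerVi i).
Proof.
move=> di x kx; rewrite (kerV_Cen di kx) (kerV_eigen kx).
by have [_ _] := kerV_submod i; apply.
Qed.

Lemma PxQ_fam_sum x : centralizer a x -> fam_sum (idx_gt d) kerHj (P * x * Q).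
Proof.
move=> Cx; have FPx : F (P * x) by apply: FMr; apply: P_F.
have [N0 /(_ _ (leqnn _)) PxE] := F_block FPx.
have -> : P * x * Q = \sum_(j < N0 | ~~ (j%:Z <= d)) P * x * e j j.
  apply: cf_inj => k l; rewrite (cf_MQ d_ge) cf_sum; under eq_bigr do rewrite cf_Me.
  have zero : (N0 <= l)%N || (l%:Z <= d) -> \sum_(j < N0 | ~~ (j%:Z <= d)) cf (P * x) k j * ((j : nat) == l)%:R = 0.
    move=> h; rewrite big1 // => j jd; case: eqP => [jl|]; rewrite ?mulr0 //.
    by have := ltn_ord j; move: jd h; rewrite jl; lia.
  case: ifP => ld; first by rewrite zero ?ld ?orbT.
  have [leN|ltN] := leqP N0 l; last first.
    rewrite (bigD1 (Ordinal ltN)) /= ?ld // eqxx mulr1 big1 ?addr0 // => j /andP [_ ne].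
    rewrite (_ : (j == l :> nat) = false) ?mulr0 //.
    by apply: contraNF ne => /eqP jl; apply/eqP/val_inj.
  by rewrite zero ?leN // PxE cf_block_sum [(l < N0)%N]ltnNge leN andbF.
apply: submod_sum; first exact: (fam_sum_submod (fun j _ => kerH_submod j)).
move=> j jd; have dj : d < j%:Z by lia.
by apply: (fam_sum_mem (fun j _ => kerH_submod j) dj); apply: in_kerH.
Qed.

Lemma QxP_fam_sum x : centralizer a x -> fam_sum (idx_gt d) kerVi (Q * x * P).
Proof.
move=> Cx; have FxP : F (x * P) by apply: FM; apply: P_F.
have [N0 /(_ _ (leqnn _)) xPE] := F_block FxP.
have -> : Q * x * P = \sum_(i < N0 | ~~ (i%:Z <= d)) e i i * x * P.
  apply: cf_inj => k l; rewrite -mulrA (cf_QM d_ge) cf_sum; under eq_bigr do rewrite -mulrA cf_eM.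
  have zero : (N0 <= k)%N || (k%:Z <= d) -> \sum_(i < N0 | ~~ (i%:Z <= d)) (k == i)%:R * cf (x * P) i l = 0.
    move=> h; rewrite big1 // => i id; case: eqP => [ki|]; rewrite ?mul0r //.
    by have := ltn_ord i; move: id h; rewrite ki; lia.
  case: ifP => kd; first by rewrite zero ?kd ?orbT.
  have [leN|ltN] := leqP N0 k; last first.
    rewrite (bigD1 (Ordinal ltN)) /= ?kd // eqxx mul1r big1 ?addr0 // => i /andP [_ ne].
    rewrite (_ : (k == i :> nat) = false) ?mul0r //.
    by apply: contraNF ne => /eqP ki; apply/eqP/val_inj.
  by rewrite zero ?leN // xPE cf_block_sum [(k < N0)%N]ltnNge leN.
apply: submod_sum; first exact: (fam_sum_submod (fun i _ => kerV_submod i)).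
move=> i id; have di : d < i%:Z by lia.
by apply: (fam_sum_mem (fun i _ => kerV_submod i) di); apply: in_kerV.
Qed.

(** ** The block outside of the finite one *)

Lemma iter_tau_horner (p : {poly K}) i (z : K) : (iter i (@tau K) p).[z] = p.[z + i%:R].
Proof.
elim: i z => [|i IH] z /=; first by rewrite addr0.
by rewrite /tau horner_comp !hornerE IH -natr1 -addrA (addrC 1).
Qed.

Lemma C_indexP i j : C_index alpha d (i, j) <->
  [/\ (1 <= i)%N, d < j%:Z & eigen (i + j) = eigen j].
Proof.
rewrite /C_index /=; split=> -[i1 dj].
  rewrite /root hornerD hornerN iter_tau_horner subr_eq0 -natrD addSn addnC => /eqP.
  by [].
move=> E; split=> //; rewrite /root hornerD hornerN iter_tau_horner subr_eq0 -natrD addSn.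
by rewrite addnC E.
Qed.

Lemma C_line_submod ij : C_index alpha d ij -> is_submod (@C_line K ij).
Proof. by move=> _; apply: line_submod. Qed.

Lemma C_space_submod : is_submod (C_space alpha d).
Proof. exact: fam_sum_submod C_line_submod. Qed.

Lemma star_C_space_submod : is_submod (star @` C_space alpha d).
Proof. exact/star_submod/C_space_submod. Qed.

Lemma in_C_space k l : (l < k)%N -> d < l%:Z -> eigen k = eigen l ->
  C_space alpha d (e k l).
Proof.
move=> lk dl E; have C : C_index alpha d ((k - l)%N, l).
  by apply/C_indexP; split; rewrite ?subnK ?subn_gt0 // ltnW.
apply: (fam_sum_mem C_line_submod C); exists 1 => //.
by rewrite scale1r /= subnK // ltnW.
Qed.

Lemma diag_submod (j : nat) : idx_gt d j -> is_submod (@diag_line K j).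
Proof. by move=> _; apply: line_submod. Qed.

Lemma QxQ_fam_sum x (W : set (I1 K)) : is_submod W -> F x -> centralizer a x ->
  (forall k l, d < k%:Z -> d < l%:Z -> eigen k = eigen l -> W (e k l)) ->
  W (Q * x * Q).
Proof.
move=> WS Fx Cx We.
have FQ : F (Q * x * Q) by apply: FMr; apply: FM.
have [N0 /(_ _ (leqnn _)) ->] := F_block FQ.
have [W0 _ WZ] := WS.
apply: submod_sum => // k _; apply: submod_sum => // l _.
rewrite (cf_MQ d_ge) (cf_QM d_ge); case: ifP => ld; first by rewrite scale0r.
case: ifP => kd; first by rewrite scale0r.
have [c0|c0] := eqVneq (cf x k l) 0; first by rewrite c0 scale0r.
apply: (WZ); apply: We; try by lia.
have : cf (a * x) k l = cf (x * a) k l by rewrite Cx.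
rewrite (cf_aM fd) ?kd // (cf_Ma fd) ?ld // => /eqP.
by rewrite (inj_eq (mulIf c0)) => /eqP.
Qed.

Lemma e_Cen k l : d < k%:Z -> d < l%:Z -> eigen k = eigen l -> centralizer a (e k l).
Proof. by move=> dk dl E; rewrite /centralizer /= (a_e fd) ?(e_a fd) ?E //; lia. Qed.

End BlockDecomposition.

Section BlockSums.
Context {K : fieldType} {charK : charZero K}.
Context {alpha : {poly K}} {f : I1 K} {d : int}.
Hypotheses (d_ge : -1 <= d) (fd : Fle d f).
Implicit Types (x y : I1 K).

Local Notation a := (evalH alpha + f).
Local Notation b := (a11 alpha f d).
Local Notation P := (@e_le K d).
Local Notation Q := (@e_gt K d).
Local Notation eigen j := (alpha.[j.+1%:R]).
Local Notation kerHj := (kerH b alpha d).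
Local Notation kerVi := (kerV b alpha d).
Local Notation kerH_sub := (fun j (_ : idx_gt d j) => @kerH_submod K alpha f d j).
Local Notation kerV_sub := (fun i (_ : idx_gt d i) => @kerV_submod K alpha f d i).

Lemma cf_line (l : K) i j k n : cf (l *: e i j) k n <> 0 -> k = i /\ n = j.
Proof.
rewrite cfZ cf_e; case: andP => [[/eqP -> /eqP ->] //|_].
by rewrite mulr0.
Qed.

Lemma diag_supp x k l : fam_sum (idx_gt d) diag_line x -> ~ (d < k%:Z /\ k = l) -> cf x k l = 0.
Proof.
move=> Wx; move: k l; apply: fam_sum_supp (@diag_submod _ _) _ _ Wx => j _ dj [c _ <-] k l n.
by apply: contrapT => /cf_line [kj lj]; apply: n; rewrite kj lj.
Qed.

Lemma C_space_supp x k l : C_space alpha d x -> ~ (d < l%:Z /\ (l < k)%N) -> cf x k l = 0.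
Proof.
move=> Wx; move: k l; apply: (fam_sum_supp (@C_line_submod _ _ _) _ Wx).
move=> [i j] _ /C_indexP [i1 dj _] [c _ <-] k l n.
by apply: contrapT => /cf_line /= [ki lj]; apply: n; rewrite ki lj; split=> //; lia.
Qed.

Lemma star_C_space_supp x k l : (star @` C_space alpha d) x ->
  ~ (d < k%:Z /\ (k < l)%N) -> cf x k l = 0.
Proof. by move=> [y Cy <-] n; rewrite cf_star; apply: C_space_supp Cy n. Qed.

Lemma kerH_sum_supp x k l : fam_sum (idx_gt d) kerHj x -> ~ (k%:Z <= d /\ d < l%:Z) -> cf x k l = 0.
Proof.
move=> Wx; move: k l; apply: (fam_sum_supp (R := fun k l : nat => k%:Z <= d /\ d < l%:Z) kerH_sub _ Wx) => j y dj ky k l n.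
by apply: (kerH_supp d_ge ky) => -[kd lj]; apply: n; rewrite lj.
Qed.

Lemma kerV_sum_supp x k l : fam_sum (idx_gt d) kerVi x -> ~ (l%:Z <= d /\ d < k%:Z) -> cf x k l = 0.
Proof.
move=> Wx; move: k l; apply: (fam_sum_supp (R := fun k l : nat => l%:Z <= d /\ d < k%:Z) kerV_sub _ Wx) => i y di ky k l n.
by apply: (kerV_supp d_ge ky) => -[ld ki]; apply: n; rewrite ki.
Qed.

Lemma diag_dsum : is_dsum (idx_gt d) (@diag_line K) (fam_sum (idx_gt d) diag_line).
Proof.
apply: (@fam_sum_dsum _ _ _ _ _ (fun j k l => k = j /\ l = j)) => [|j _ dj [c _ <-] k l n|].
- exact: diag_submod.
- by apply: contrapT => /cf_line.
- by move=> i i' k j _ _ [-> _] [->].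
Qed.

Lemma C_space_dsum : is_dsum (C_index alpha d) (@C_line K) (C_space alpha d).
Proof.
apply: (@fam_sum_dsum _ _ _ _ _ (fun ij k l => k = (ij.1 + ij.2)%N /\ l = ij.2)).
- exact: C_line_submod.
- by move=> ij _ _ [c _ <-] k l n; apply: contrapT => /cf_line.
- by move=> [i j] [i' j'] k l _ _ /= [-> ->] [E jj]; congr pair; lia.
Qed.

Lemma kerH_dsum : is_dsum (idx_gt d) kerHj (fam_sum (idx_gt d) kerHj).
Proof.
apply: (@fam_sum_dsum _ _ _ _ _ (fun j k l => k%:Z <= d /\ l = j)).
- exact: kerH_sub.
- by move=> j x _ kx k l; apply: (kerH_supp d_ge kx).
- by move=> i i' k l _ _ [_ ->] [].
Qed.

Lemma kerV_dsum : is_dsum (idx_gt d) kerVi (fam_sum (idx_gt d) kerVi).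
Proof.
apply: (@fam_sum_dsum _ _ _ _ _ (fun i k l => l%:Z <= d /\ k = i)).
- exact: kerV_sub.
- by move=> j x _ kx k l; apply: (kerV_supp d_ge kx).
- by move=> i i' k l _ _ [_ ->] [].
Qed.

Lemma CenFle_submod : is_submod (CenFle d b).
Proof.
have [F0 FD FZ] := Kspan_submod [set x : I1 K | exists i j : nat, [/\ i%:Z <= d, j%:Z <= d & x = e i j]].
have [C0 CD CZ] := Cen_submod b.
split=> [|x y [Fx Cx] [Fy Cy]|l x [Fx Cx]]; split=> //; [exact: FD|exact: CD|exact: FZ|exact: CZ].
Qed.

Lemma in_CenFle x : centralizer a x -> CenFle d b (P * x * P).
Proof.
move=> Cx; split; first exact: PxP_Fle.
by apply/(Fle_Cen d_ge fd (PxP_Fle d_ge x)); apply: Cen_mul (Cen_mul _ _) _ => //; apply: Cen_P.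
Qed.

Lemma CenFle_CenF x : CenFle d b x -> CenF a x.
Proof. by move=> [Fx Cx]; split; [exact: Fle_F Fx|apply/(Fle_Cen d_ge fd Fx)]. Qed.

Lemma dsum_seq_supp (s : seq (set (I1 K))) (W : set (I1 K)) (R : nat -> nat -> nat -> Prop) :
  is_submod W ->
  (forall i, (i < size s)%N -> is_submod (nth set0 s i)) ->
  (forall i, (i < size s)%N -> nth set0 s i `<=` W) ->
  (forall S, is_submod S -> (forall i, (i < size s)%N -> nth set0 s i `<=` S) -> W `<=` S) ->
  (forall i x k l, (i < size s)%N -> nth set0 s i x -> ~ R i k l -> cf x k l = 0) ->
  (forall i i' k l, (i < size s)%N -> (i' < size s)%N -> R i k l -> R i' k l -> i = i') ->
  is_dsum_seq s W.
Proof.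
move=> WS sS sW Wgen sR Rinj.
have sS' (i : 'I_(size s)) : [set: 'I_(size s)] i -> is_submod (nth set0 s i).
  by move=> _; apply: sS.
split=> //.
  apply/seteqP; split; last by apply: fam_sum_sub => // i _; apply: sW.
  apply: Wgen; first exact: fam_sum_submod.
  by move=> i lt x sx; apply: (@fam_sum_mem _ _ _ _ _ sS' (Ordinal lt)).
apply: (supp_independent (R := fun (i : 'I_(size s)) k l => R i k l)) => [i x _ sx k l|i i' k l _ _ Ri Ri'].
  by apply: sR sx.
by apply/val_inj/(Rinj i i' k l).
Qed.

(** The outer block is split into its diagonal and its two strict triangles; then
    come the finite block and the two mixed ones. *)
Definition six_supports (i k l : nat) : Prop :=
  match i with
  | 0 => d < k%:Z /\ k = l
  | 1 => d < l%:Z /\ (l < k)%N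
  | 2 => d < k%:Z /\ (k < l)%N
  | 3 => k%:Z <= d /\ l%:Z <= d
  | 4 => k%:Z <= d /\ d < l%:Z
  | _ => l%:Z <= d /\ d < k%:Z
  end.

Lemma CenF_dsum6 : is_dsum_seq
  [:: fam_sum (idx_gt d) diag_line; C_space alpha d; star @` C_space alpha d;
      CenFle d b; fam_sum (idx_gt d) kerHj; fam_sum (idx_gt d) kerVi] (CenF a).
Proof.
have CFS := CenF_submod a.
have CF_e (c : K) k l : d < k%:Z -> d < l%:Z -> eigen k = eigen l -> CenF a (c *: e k l).
  have [_ _ CZ] := CFS; move=> dk dl E; apply: CZ.
  by split; [exact: F_eij|exact: (e_Cen d_ge fd)].
apply: (@dsum_seq_supp _ _ six_supports) => //.
- move=> -[|[|[|[|[|[|//]]]]]] _ /=.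
  + exact: fam_sum_submod (@diag_submod _ _).
  + exact: C_space_submod.
  + exact: star_C_space_submod.
  + exact: CenFle_submod.
  + exact: fam_sum_submod kerH_sub.
  + exact: fam_sum_submod kerV_sub.
- move=> -[|[|[|[|[|[|//]]]]]] _ /=.
  + by apply: fam_sum_sub => // j dj _ [c _ <-]; apply: CF_e.
  + apply: fam_sum_sub => // -[i j] /C_indexP [i1 dj E] _ [c _ <-] /=.
    by apply: CF_e => //; lia.
  + move=> _ [x Cx <-]; move: x Cx.
    apply: (fam_sum_sub (W := [set x | CenF a (star x)])).
      have [C0 CD CZ] := CFS.
      split=> [|x y|c x] /=; rewrite ?star0 ?starD ?starZ //; [exact: CD|exact: CZ].
    move=> [i j] /C_indexP [i1 dj E] _ [c _ <-] /=; rewrite starZ star_e.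
    by apply: CF_e => //; lia.
  + by move=> x; apply: CenFle_CenF.
  + apply: fam_sum_sub => // j dj x kx.
    by split; [exact: kerH_F kx|exact: (kerH_Cen d_ge fd dj kx)].
  + apply: fam_sum_sub => // j dj x kx.
    by split; [exact: kerV_F kx|exact: (kerV_Cen d_ge fd dj kx)].
- move=> S SS sS x [Fx Cx]; have [_ SD _] := SS; rewrite (block_dec d_ge x).
  have /= s0 := sS 0%N isT; have /= s1 := sS 1%N isT; have /= s2 := sS 2%N isT.
  have /= s3 := sS 3%N isT; have /= s4 := sS 4%N isT; have /= s5 := sS 5%N isT.
  apply: (SD); [apply: (SD); [apply: (SD)|]|].
  + exact: s3 _ (in_CenFle Cx).
  + by pose proof (PxQ_fam_sum d_ge fd Cx); apply: s4.
  + by pose proof (QxP_fam_sum d_ge fd Cx); apply: s5.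
  + apply: (QxQ_fam_sum (W := S) d_ge fd SS Fx Cx) => k l dk dl E; have [lk|kl|kl] := ltngtP l k.
    * exact: s1 _ (in_C_space lk dl E).
    * by apply: s2; exists (e l k); [apply: in_C_space|rewrite star_e].
    * rewrite kl in dl *; apply: s0.
      by apply: (fam_sum_mem (@diag_submod _ _) dl); exists 1; rewrite ?scale1r.
- move=> -[|[|[|[|[|[|//]]]]]] x k l _ /= sx n.
  + exact: diag_supp sx n.
  + exact: C_space_supp sx n.
  + exact: star_C_space_supp sx n.
  + by case: sx => /FleP Fx _; apply: Fx.
  + exact: kerH_sum_supp sx n.
  + exact: kerV_sum_supp sx n.
- by move=> -[|[|[|[|[|[|//]]]]]] -[|[|[|[|[|[|//]]]]]] k l _ _ //= Ri Ri'; lia.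
Qed.

End BlockSums.

(** * Polynomials over the subring generated by one polynomial *)

Section PolyBasis.
Context {K : fieldType} {alpha : {poly K}} {rho : nat}.
Hypotheses (rho_gt0 : (0 < rho)%N) (size_alpha : size alpha = rho.+1).

Lemma alpha_neq0 : alpha != 0. Proof. by rewrite -size_poly_eq0 size_alpha. Qed.

(** Repeated Euclidean division by [alpha]: the digits of [h] in base [alpha]. *)
Lemma comp_span (h : {poly K}) :
  exists q : 'I_rho -> {poly K}, h = \sum_r (q r \Po alpha) * 'X^r.
Proof.
elim: {h}(size h) {-2}h (leqnn (size h)) => [|n IH] h le.
  exists (fun=> 0); rewrite big1 => [|r _]; last by rewrite comp_poly0 mul0r.
  by apply/eqP; rewrite -size_poly_eq0 -leqn0.
have [|q qE] := IH (h %/ alpha).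
  rewrite size_divp ?alpha_neq0 // size_alpha leq_subLR; apply: leq_trans le _.
  by rewrite -add1n leq_add2r.
exists (fun r => q r * 'X + ((h %% alpha)`_r)%:P).
under eq_bigr do rewrite comp_polyD comp_polyM comp_polyX comp_polyC mulrDl mulrAC.
rewrite big_split /= -mulr_suml -qE {1}(divp_eq h alpha); congr (_ + _).
have lt : (size (h %% alpha)%R <= rho)%N by rewrite -ltnS -size_alpha ltn_modp alpha_neq0.
rewrite -[LHS](take_poly_id lt) /take_poly poly_def.
by apply: eq_bigr => r _; rewrite mul_polyC.
Qed.

(** The uniqueness of Euclidean division by [alpha] gives the vanishing of the
    constant terms of the [p r], and then of the other terms by induction. *)
Lemma comp_free (p : 'I_rho -> {poly K}) :
  \sum_r (p r \Po alpha) * 'X^r = 0 -> forall r, p r = 0.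
Proof.
have : forall r, (size (p r) <= \max_r size (p r))%N by move=> r; apply: leq_bigmax.
move: (\max_r size (p r))%N => n; elim: n p => [|n IH] p le p0 r.
  by apply/eqP; rewrite -size_poly_eq0 -leqn0.
have /choice [qc qcP] r' : exists qc : {poly K} * K, p r' = qc.1 * 'X + qc.2%:P.
  by elim/poly_ind: (p r') => [|q c _]; [exists (0, 0)|exists (q, c)]; rewrite ?mul0r ?addr0.
pose S := \sum_r ((qc r).1 \Po alpha) * 'X^r.
pose R := \sum_(r < rho) (qc r).2 *: 'X^r.
have E : S * alpha + R = 0.
  rewrite -p0 /S /R mulr_suml -big_split /=; apply: eq_bigr => r' _.
  by rewrite qcP comp_polyD comp_polyM comp_polyX comp_polyC mulrDl mulrAC mul_polyC.
have sR : (size R <= rho)%N.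
  apply: leq_trans (size_sum _ _ _) _; apply/bigmax_leqP => i _.
  by apply: leq_trans (size_scale_leq _ _) _; rewrite size_polyXn.
have S0 : S = 0.
  apply: contrapT => /eqP S0; have : R = - (S * alpha) by apply/eqP; rewrite -addr_eq0 addrC E.
  move=> RE; move: sR; rewrite RE size_polyN size_mul ?alpha_neq0 // size_alpha addnS /=.
  by rewrite -[X in (_ <= X)%N]add0n leq_add2r leqn0 size_poly_eq0 (negPf S0).
have R0 : R = 0 by rewrite -E S0 mul0r add0r.
have c0 r' : (qc r').2 = 0.
  have := congr1 (fun q : {poly K} => q`_r') R0; rewrite coef0 coef_sum (bigD1 r') //=.
  rewrite coefZ coefXn eqxx mulr1 big1 ?addr0 // => i ne.
  rewrite coefZ coefXn (_ : (r' == i :> nat) = false) ?mulr0 //.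
  by apply: contraNF ne => /eqP e; apply/eqP/val_inj.
have q0 r' : (qc r').1 = 0.
  apply: (IH (fun r => (qc r).1)) => // i; move: (le i); rewrite qcP size_MXaddC.
  by case: eqP => [->|] //=; rewrite size_poly0.
by rewrite qcP q0 c0 mul0r addr0.
Qed.

End PolyBasis.

(** * The case of degree zero *)

Section Idempotents.
Context {K : fieldType} {A : algType K} {eps : nat -> A}.
Hypotheses (eps_neq0 : forall n, eps n <> 0)
  (epsM : forall n k, eps n * eps k = if n == k then eps n else 0).

Lemma idempotent_left_dsum : has_infinite_dsum (@left_ideal K A).
Proof.
exists (fun n => [set x | x = x * eps n]); split=> [n|n|].
- split=> [|x y xe ye|r x xe] /=; first by rewrite mul0r.
    by rewrite mulrDl -xe -ye.
  by rewrite -mulrA -xe.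
- move=> U0; apply: (@eps_neq0 n).
  have : [set x | x = x * eps n] (eps n) by rewrite /= epsM eqxx.
  by rewrite U0.
- move=> w Uw fw w0 n _; have : (\sum_(i \in [set: nat]) w i) * eps n = 0 by rewrite w0 mul0r.
  rewrite (fsum_morph (phi := *%R^~ (eps n))) ?mul0r //; last by move=> x y; rewrite mulrDl.
  rewrite (@fsum1 _ _ _ _ n) // => [|i _ /eqP /negPf ne]; first by rewrite -(Uw n).
  by rewrite (Uw i) // -mulrA epsM ne mulr0.
Qed.

Lemma idempotent_right_dsum : has_infinite_dsum (@right_ideal K A).
Proof.
exists (fun n => [set x | x = eps n * x]); split=> [n|n|].
- split=> [|x y xe ye|r x xe] /=; first by rewrite mulr0.
    by rewrite mulrDr -xe -ye.
  by rewrite mulrA -xe.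
- move=> U0; apply: (@eps_neq0 n).
  have : [set x | x = eps n * x] (eps n) by rewrite /= epsM eqxx.
  by rewrite U0.
- move=> w Uw fw w0 n _; have : eps n * (\sum_(i \in [set: nat]) w i) = 0 by rewrite w0 mulr0.
  rewrite (fsum_morph (phi := *%R (eps n))) ?mulr0 //; last by move=> x y; rewrite mulrDr.
  rewrite (@fsum1 _ _ _ _ n) // => [|i _ ne]; first by rewrite -(Uw n).
  have /negPf ne' : n != i by apply/eqP => ni; apply: ne.
  by rewrite (Uw i) // mulrA epsM ne' mul0r.
Qed.

(** The ideal of the elements killed by almost all the idempotents is not
    finitely generated. *)
Lemma idempotent_not_left_noetherian : ~ left_noetherian A.
Proof.
move=> noeth; pose I := [set x : A | exists N, forall n, (N <= n)%N -> x * eps n = 0].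
have [|s sE] := noeth I.
  split=> [|x y [N NP] [M MP]|r x [N NP]]; first by exists 0%N => n _; rewrite mul0r.
    by exists (maxn N M) => n le; rewrite mulrDl NP ?MP ?addr0 //; lia.
  by exists N => n /NP; rewrite -mulrA => ->; rewrite mulr0.
have [N NP] : exists N, forall x, x \in s -> forall n, (N <= n)%N -> x * eps n = 0.
  have : forall x, x \in s -> I x by move=> x xs; rewrite sE => J [_]; apply.
  elim: s {sE} => [|x s IH] sI; first by exists 0%N.
  have [|N NP] := IH; first by move=> y ys; apply: sI; rewrite inE ys orbT.
  have [M MP] := sI x (mem_head _ _); exists (maxn N M) => y.
  rewrite inE => /orP [/eqP ->|ys] n; rewrite geq_max => /andP [leN leM]; first exact: MP.
  exact: NP.
have : I (eps N).
  exists N.+1 => n lt; rewrite epsM (_ : N == n = false) //; lia.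
rewrite sE => /(_ [set x | x * eps N = 0]) epsN; apply: (@eps_neq0 N).
suff : eps N * eps N = 0 by rewrite epsM eqxx.
apply: epsN; split=> [|x xs]; last exact: NP.
split=> [|x y x0 y0|r x x0] /=; first by rewrite mul0r.
  by rewrite mulrDl x0 y0 addr0.
by rewrite -mulrA x0 mulr0.
Qed.

Lemma idempotent_not_right_noetherian : ~ right_noetherian A.
Proof.
move=> noeth; pose I := [set x : A | exists N, forall n, (N <= n)%N -> eps n * x = 0].
have [|s sE] := noeth I.
  split=> [|x y [N NP] [M MP]|r x [N NP]]; first by exists 0%N => n _; rewrite mulr0.
    by exists (maxn N M) => n le; rewrite mulrDr NP ?MP ?addr0 //; lia.
  by exists N => n /NP; rewrite mulrA => ->; rewrite mul0r.
have [N NP] : exists N, forall x, x \in s -> forall n, (N <= n)%N -> eps n * x = 0.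
  have : forall x, x \in s -> I x by move=> x xs; rewrite sE => J [_]; apply.
  elim: s {sE} => [|x s IH] sI; first by exists 0%N.
  have [|N NP] := IH; first by move=> y ys; apply: sI; rewrite inE ys orbT.
  have [M MP] := sI x (mem_head _ _); exists (maxn N M) => y.
  rewrite inE => /orP [/eqP ->|ys] n; rewrite geq_max => /andP [leN leM]; first exact: MP.
  exact: NP.
have : I (eps N).
  exists N.+1 => n lt; rewrite epsM (_ : n == N = false) //; lia.
rewrite sE => /(_ [set x | eps N * x = 0]) epsN; apply: (@eps_neq0 N).
suff : eps N * eps N = 0 by rewrite epsM eqxx.
apply: epsN; split=> [|x xs]; last exact: NP.
split=> [|x y x0 y0|r x x0] /=; first by rewrite mulr0.
  by rewrite mulrDr x0 y0 addr0.
by rewrite mulrA x0 mul0r.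
Qed.

End Idempotents.

Section FDegree.
Context {K : fieldType} {charK : charZero K}.
Implicit Types (x y a f : I1 K) (p : {poly K}).

Lemma evalH_F p : F (evalH p : I1 K) -> p = 0.
Proof. by move=> /(F_symbol (has_symbol_evalH p)) /(_ 0). Qed.

Lemma cf_Fpart a k j : cf (Fpart a) k j = (nf a).2 (k, j).
Proof.
have [_ fl _] : normal_form a (nf a) by apply: nfP.
have nF : normal_form (Fpart a) (fun=> 0, (nf a).2).
  split=> //=; first by apply: (sub_finite_set _ (@finite_set0 int)) => i /=.
  rewrite [X in X + _]fsbig1 ?add0r // => i _.
  by rewrite /evalH rmorph0 mul0r.
by rewrite (normal_form_cf nF) /= horner0 add0r.
Qed.

Lemma Fpart_eq alpha f : F f -> Fpart (evalH alpha + f) = f.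
Proof.
move=> Ff; have nfE : nf (evalH alpha + f) =
    (fun i => if i == 0 then alpha else 0, fun kj => cf f kj.1 kj.2).
  apply: nf_uniq; apply: normal_formE => /= [||k j].
  - apply: (sub_finite_set _ (finite_set1 (0 : int))) => i /=.
    by case: eqP => // ->.
  - have /FP [N NP] := Ff; apply/finite_nat2P; exists N => i j /= ne.
    suff : ~~ ((N <= i)%N || (N <= j)%N) by lia.
    by apply/negP => /NP.
  - rewrite cfD cf_evalH (_ : (k%:Z - j%:Z == 0) = (k == j)); last by lia.
    by case: eqP => _; rewrite ?mulr1 // horner0 mulr0.
by apply: cf_inj => k j; rewrite cf_Fpart nfE.
Qed.

Lemma degFP alpha f : F f -> -1 <= degF (evalH alpha + f) /\ Fle (degF (evalH alpha + f)) f.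
Proof.
move=> Ff; rewrite /degF Fpart_eq //; case: eqP => [->|_].
  by split=> //; have [] := Kspan_submod [set x : I1 K | exists i j : nat,
    [/\ i%:Z <= -1, j%:Z <= -1 & x = e i j]].
split=> //; have /FP [N NP] := Ff.
pose p n := `[< Fle n%:Z f >].
have exP : exists n, p n.
  by exists N; apply/asboolP/FleP => k j n; apply: NP; lia.
have [] : [set n : nat | Fle n f /\ forall k : nat, Fle k f -> (n <= k)%N]
    (xget 0%N [set n : nat | Fle n f /\ forall k : nat, Fle k f -> (n <= k)%N]).
  apply: xgetPex; case: (ex_minnP exP) => m /asboolP mP mmin; exists m; split=> // k kP.
  by apply: mmin; apply/asboolP.
by [].
Qed.

Lemma evalH_comm p q : evalH p * evalH q = evalH q * evalH p :> I1 K.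
Proof. by rewrite /evalH -!rmorphM mulrC. Qed.

(** The values at the multiples of the period coincide. *)
Lemma periodic_const p (i : int) : i != 0 ->
  p \Po ('X + i%:~R%:P) = p -> (size p <= 1)%N.
Proof.
wlog i_gt0 : i / 0 < i => [W i0 pi|].
  have [lt|lt|i0'] := ltgtP i 0; last by rewrite i0' eqxx in i0.
    apply: (W (- i)); rewrite ?oppr_gt0 ?oppr_eq0 //.
    rewrite -{1}pi -comp_polyA comp_polyD comp_polyX comp_polyC -addrA -polyCD -intrD.
    by rewrite addNr addr0 comp_polyXr.
  exact: W lt i0 pi.
case: i i_gt0 => // m m_gt0 _ pm.
have pE k : p.[(k * m)%:R] = p.[0].
  elim: k => [|k IH]; first by rewrite mul0n.
  by rewrite -IH -{2}pm horner_comp hornerD hornerX hornerC -natrD mulSn addnC.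
have : (p - p.[0]%:P) \Po (m%:R *: 'X) = 0.
  apply: (@poly_nat_eq0 _ _ _ 0) => k _.
  by rewrite horner_comp hornerZ hornerX hornerD hornerN hornerC -natrM mulnC pE subrr.
move=> /eqP; rewrite comp_poly_eq0; last first.
  by rewrite size_scale ?size_polyX // natf_eq0 -lt0n; lia.
by rewrite subr_eq0 => /eqP ->; rewrite size_polyC_leq1.
Qed.

End FDegree.

Section ZeroDegree.
Context {K : fieldType} {charK : charZero K}.
Context {alpha : {poly K}} {f : I1 K} {d : int}.
Hypotheses (d_ge : -1 <= d) (fd : Fle d f) (alpha_nc : (1 < size alpha)%N).
Implicit Types (x y : I1 K).

Local Notation a := (evalH alpha + f).
Local Notation P := (@e_le K d).
Local Notation Q := (@e_gt K d).
Local Notation rho := (size alpha).-1.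

Lemma f_F : F f. Proof. exact: Fle_F fd. Qed.

Lemma FD_iff x y : F (x - y) -> (F x <-> F y).
Proof.
move=> Fxy; split=> [Fx|Fy]; last by rewrite -(subrK y x); apply: FD.
by pose proof (FB Fx Fxy) as Fy; rewrite opprB addrC subrK in Fy.
Qed.

Lemma F_subM x x' y y' : F (x - x') -> F (y - y') -> F (x * y - x' * y').
Proof.
move=> Fx Fy; rewrite -(subrK (x' * y) (x * y)) -mulrBl -addrA -mulrBr.
by apply: FD; [apply: FMr|apply: FM].
Qed.

Lemma Q_F1 : F (Q - 1).
Proof. by rewrite /e_gt addrAC subrr add0r; apply: FN; apply: P_F. Qed.

Lemma Q_sub x : F (Q * x - x).
Proof. by rewrite -{2}[x]mul1r -mulrBl; apply: FMr; apply: Q_F1. Qed.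

Lemma horner_sub_F p : F (horner_alg a p - evalH (p \Po alpha)).
Proof.
elim/poly_ind: p => [|p c IH]; first by rewrite comp_poly0 /evalH !rmorph0 subrr; apply: F0.
rewrite comp_polyD comp_polyM comp_polyX comp_polyC /evalH !rmorphD !rmorphM /= horner_algX !horner_algC.
rewrite opprD addrACA subrr addr0; apply: F_subM => //.
by rewrite addrAC subrr add0r; apply: f_F.
Qed.

Lemma cf_Q_evalH p k j : cf (Q * evalH p) k j = if k%:Z <= d then 0 else p.[k.+1%:R] * (k == j)%:R.
Proof. by rewrite (cf_QM d_ge) cf_evalH. Qed.

Lemma Q_evalH_Cen p : centralizer a (Q * evalH p).
Proof.
apply: cf_inj => k j.
have [kd|kd] := boolP (k%:Z <= d); last first.
  rewrite (cf_aM fd); last exact/negP.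
  rewrite cf_Q_evalH (negPf kd).
  rewrite (@cfM1 _ _ _ _ _ _ k) => [|l /negPf ne].
    rewrite cf_Q_evalH (negPf kd) eqxx mulr1 cf_a (cf_f0 fd) ?addr0 1?mulrCA //.
    by case=> kd'; rewrite kd' in kd.
  by rewrite cf_Q_evalH (negPf kd) eq_sym ne mulr0 mul0r.
rewrite cf_neq0M => [|l]; last first.
  rewrite cf_Q_evalH; case: ifP => [_|/negP ld]; first by rewrite mulr0.
  rewrite cf_a (cf_f0 fd) ?addr0; last by case.
  by rewrite (_ : (k == l) = false) ?mulr0 ?mul0r //; apply/eqP => kl; apply: ld; rewrite -kl.
by rewrite cf_neq0M // => l; rewrite cf_Q_evalH kd mul0r.
Qed.

(** In the symbol of an element commuting with [a], the coefficient [c] of [v i]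
    satisfies [(alpha (H) - alpha (H - i)) c = 0]; it vanishes for [i <> 0]
    because [alpha] is not constant. *)
Lemma Cen_mod_F x : centralizer a x -> exists h, F (x - evalH h).
Proof.
move=> Cx; have [c xc] := has_symbol_ex x; exists (c 0).
have xc' : has_symbol (-1 *: evalH (c 0) + x)
    (fun i => -1 *: (if i == 0 then c 0 else 0) + c i).
  by apply: has_symbolZD => //; apply: has_symbol_evalH.
have -> : x - evalH (c 0) = -1 *: evalH (c 0) + x by rewrite scaleN1r addrC.
apply: (F_symbol xc').2 => i; have [->|i0] := eqVneq i 0; first by rewrite scaleN1r addNr.
rewrite scaler0 add0r; apply/eqP; apply: contraT => ci0.
suff : (size alpha <= 1)%N by rewrite leqNgt alpha_nc.
apply: (@periodic_const _ _ _ (- i)); rewrite ?oppr_eq0 //.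
have [B [c0 cE]] := xc.
suff : (alpha - (alpha \Po ('X + (- i)%:~R%:P))) * c i = 0.
  by move=> /eqP; rewrite mulf_eq0 (negPf ci0) orbF subr_eq0 => /eqP.
apply: (@poly_nat_eq0 _ _ _ (B + absz i + absz d + 1).+1) => -[//|k] le.
pose j := absz (k%:Z - i); have jE : k%:Z - j%:Z = i by lia.
have : cf (a * x) k j = cf (x * a) k j by rewrite Cx.
rewrite (cf_aM fd); last by lia.
rewrite (cf_Ma fd); last by lia.
rewrite cE; last by lia.
rewrite jE => E; rewrite hornerM hornerD hornerN horner_comp hornerD hornerX hornerC.
rewrite -(@natr_addz _ j.+1 k.+1 (- i)); last by lia.
by rewrite mulrBl E subrr.
Qed.

(** Modulo F, the centralizer is [K[H]] and [a] is [alpha]; multiplying by [Q]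
    turns [H ^+ r] into an element of the centralizer. *)
Lemma Fbasis_zero_degree :
  Fbasis a (centralizer a) (fun r : 'I_rho => Q * evalH 'X^r).
Proof.
have rho0 : (0 < rho)%N by lia.
have sa : size alpha = rho.+1 by rewrite prednK //; lia.
have sumF (q : 'I_rho -> {poly K}) :
    F (\sum_r horner_alg a (q r) * (Q * evalH 'X^r) - evalH (\sum_r (q r \Po alpha) * 'X^r)).
  rewrite /evalH rmorph_sum -sumrB; apply: F_sum => r _; rewrite rmorphM.
  by apply: F_subM; [apply: horner_sub_F|apply: Q_sub].
split=> [r|x /Cen_mod_F [h Fh]|p Fp].
- exact: Q_evalH_Cen.
- have [q hE] := comp_span rho0 sa h; exists q.
  have -> : x - \sum_r horner_alg a (q r) * (Q * evalH 'X^r) = (x - evalH h) -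
     (\sum_r horner_alg a (q r) * (Q * evalH 'X^r) - evalH (\sum_r (q r \Po alpha) * 'X^r)).
    by rewrite -hE opprB addrA subrK.
  exact: FB.
- apply: (comp_free sa); apply: evalH_F.
  exact: (FD_iff (sumF p)).1.
Qed.

End ZeroDegree.

Section InfiniteDiagonal.
Context {K : fieldType} {charK : charZero K}.
Context {alpha : {poly K}} {f : I1 K} {d : int}.
Hypotheses (d_ge : -1 <= d) (fd : Fle d f).
Implicit Types (x y : I1 K).

Local Notation a := (evalH alpha + f).

Lemma diag_Cen (n : nat) : centralizer a (e (absz (d + 1) + n) (absz (d + 1) + n)).
Proof. by apply: (e_Cen d_ge fd) => //; lia. Qed.

Definition diag_idem n : CenA a := SubalgElt (in_CenA (diag_Cen n)).

Lemma e_neq0 i j : e i j <> 0 :> I1 K.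
Proof. by move=> /(congr1 (fun x => cf x i j)); rewrite cf_e cf0 !eqxx => /eqP; rewrite oner_eq0. Qed.

Lemma diag_idem_neq0 n : diag_idem n <> 0.
Proof. by move=> /(congr1 (fun z : CenA a => val z : I1 K)) /= /e_neq0. Qed.

Lemma diag_idemM n k : diag_idem n * diag_idem k = if n == k then diag_idem n else 0.
Proof.
apply: val_inj; transitivity (e (absz (d + 1) + n) (absz (d + 1) + n) *
  e (absz (d + 1) + k) (absz (d + 1) + k) : I1 K); first by [].
rewrite eM eqn_add2l; case: eqP => [->|_]; first by rewrite scale1r.
by rewrite scale0r.
Qed.

Lemma diag_chain :
  [/\ has_infinite_dsum (@left_ideal K (CenA a)), has_infinite_dsum (@right_ideal K (CenA a)),
      ~ left_noetherian (CenA a) & ~ right_noetherian (CenA a)].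
Proof.
split; [apply: idempotent_left_dsum|apply: idempotent_right_dsum|
        apply: idempotent_not_left_noetherian|apply: idempotent_not_right_noetherian];
  by [apply: diag_idem_neq0|apply: diag_idemM].
Qed.

Lemma CenF_infinite : ~ finite_dim (CenF a).
Proof.
move=> [s sE].
have [N NP] : exists N, forall x, x \in s -> forall k j, (N <= k)%N || (N <= j)%N -> cf x k j = 0.
  have : forall x, x \in s -> F x.
    by move=> x xs; have : CenF a x by [rewrite sE; apply: gen_in_span]; case.
  elim: s {sE} => [|x s IH] sF; first by exists 0%N.
  have [|N NP] := IH; first by move=> y ys; apply: sF; rewrite inE ys orbT.
  have /FP [M MP] := sF x (mem_head _ _); exists (maxn N M) => y.
  by rewrite inE => /orP [/eqP ->|ys] k j le; [apply: MP|apply: (NP _ ys)]; lia.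
pose n := (absz (d + 1)%R + N)%N.
have : CenF a (e n n) by split; [apply: F_eij|apply: diag_Cen].
rewrite sE => /(span_least (supp_submod (fun k j => (N <= k)%N || (N <= j)%N))) h.
have /eqP : cf (e n n : I1 K) n n = 0 by apply: h => [x xs k j|]; [exact: NP|lia].
by rewrite cf_e !eqxx oner_eq0.
Qed.

Lemma infinite_diag : infinite_set [set j | idx_gt d j /\ @diag_line K j <> [set 0]].
Proof.
move=> /finite_seqP [s sE].
pose n := (absz (d + 1)%R + \max_(j <- s) j)%N.+1.
have : [set` s] n.
  rewrite -sE; split; first by rewrite /idx_gt /=; lia.
  move=> n0; have : diag_line n (e n n : I1 K) by exists 1; rewrite ?scale1r.
  by rewrite n0 => /e_neq0.
move=> /= sn; have : (n <= \max_(j <- s) j)%N by apply: (@leq_bigmax_seq _ s xpredT id _ sn).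
by rewrite leqNgt /n ltnS leq_addl.
Qed.

End InfiniteDiagonal.

Section TwoSummands.
Context {K : fieldType}.
Implicit Types (A B W : set (I1 K)).

Lemma dsum_pair A B W : is_submod A -> is_submod B -> is_submod W ->
  A `<=` W -> B `<=` W ->
  (forall x, W x -> exists2 y, A y & B (x - y)) ->
  (forall x, A x -> B x -> x = 0) -> is_dsum_seq [:: A; B] W.
Proof.
move=> AS BS WS AW BW Wdec AB0.
set s := [:: A; B].
have sS (i : 'I_(size s)) : [set: 'I_(size s)] i -> is_submod (nth set0 s i).
  by case: i => -[|[|//]] lt _.
pose i0 : 'I_(size s) := ord0; pose i1 : 'I_(size s) := ord_max.
have us : uniq [:: i0; i1] by [].
have fsum2 (w : 'I_(size s) -> I1 K) : \sum_(i \in [set: 'I_(size s)]) w i = w i0 + w i1.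
  rewrite (fsum_seq us) //; first by rewrite big_cons big_seq1.
  by case=> -[|[|//]] lt _; rewrite !inE -!val_eqE.
split=> //.
- apply/seteqP; split; last by apply: fam_sum_sub => // i _; case: i => -[|[|//]] lt.
  move=> x /Wdec [y Ay Bxy]; exists (fun i => if i == i0 then y else x - y); split.
  + by case=> -[|[|//]] lt _ /=.
  + exact: finite_finset.
  + by rewrite fsum2 /= subrKC.
- move=> w Uw _; rewrite fsum2 => /eqP; rewrite addr_eq0 => /eqP w01.
  have A0 : A (w i0) by apply: (Uw i0).
  have B1 : B (w i1) by apply: (Uw i1).
  have w0 : w i0 = 0 by apply: AB0 => //; rewrite w01; apply: submodN.
  have w1 : w i1 = 0 by move: w01; rewrite w0 => /esym/eqP; rewrite oppr_eq0 => /eqP.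
  by case=> -[|[|//]] lt _; [rewrite -[RHS]w0|rewrite -[RHS]w1]; congr w; apply: val_inj.
Qed.

End TwoSummands.

Section ZeroDegreeTheorem.
Context {K : fieldType} {charK : charZero K}.
Context {alpha : {poly K}} {f : I1 K} {d : int}.
Hypotheses (d_ge : -1 <= d) (fd : Fle d f) (alpha_nc : (1 < size alpha)%N).
Implicit Types (x y : I1 K).

Local Notation a := (evalH alpha + f).
Local Notation Q := (@e_gt K d).
Local Notation P := (@e_le K d).

(** A finite set of elements of the centralizer is diagonal, with polynomial
    diagonal entries, outside of a common finite block; hence so is the
    subalgebra that it generates, which omits some [e_jj]. *)
Lemma zero_degree_not_fg_algebra : ~ fg_algebra (CenA a).
Proof.
move=> /fg_algebra_subalg [s [sC sW]].
pose W N := [set x : I1 K | exists h : {poly K}, forall k j, (N <= k)%N || (N <= j)%N ->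
  cf x k j = h.[k.+1%:R] * (k == j)%:R].
have [N NP] : exists N, forall x, x \in s -> W N x.
  elim: s sC {sW} => [|x s IH] sC; first by exists 0%N.
  have [|N NP] := IH; first by move=> y ys; apply: sC; rewrite inE ys orbT.
  have [h /FP [M MP]] := Cen_mod_F d_ge fd alpha_nc (sC x (mem_head _ _)).
  exists (maxn N M) => y; rewrite inE => /orP [/eqP ->|/NP [g gP]]; last first.
    by exists g => k j le; apply: gP; lia.
  exists h => k j le; apply/eqP; rewrite -subr_eq0 -cf_evalH -cfB MP //; lia.
pose n := (absz (d + 1)%R + N)%N.
have ann : centralizer a (e n n) by apply: (diag_Cen d_ge fd N).
have : W N (e n n).
  move: ann; apply: (sW (W N)) => //.
  split; first split.
  - by exists 0 => k j _; rewrite cf0 horner0 mul0r.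
  - move=> x y [h hP] [g gP]; exists (h + g) => k j le.
    by rewrite cfD hP ?gP // hornerD mulrDl.
  - by move=> l x [h hP]; exists (l *: h) => k j le; rewrite cfZ hP // hornerZ mulrA.
  - by exists 1 => k j le; rewrite cf1 hornerC mul1r.
  - move=> x y [h hP] [g gP]; exists (h * g) => k j le.
    have [leN|ltN] := leqP N k.
      rewrite (@cfM1 _ _ _ _ _ _ k) => [|l /negPf ne].
        by rewrite hP ?leN // gP ?leN // eqxx mulr1 hornerM mulrA.
      by rewrite hP ?leN // eq_sym ne mulr0 mul0r.
    have leN : (N <= j)%N by lia.
    rewrite (_ : (k == j) = false) ?mulr0; last by lia.
    rewrite cf_neq0M // => l; have [ltl|lel] := ltnP l N.
      by rewrite gP ?leN ?orbT // (_ : (l == j) = false) ?mulr0 //; lia.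
    by rewrite hP ?lel ?orbT // (_ : (k == l) = false) ?mulr0 ?mul0r //; lia.
move=> [h hP]; have h0 : h = 0.
  apply: (@poly_nat_eq0 _ _ _ n.+2) => -[//|k] lt.
  have := hP k k; rewrite cf_e eqxx mulr1 (_ : (k == n) = false) /=; last by lia.
  by move=> <- //; lia.
have := hP n n; rewrite h0 horner0 mul0r cf_e !eqxx => /(_ ltac:(lia)) /eqP.
by rewrite oner_eq0.
Qed.

Lemma zero_degree_not_fg_module : ~ fg_module (CenM a).
Proof. by move=> /fg_module_generates [s /generates_fg_algebra /zero_degree_not_fg_algebra]. Qed.

Lemma zero_degree_comm x y : centralizer a x -> centralizer a y -> F (x * y - y * x).
Proof.
move=> /(Cen_mod_F d_ge fd alpha_nc) [h Fh] /(Cen_mod_F d_ge fd alpha_nc) [g Fg].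
pose proof (FB (F_subM Fh Fg) (F_subM Fg Fh)) as E.
by rewrite opprB (evalH_comm g) addrA subrK in E.
Qed.

Lemma star_C_space_stable : a_stable a (star @` C_space alpha d).
Proof.
move=> _ [x Cx <-]; move: x Cx.
apply: (fam_sum_sub (W := [set x | (star @` C_space alpha d) (a * star x)])).
  have [S0 SD SZ] := @star_C_space_submod K charK alpha d.
  split=> [|x y Sx Sy|l x Sx] /=; first by rewrite star0 mulr0.
    by rewrite starD mulrDr; apply: SD.
  by rewrite starZ -scalerAr; apply: SZ.
move=> [i j] Cij _ [c _ <-] /=; have /C_indexP [_ dj _] := Cij.
rewrite starZ star_e -scalerAr (a_e fd); last by lia.
exists (c *: (alpha.[j.+1%:R] *: e (i + j) j)); last by rewrite !starZ star_e.
apply: (fam_sum_mem (@C_line_submod _ _ _) Cij).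
by exists (c * alpha.[j.+1%:R]); rewrite ?scalerA.
Qed.

Lemma CenFle_stable : a_stable a (CenFle d (a11 alpha f d)).
Proof.
move=> x [xd Cx]; have ax : centralizer a x by apply/(Fle_Cen d_ge fd xd).
have axd : Fle d (a * x).
  have PxE : P * x = x := P_Fle d_ge xd; have xPE : x * P = x := Fle_P d_ge xd.
  have -> : a * x = P * (a * x) * P by rewrite mulrA -(aP d_ge fd) -!mulrA xPE PxE.
  exact: PxP_Fle.
split=> //; apply/(Fle_Cen d_ge fd axd); apply: Cen_mul => //; exact: Cen_self.
Qed.

Lemma zero_degree_dsum : is_dsum_seq [:: [set Q * h | h in KH]; CenF a] (Cen a).
Proof.
apply: dsum_pair; rewrite ?/Cen.
- apply: image_submod => [|l x y]; first by case: (@smallest_subalgP K (I1 K) [set opH]).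
  by rewrite mulrDr scalerAr.
- exact: CenF_submod.
- exact: Cen_submod.
- by move=> _ [_ /KHP [p ->] <-]; apply: Q_evalH_Cen.
- by move=> x [].
- move=> x Cx; have [h Fh] := Cen_mod_F d_ge fd alpha_nc Cx.
  exists (Q * evalH h); first by exists (evalH h) => //; apply/KHP; exists h.
  split; last by apply: CenB => //; apply: Q_evalH_Cen.
  rewrite -[x](subrK (evalH h)) -addrA; apply: FD => //.
  by rewrite -opprB; apply: FN; apply: Q_sub.
- move=> _ [_ /KHP [p ->] <-] [FQ _].
  pose proof ((FD_iff (Q_sub (evalH p))).1 FQ) as Fp; rewrite (evalH_F Fp).
  by rewrite /evalH rmorph0 mulr0.
Qed.

End ZeroDegreeTheorem.

Section PartTwo.
Context {K : fieldType} {charK : charZero K}.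

Theorem zero_degree_Cen (a : I1 K) : [set x + y | x in KH & y in F] a ->
      ~ [set x + y | x in KI1 & y in F] a ->
    forall (alpha : {poly K}) (f : I1 K), F f -> a = evalH alpha + f ->
    forall d : int, d = degF a -> forall rho : nat, rho = (size alpha).-1 ->
      (~ fg_module (CenM a) /\ has_rank (CenM a) rho) /\
      (~ fg_algebra (CenA a) /\ ~ left_noetherian (CenA a) /\
       ~ right_noetherian (CenA a) /\
       has_infinite_dsum (@left_ideal K (CenA a)) /\
       has_infinite_dsum (@right_ideal K (CenA a))) /\
      mod_iso (CenM a) ({ffun 'I_rho -> KalgM a} * CenFM charK a)%type /\
      (is_dsum_seq [:: [set e_gt d * h | h in KH]; CenF a] (Cen a) /\
       @is_dsum_seq {poly K} (tmod a)
         [:: fam_sum (idx_gt d) diag_line;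
             C_space alpha d;
             star @` C_space alpha d;
             CenFle d (a11 alpha f d);
             fam_sum (idx_gt d) (kerH (a11 alpha f d) alpha d);
             fam_sum (idx_gt d) (kerV (a11 alpha f d) alpha d)]
         (CenF a) /\
       @is_dsum {poly K} (tmod a) nat (idx_gt d) diag_line
         (fam_sum (idx_gt d) diag_line) /\
       infinite_set [set j | idx_gt d j /\ @diag_line K j <> [set 0]] /\
       @is_dsum {poly K} (tmod a) (nat * nat)%type (C_index alpha d) C_line
         (C_space alpha d) /\
       @is_dsum {poly K} (tmod a) nat (idx_gt d) (kerH (a11 alpha f d) alpha d)
         (fam_sum (idx_gt d) (kerH (a11 alpha f d) alpha d)) /\
       @is_dsum {poly K} (tmod a) nat (idx_gt d) (kerV (a11 alpha f d) alpha d)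
         (fam_sum (idx_gt d) (kerV (a11 alpha f d) alpha d))) /\
      (commutator_space (Cen a) `<=` CenF a /\ ~ finite_dim (CenF a) /\
       CenF a = torsion (Cen_mod a)).
Proof.
move=> _ nKF alpha f Ff aE d dE rho rhoE; subst a; subst rho.
have [d_ge fd] : -1 <= d /\ Fle d f by rewrite dE; apply: degFP.
have alpha_nc : (1 < size alpha)%N.
  rewrite ltnNge; apply/negP => /size1_polyC alphaC; apply: nKF.
  by exists (evalH alpha); [exists alpha`_0; rewrite -?evalHC -?alphaC|exists f].
pose proof (Fbasis_zero_degree d_ge fd alpha_nc) as cP.
have [dl dr nl nr] := diag_chain (alpha := alpha) d_ge fd.
pose proof (kerH_dsum (alpha := alpha) (f := f) d_ge) as kHd.
pose proof (kerV_dsum (alpha := alpha) (f := f) d_ge) as kVd.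
have diag_st (j : nat) : idx_gt d j -> a_stable (evalH alpha + f) (@diag_line K j).
  by move=> dj; apply: (@line_stable _ _ alpha.[j.+1%:R]); apply: (a_e fd); rewrite /idx_gt /= in dj; lia.
have C_st ij : C_index alpha d ij -> a_stable (evalH alpha + f) (@C_line K ij).
  case: ij => i j [_ /= dj _]; apply: (@line_stable _ _ alpha.[(i + j).+1%:R]).
  by apply: (a_e fd) => /=; lia.
have kH_st (j : nat) : idx_gt d j -> a_stable (evalH alpha + f) (kerH (a11 alpha f d) alpha d j).
  by move=> _; apply: kerH_stable.
have kV_st (j : nat) : idx_gt d j -> a_stable (evalH alpha + f) (kerV (a11 alpha f d) alpha d j).
  by move=> dj; apply: kerV_stable.
split; [|split; [|split; [|split]]].
- split; first exact: (zero_degree_not_fg_module d_ge fd alpha_nc).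
  exact: Fbasis_rank cP.
- by split; [exact: (zero_degree_not_fg_algebra d_ge fd alpha_nc)|].
- exact: Fbasis_mod_iso cP.
- split; first exact: (zero_degree_dsum d_ge fd alpha_nc).
  split.
    apply: is_dsum_tmod; first exact: (CenF_dsum6 d_ge fd).
    move=> i _; case: i => -[|[|[|[|[|[|//]]]]]] lt /=.
    + exact: fam_sum_stable (@diag_submod _ _) diag_st.
    + exact: fam_sum_stable (@C_line_submod _ _ _) C_st.
    + by apply: star_C_space_stable.
    + by apply: CenFle_stable.
    + by apply: fam_sum_stable kH_st => j _; apply: kerH_submod.
    + by apply: fam_sum_stable kV_st => j _; apply: kerV_submod.
  split; first by apply: is_dsum_tmod => //; apply: diag_dsum.
  split; first exact: (infinite_diag d_ge).
  split; first by apply: is_dsum_tmod => //; apply: C_space_dsum.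
  by split; apply: is_dsum_tmod.
- split; first by apply: comm_space_F => x y; apply: (zero_degree_comm d_ge fd alpha_nc).
  split; first exact: (CenF_infinite d_ge fd).
  exact: Fbasis_torsion cP.
Qed.

End PartTwo.

(** * Scalars plus finite matrices *)

Section ScalarPart.
Context {K : fieldType} {charK : charZero K}.
Context {lambda : K} {f : I1 K} {d : int}.
Hypotheses (d_ge : -1 <= d) (fd : Fle d f).
Implicit Types (x y : I1 K).

Local Notation alpha := (lambda%:P : {poly K}).
Local Notation a := (evalH lambda%:P + f).
Local Notation b := (a11 lambda%:P f d).
Local Notation P := (@e_le K d).
Local Notation Q := (@e_gt K d).
Local Notation D := (absz (d + 1)%R).
Local Notation KH := (kerl (H0 d) f).
Local Notation KV := (kerr (V0 d) f).

Lemma aME x : a * x = lambda *: x + f * x.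
Proof. by rewrite mulrDl evalHC mulr_algl. Qed.

Lemma MaE x : x * a = lambda *: x + x * f.
Proof. by rewrite mulrDr evalHC -scalerAr mulr1. Qed.

Lemma scalar_Cen x : centralizer a x <-> centralizer f x.
Proof.
rewrite /centralizer /= aME MaE; split=> [/addrI //|->//].
Qed.

Lemma kerl_scalar j : kerl (H0 d) (b - alpha.[j.+1%:R]%:A) = KH.
Proof.
have E x : H0 d x -> (b - alpha.[j.+1%:R]%:A) * x = f * x.
  move=> Hx; rewrite (b_eigen d_ge fd); last exact: P_H0.
  by rewrite aME hornerC addrAC subrr add0r.
by apply/seteqP; split=> x [Hx x0]; split=> //; [rewrite -E|rewrite E].
Qed.

Lemma kerr_scalar i : kerr (V0 d) (b - alpha.[i.+1%:R]%:A) = KV.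
Proof.
have E x : V0 d x -> x * (b - alpha.[i.+1%:R]%:A) = x * f.
  move=> Vx; rewrite (eigen_b d_ge fd); last exact: V0_P.
  by rewrite MaE hornerC addrAC subrr add0r.
by apply/seteqP; split=> x [Vx x0]; split=> //; [rewrite -E|rewrite E].
Qed.

Lemma kerH_scalar : kerH b alpha d = fun j => [set u * e 0 j | u in KH].
Proof. by apply/funext => j; rewrite /kerH kerl_scalar. Qed.

Lemma kerV_scalar : kerV b alpha d = fun i => [set e i 0 * u | u in KV].
Proof. by apply/funext => i; rewrite /kerV kerr_scalar. Qed.

Lemma CenFle_scalar : CenFle d b = CenFle d f.
Proof.
apply/seteqP; split=> x [Fx Cx]; split=> //.
  by apply/scalar_Cen/(Fle_Cen d_ge fd Fx).
by apply/(Fle_Cen d_ge fd Fx)/scalar_Cen.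
Qed.

Lemma fQ : f * Q = 0.
Proof. by rewrite mulrBr mulr1 (Fle_P d_ge fd) subrr. Qed.

Lemma Qf : Q * f = 0.
Proof. by rewrite mulrBl mul1r (P_Fle d_ge fd) subrr. Qed.

Lemma QxQ_Cen x : centralizer a (Q * x * Q).
Proof. by apply/scalar_Cen; rewrite /centralizer /= !mulrA fQ !mul0r -(mulrA _ Q f) Qf mulr0. Qed.

Lemma corner_submod : is_submod [set Q * x * Q | x in [set: I1 K]].
Proof.
apply: image_submod => [|l x y]; first by [].
by rewrite (mulrDr Q (l *: x)) (mulrDl _ _ Q) -scalerAr -scalerAl.
Qed.

Definition four_supports (i k l : nat) : Prop :=
  match i with
  | 0 => k%:Z <= d /\ l%:Z <= d
  | 1 => k%:Z <= d /\ d < l%:Z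
  | 2 => l%:Z <= d /\ d < k%:Z
  | _ => d < k%:Z /\ d < l%:Z
  end.

Lemma scalar_dsum : is_dsum_seq
  [:: CenFle d b; fam_sum (idx_gt d) (kerH b alpha d); fam_sum (idx_gt d) (kerV b alpha d);
      [set Q * x * Q | x in [set: I1 K]]] (Cen a).
Proof.
have CS := Cen_submod a.
apply: (@dsum_seq_supp _ _ _ _ four_supports) => //.
- move=> -[|[|[|[|//]]]] _ /=.
  + exact: CenFle_submod.
  + by apply: fam_sum_submod => j _; apply: kerH_submod.
  + by apply: fam_sum_submod => j _; apply: kerV_submod.
  + exact: corner_submod.
- move=> -[|[|[|[|//]]]] _ /=.
  + by move=> x /(CenFle_CenF d_ge fd) [].
  + by apply: fam_sum_sub => // j dj x kx; exact: (kerH_Cen d_ge fd dj kx).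
  + by apply: fam_sum_sub => // j dj x kx; exact: (kerV_Cen d_ge fd dj kx).
  + by move=> _ [x _ <-]; apply: QxQ_Cen.
- move=> S SS sS x Cx; have [_ SD _] := SS; rewrite (block_dec d_ge x).
  have /= s0 := sS 0%N isT; have /= s1 := sS 1%N isT; have /= s2 := sS 2%N isT.
  have /= s3 := sS 3%N isT.
  apply: (SD); [apply: (SD); [apply: (SD)|]|].
  + by pose proof (in_CenFle d_ge fd Cx); apply: s0.
  + by pose proof (PxQ_fam_sum d_ge fd Cx); apply: s1.
  + by pose proof (QxP_fam_sum d_ge fd Cx); apply: s2.
  + by apply: s3; exists x.
- move=> -[|[|[|[|//]]]] x k l _ /= sx n.
  + by case: sx => /FleP Fx _; apply: Fx.
  + exact: (kerH_sum_supp d_ge sx n).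
  + exact: (kerV_sum_supp d_ge sx n).
  + move: sx => [y _ <-]; rewrite (cf_MQ d_ge) (cf_QM d_ge).
    by case: ifP => // ld; case: ifP => // kd; case: n; lia.
- by move=> -[|[|[|[|//]]]] -[|[|[|[|//]]]] k l _ _ //= Ri Ri'; lia.
Qed.

(** ** The corner is a copy of the whole algebra *)

(** Since [opD ^+ D * opI ^+ D = 1], this is an isomorphism of the whole algebra
    onto the corner [Q * I1 * Q], with [Q] as unit. *)
Definition shift x : I1 K := opI ^+ D * x * opD ^+ D.

Lemma opDIX n : opD ^+ n * opI ^+ n = 1 :> I1 K.
Proof.
elim: n => [|n IH]; first by rewrite mulr1.
by rewrite exprSr exprS mulrA -(mulrA _ opD) (opDI charK) mulr1 IH.
Qed.

Lemma shiftM x y : shift (x * y) = shift x * shift y.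
Proof. by rewrite /shift !mulrA -(mulrA _ (opD ^+ D) (opI ^+ D)) opDIX mulr1. Qed.

Lemma shift1 : shift 1 = Q.
Proof.
rewrite /shift mulr1; apply: cf_inj => k j.
rewrite -[Q]mul1r (cf_MQ d_ge) cf1.
rewrite cf_opIXM -[opD ^+ _]mulr1 cf_opDXM cf1.
have -> : (j%:Z <= d) = (j < D)%N by lia.
case: (leqP D k) => [le|lt].
  by rewrite subnK //; case: ltnP => // ltj; rewrite (_ : (k == j) = false) //; lia.
by case: ltnP => // le; rewrite (_ : (k == j) = false) //; lia.
Qed.

Lemma QxQ_shift x : Q * x * Q = shift (opD ^+ D * x * opI ^+ D).
Proof. by rewrite -shift1 /shift !mulr1 !mulrA. Qed.

Lemma shift_Cen x : centralizer a (shift x).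
Proof.
have -> : shift x = Q * shift x * Q by rewrite -shift1 -!shiftM mul1r mulr1.
exact: QxQ_Cen.
Qed.

Lemma shift_subalg (W : set (I1 K)) : is_subalg W -> W (shift 1) -> W (shift opX) ->
  W (shift opD) -> W (shift opI) -> forall x, W (shift x).
Proof.
move=> [[_ WD WZ] _ WM] W1 WX WDD WI; elim/(@I1_ind K) => // [l x y Wx Wy|x y Wx Wy].
  have -> : shift (l *: x + y) = l *: shift x + shift y.
    by rewrite /shift mulrDr mulrDl -scalerAr -scalerAl.
  by apply: WD => //; apply: WZ.
by rewrite shiftM; apply: WM.
Qed.

Lemma corner_finite : exists s : seq (I1 K),
  [set x | centralizer a x /\ Fle (d + 1) x] = smallest (@is_submod K (I1 K)) [set` s].
Proof.
apply: (@finite_span _ _ _ _ (@window K D.+1 D.+1)).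
  have [[C0 CD CZ] [F0' FD' FZ']] := (Cen_submod a, Kspan_submod [set x : I1 K |
    exists i j : nat, [/\ i%:Z <= d + 1, j%:Z <= d + 1 & x = e i j]]).
  split=> [|x y [Cx Fx] [Cy Fy]|l x [Cx Fx]]; split=> //;
    [exact: CD|exact: FD'|exact: CZ|exact: FZ'].
move=> x [_ /FleP Fx] x0; apply: cf_inj => k j; rewrite cf0.
have [ltk|lek] := ltnP k D.+1; last by apply: Fx; lia.
have [ltj|lej] := ltnP j D.+1; last by apply: Fx; lia.
by have /matrixP /(_ (Ordinal ltk) (Ordinal ltj)) := x0; rewrite !mxE.
Qed.

(** Besides the corner, which is generated by the images of the generators of
    the algebra, a finite block generates the centralizer: the matrix units
    [e_Dj] of the corner move its last row and column. *)
Lemma scalar_fg_algebra : fg_algebra (CenA a).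
Proof.
have [s sE] := corner_finite.
apply: (subalg_fg_algebra (s := s ++ [:: shift 1; shift opX; shift opD; shift opI])).
  move=> x; rewrite mem_cat !inE => /orP [sx|/or4P [] /eqP ->]; try exact: shift_Cen.
  have : smallest (@is_submod K (I1 K)) [set` s] x by apply: gen_in_span.
  by rewrite -sE => -[].
move=> W WA Ws; have Wsub := subalg_submod WA; have [_ _ WM] := WA.
have Wfin : [set x | centralizer a x /\ Fle (d + 1) x] `<=` W.
  by rewrite sE; apply: span_least => // y ys; apply: Ws; rewrite mem_cat ys.
have Wshift x : W (shift x).
  by apply: shift_subalg => //; apply: Ws; rewrite mem_cat !inE eqxx ?orbT.
have We k l : d < k%:Z -> d < l%:Z -> W (e k l).
  move=> dk dl; have -> : e k l = Q * e k l * Q; last by rewrite QxQ_shift.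
  apply: cf_inj => i j; rewrite (cf_MQ d_ge) (cf_QM d_ge) cf_e.
  by case: ifP => jd; [|case: ifP => // id]; rewrite (_ : _ && _ = false) //; lia.
have dD : d < D%:Z by lia.
move=> x Cx; rewrite (block_dec d_ge x); have [_ WD _] := Wsub.
apply: (WD); [apply: (WD); [apply: (WD)|]|].
- apply: Wfin; split; last first.
    apply/FleP => k j n; apply: ((FleP _ _).1 (PxP_Fle d_ge x)); lia.
  have [_ Cb] := in_CenFle d_ge fd Cx.
  by apply/(Fle_Cen d_ge fd (PxP_Fle d_ge x)).
- pose proof (PxQ_fam_sum d_ge fd Cx) as h; move: h; rewrite kerH_scalar.
  apply: fam_sum_sub => // j dj _ [w Hw <-].
  have -> : w * e 0 j = w * e 0 D * e D j by rewrite -mulrA e_eqM.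
  apply: WM; last exact: We.
  have kD : kerH b alpha d D (w * e 0 D) by rewrite kerH_scalar; exists w.
  apply: Wfin; split; first exact: (kerH_Cen d_ge fd dD kD).
  by apply/FleP => k l n; apply: (kerH_supp d_ge kD) => -[kd lD]; apply: n; lia.
- pose proof (QxP_fam_sum d_ge fd Cx) as h; move: h; rewrite kerV_scalar.
  apply: fam_sum_sub => // i di _ [w Vw <-].
  have -> : e i 0 * w = e i D * (e D 0 * w) by rewrite mulrA e_eqM.
  apply: WM; first exact: We.
  have kD : kerV b alpha d D (e D 0 * w) by rewrite kerV_scalar; exists w.
  apply: Wfin; split; first exact: (kerV_Cen d_ge fd dD kD).
  by apply/FleP => k l n; apply: (kerV_supp d_ge kD) => -[ld kD']; apply: n; lia.
- by rewrite QxQ_shift.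
Qed.

(** Far along the diagonal, [a] acts as a scalar and the entries of any element
    are the values of a polynomial: this property is inherited by the generated
    submodule, but [e_jj] for large [j] violates it. *)
Lemma scalar_not_fg_module : ~ fg_module (CenM a).
Proof.
move=> /fg_module_generates [s [sC sW]].
pose W N := [set x : I1 K | exists h : {poly K}, forall j, (D + N <= j)%N ->
  cf x j j = h.[j.+1%:R]].
have [N NP] : exists N, forall x, x \in s -> W N x.
  elim: s {sC sW} => [|x s [N NP]]; first by exists 0%N.
  have [c [B [_ cE]]] := has_symbol_ex x.
  exists (maxn N B) => y; rewrite inE => /orP [/eqP ->|/NP [g gP]]; last first.
    by exists g => j le; apply: gP; lia.
  by exists (c 0) => j le; rewrite cE ?subrr //; lia.
pose n := (D + N)%N.
have : W N (e n n).
  apply: (sW (W N)) => //; last exact: (diag_Cen d_ge fd N).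
    split=> [|x y [h hP] [g gP]|l x [h hP]].
    - by exists 0 => j _; rewrite cf0 horner0.
    - by exists (h + g) => j le; rewrite cfD hP ?gP // hornerD.
    - by exists (l *: h) => j le; rewrite cfZ hP // hornerZ.
  move=> x [h hP]; exists (lambda *: h) => j le.
  by rewrite (cf_aM fd) ?hP ?hornerC ?hornerZ //; lia.
move=> [h hP]; have h0 : h = 0.
  apply: (@poly_nat_eq0 _ _ _ n.+2) => -[//|k] lt.
  have := hP k; rewrite cf_e (_ : (n == k) = false) ?andbF /=; last by lia.
  by move=> <- //; lia.
have := hP n (leqnn _); rewrite h0 horner0 cf_e !eqxx => /eqP.
by rewrite oner_eq0.
Qed.

Lemma scalar_torsion : f != 0 -> torsion (Cen_mod a) = Cen a :> set (I1 K).
Proof.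
move=> f0; apply/seteqP; split=> [x []|x Cx] //; split=> //.
have Cf : CenF a f by split; [exact: Fle_F fd|apply/scalar_Cen].
have [p p0 pf] := CenF_torsion Cf.
exists (p * ('X - lambda%:P)); split; first by rewrite mulf_neq0 // polyXsubC_eq0.
suff pa : horner_alg a (p * ('X - lambda%:P)) = 0.
  suff : (horner_alg a (p * ('X - lambda%:P)) : I1 K) * (x : I1 K) = 0 by [].
  by rewrite pa mul0r.
rewrite rmorphM rmorphB /= horner_algX horner_algC -[X in _ * X]/(evalH lambda%:P + f - lambda%:A).
by rewrite evalHC addrAC subrr add0r -evalHC.
Qed.

Lemma Q_notF : ~ F Q.
Proof.
move=> FQ; apply: (@notF1 K charK); rewrite -(subrK P 1); apply: FD => //.
exact: P_F.
Qed.

(** The corner contains copies of [opD] and [opX], whose commutator is its unit. *)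
Lemma scalar_commutator : ~ (commutator_space (Cen a) `<=` CenF a).
Proof.
move=> sub; apply: Q_notF.
have [] : CenF a Q; last by [].
apply: sub; rewrite -shift1; apply: gen_in_span.
exists (shift opD); first exact: shift_Cen.
exists (shift opX); first exact: shift_Cen.
rewrite -!shiftM /shift -mulrBl -mulrBr; congr (_ * _ * _).
by rewrite opDX addrAC subrr add0r.
Qed.

End ScalarPart.

Section PartThree.
Context {K : fieldType} {charK : charZero K}.

Theorem scalar_Cen_structure (a : I1 K) : [set x + y | x in KI1 & y in F] a -> ~ KI1 a ->
    forall (lambda : K) (f : I1 K), F f -> f <> 0 -> a = lambda%:A + f ->
    forall d : int, d = degF f ->
      (fg_algebra (CenA a) /\ ~ left_noetherian (CenA a) /\
       ~ right_noetherian (CenA a) /\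
       has_infinite_dsum (@left_ideal K (CenA a)) /\
       has_infinite_dsum (@right_ideal K (CenA a)) /\
       ~ fg_module (CenM a)) /\
      (is_dsum_seq
         [:: CenFle d f;
             fam_sum (idx_gt d) (fun j => [set u * e 0 j | u in kerl (H0 d) f]);
             fam_sum (idx_gt d) (fun i => [set e i 0 * u | u in kerr (V0 d) f]);
             [set e_gt d * x * e_gt d | x in [set: I1 K]]]
         (Cen a) /\
       is_dsum (idx_gt d) (fun j => [set u * e 0 j | u in kerl (H0 d) f])
         (fam_sum (idx_gt d) (fun j => [set u * e 0 j | u in kerl (H0 d) f])) /\
       is_dsum (idx_gt d) (fun i => [set e i 0 * u | u in kerr (V0 d) f])
         (fam_sum (idx_gt d) (fun i => [set e i 0 * u | u in kerr (V0 d) f]))) /\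
      (~ (commutator_space (Cen a) `<=` CenF a) /\ ~ finite_dim (CenF a) /\
       torsion (Cen_mod a) = Cen a :> set (I1 K) /\
       (Cen a : set (I1 K)) <> CenF a).
Proof.
move=> _ _ lambda f Ff f0 aE d dE.
have [d_ge fd] : -1 <= d /\ Fle d f.
  have := @degFP K charK 0 f Ff; rewrite /evalH rmorph0 add0r -dE; apply.
have {}aE : a = evalH lambda%:P + f by rewrite evalHC.
subst a.
pose proof (diag_chain (alpha := lambda%:P) d_ge fd) as [dl dr nl nr].
have kHE := kerH_scalar (lambda := lambda) d_ge fd.
have kVE := kerV_scalar (lambda := lambda) d_ge fd.
split; [|split].
- split; first exact: (scalar_fg_algebra d_ge fd).
  split; [exact: nl|split; [exact: nr|split; [exact: dl|split; [exact: dr|]]]].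
  exact: (scalar_not_fg_module d_ge fd).
- rewrite -kHE -kVE -(CenFle_scalar (lambda := lambda) d_ge fd).
  split; first exact: scalar_dsum.
  by split; [apply: kerH_dsum|apply: kerV_dsum].
- split; first exact: (scalar_commutator d_ge fd).
  split; first exact: (CenF_infinite d_ge fd).
  split; first by apply: (scalar_torsion fd); apply/eqP.
  move=> E; have [] : CenF (evalH lambda%:P + f) 1 by rewrite -E; apply: Cen1.
  by move=> /notF1.
Qed.

End PartThree.

Theorem theorem5p7 (K : fieldType) (charK : [pchar K] =i pred0) :
  (forall a : I1 K, ~ [set x + y | x in KH & y in F] a ->
    exists rho : nat,
      ((1 <= rho)%N /\ fg_module (CenM a) /\ has_rank (CenM a) rho /\
       fg_algebra (CenA a) /\ left_noetherian (CenA a) /\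
       right_noetherian (CenA a)) /\
      (mod_iso (CenM a) ({ffun 'I_rho -> KalgM a} * CenFM charK a)%type /\
       (pi_minus a < 0 -> (rho %| absz (pi_minus a))%N) /\
       (0 < pi_plus a -> (rho %| absz (pi_plus a))%N)) /\
      (commutator_space (Cen a) `<=` CenF a /\ finite_dim (CenF a) /\
       CenF a = torsion (Cen_mod a))) /\
  (forall a : I1 K, [set x + y | x in KH & y in F] a ->
      ~ [set x + y | x in KI1 & y in F] a ->
    forall (alpha : {poly K}) (f : I1 K), F f -> a = evalH alpha + f ->
    forall d : int, d = degF a -> forall rho : nat, rho = (size alpha).-1 ->
      (~ fg_module (CenM a) /\ has_rank (CenM a) rho) /\
      (~ fg_algebra (CenA a) /\ ~ left_noetherian (CenA a) /\
       ~ right_noetherian (CenA a) /\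
       has_infinite_dsum (@left_ideal K (CenA a)) /\
       has_infinite_dsum (@right_ideal K (CenA a))) /\
      mod_iso (CenM a) ({ffun 'I_rho -> KalgM a} * CenFM charK a)%type /\
      (is_dsum_seq [:: [set e_gt d * h | h in KH]; CenF a] (Cen a) /\
       @is_dsum_seq {poly K} (tmod a)
         [:: fam_sum (idx_gt d) diag_line;
             C_space alpha d;
             star @` C_space alpha d;
             CenFle d (a11 alpha f d);
             fam_sum (idx_gt d) (kerH (a11 alpha f d) alpha d);
             fam_sum (idx_gt d) (kerV (a11 alpha f d) alpha d)]
         (CenF a) /\
       @is_dsum {poly K} (tmod a) nat (idx_gt d) diag_line
         (fam_sum (idx_gt d) diag_line) /\
       infinite_set [set j | idx_gt d j /\ @diag_line K j <> [set 0]] /\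
       @is_dsum {poly K} (tmod a) (nat * nat)%type (C_index alpha d) C_line
         (C_space alpha d) /\
       @is_dsum {poly K} (tmod a) nat (idx_gt d) (kerH (a11 alpha f d) alpha d)
         (fam_sum (idx_gt d) (kerH (a11 alpha f d) alpha d)) /\
       @is_dsum {poly K} (tmod a) nat (idx_gt d) (kerV (a11 alpha f d) alpha d)
         (fam_sum (idx_gt d) (kerV (a11 alpha f d) alpha d))) /\
      (commutator_space (Cen a) `<=` CenF a /\ ~ finite_dim (CenF a) /\
       CenF a = torsion (Cen_mod a))) /\
  (forall a : I1 K, [set x + y | x in KI1 & y in F] a -> ~ KI1 a ->
    forall (lambda : K) (f : I1 K), F f -> f <> 0 -> a = lambda%:A + f ->
    forall d : int, d = degF f ->
      (fg_algebra (CenA a) /\ ~ left_noetherian (CenA a) /\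
       ~ right_noetherian (CenA a) /\
       has_infinite_dsum (@left_ideal K (CenA a)) /\
       has_infinite_dsum (@right_ideal K (CenA a)) /\
       ~ fg_module (CenM a)) /\
      (is_dsum_seq
         [:: CenFle d f;
             fam_sum (idx_gt d) (fun j => [set u * e 0 j | u in kerl (H0 d) f]);
             fam_sum (idx_gt d) (fun i => [set e i 0 * u | u in kerr (V0 d) f]);
             [set e_gt d * x * e_gt d | x in [set: I1 K]]]
         (Cen a) /\
       is_dsum (idx_gt d) (fun j => [set u * e 0 j | u in kerl (H0 d) f])
         (fam_sum (idx_gt d) (fun j => [set u * e 0 j | u in kerl (H0 d) f])) /\
       is_dsum (idx_gt d) (fun i => [set e i 0 * u | u in kerr (V0 d) f])
         (fam_sum (idx_gt d) (fun i => [set e i 0 * u | u in kerr (V0 d) f]))) /\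
      (~ (commutator_space (Cen a) `<=` CenF a) /\ ~ finite_dim (CenF a) /\
       torsion (Cen_mod a) = Cen a :> set (I1 K) /\
       (Cen a : set (I1 K)) <> CenF a)).
Proof.
split; first exact: (@nonzero_degree_Cen K charK).
split; first exact: (@zero_degree_Cen K charK).
exact: (@scalar_Cen_structure K charK).
Qed.
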